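(* The category $\mathscr{Z}(\mathrm{Ver}_5^+)$ has exactly $10$ indecomposable objects up to isomorphism.
   Context: $\mathbf{k}$ is an algebraically closed field of characteristic $5$. $\mathrm{Ver}_5$ is the Verlinde category: the symmetric fusion category over $\mathbf{k}$ obtained as the semisimplification (quotient by negligible morphisms) of $\mathrm{Rep}_{\mathbf{k}}(\mathbb{Z}/5\mathbb{Z})$. Its simple objects are $L_1=\mathbf{1},L_2,L_3,L_4$, with $L_2\otimes L_i=L_{i-1}\oplus L_{i+1}$ (where $L_0=L_5=0$). $\mathrm{Ver}_5^+\subset\mathrm{Ver}_5$ is the fusion subcategory with simple objects $\mathbf{1}$ and $X:=L_3$, where $X\otimes X=\mathbf{1}\oplus X$. $\mathscr{Z}(\mathrm{Ver}_5^+)$ is its Drinfeld center, a finite braided tensor category over $\mathbf{k}$. *)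

(* Defs.v *)
From HB Require Import structures.
From mathcomp Require Import all_boot all_order all_algebra all_fingroup all_character.
From mathcomp Require Import generic_quotient ring_quotient boolp mxtens.

Set Implicit Arguments.
Unset Strict Implicit.
Unset Printing Implicit Defensive.

Import GRing.Theory.

Local Open Scope ring_scope.
Local Open Scope quotient_scope.

Reserved Notation "f ;; g" (at level 40, left associativity).
Reserved Notation "x \ox y" (at level 38, left associativity).
Reserved Notation "f \om g" (at level 38, left associativity).

(* Composition is in diagrammatic order, to match row-vector matrices. *)
Record linCat (k : fieldType) := LinCat {
  ob :> Type;
  hom : ob -> ob -> lmodType k;
  idm : forall x, hom x x;
  comp : forall x y z, hom x y -> hom y z -> hom x z;
  comp1m : forall x y (f : hom x y), comp (idm x) f = f;
  compm1 : forall x y (f : hom x y), comp f (idm y) = f;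
  compA : forall x y z t (f : hom x y) (g : hom y z) (h : hom z t),
    comp f (comp g h) = comp (comp f g) h;
  compPl : forall x y z a (f f' : hom x y) (g : hom y z),
    comp (a *: f + f') g = a *: comp f g + comp f' g;
  compPr : forall x y z a (f : hom x y) (g g' : hom y z),
    comp f (a *: g + g') = a *: comp f g + comp f g'
}.
Arguments hom {k l} x y.
Arguments idm {k l} x.
Arguments comp {k l x y z} f g.
Notation "f ;; g" := (comp f g).

Section LinCatTheory.
Context (k : fieldType) (C : linCat k).
Implicit Types x y z : C.

Definition is_iso x y (f : hom x y) : Prop :=
  exists g : hom y x, f ;; g = idm x /\ g ;; f = idm y.

Definition isomorphic x y : Prop := exists f : hom x y, is_iso f.

Definition is_zero x : Prop := idm x = 0.

(* [z] is the direct sum of the family [S], with inclusions [i] and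
   projections [p]. *)
Definition is_dsum (I : finType) (S : I -> C) z : Prop :=
  exists (i : forall a, hom (S a) z) (p : forall a, hom z (S a)),
    [/\ forall a, i a ;; p a = idm (S a),
        forall a b, a != b -> i a ;; p b = 0
      & \sum_a (p a ;; i a) = idm z].

Definition indecomposable z : Prop :=
  ~ is_zero z /\
  forall x y, is_dsum (fun b : bool => if b then x else y) z ->
              is_zero x \/ is_zero y.

Lemma compDl x y z (f f' : hom x y) (g : hom y z) :
  (f + f') ;; g = f ;; g + f' ;; g.
Proof. by have := compPl 1 f f' g; rewrite !scale1r. Qed.

Lemma compDr x y z (f : hom x y) (g g' : hom y z) :
  f ;; (g + g') = f ;; g + f ;; g'.
Proof. by have := compPr 1 f g g'; rewrite !scale1r. Qed.

Lemma comp0m x y z (g : hom y z) : (0 : hom x y) ;; g = 0.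
Proof. by apply: (addIr (0 ;; g)); rewrite -compDl !add0r. Qed.

Lemma compm0 x y z (f : hom x y) : f ;; (0 : hom y z) = 0.
Proof. by apply: (addIr (f ;; 0)); rewrite -compDr !add0r. Qed.

Lemma compZl x y z a (f : hom x y) (g : hom y z) : (a *: f) ;; g = a *: (f ;; g).
Proof. by have := compPl a f 0 g; rewrite comp0m !addr0. Qed.

Lemma compZr x y z a (f : hom x y) (g : hom y z) : f ;; (a *: g) = a *: (f ;; g).
Proof. by have := compPr a f g 0; rewrite compm0 !addr0. Qed.

Lemma compBl x y z (f f' : hom x y) (g : hom y z) :
  (f - f') ;; g = f ;; g - f' ;; g.
Proof. by rewrite compDl -scaleN1r compZl scaleN1r. Qed.

Lemma compBr x y z (f : hom x y) (g g' : hom y z) :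
  f ;; (g - g') = f ;; g - f ;; g'.
Proof. by rewrite compDr -scaleN1r compZr scaleN1r. Qed.

Lemma comp_suml x y z (I : finType) (F : I -> hom x y) (g : hom y z) :
  (\sum_a F a) ;; g = \sum_a (F a ;; g).
Proof. by elim/big_rec2: _ => [|a f f' _ <-]; rewrite ?comp0m ?compDl. Qed.

Lemma comp_sumr x y z (I : finType) (f : hom x y) (F : I -> hom y z) :
  f ;; (\sum_a F a) = \sum_a (f ;; F a).
Proof. by elim/big_rec2: _ => [|a g g' _ <-]; rewrite ?compm0 ?compDr. Qed.

Lemma is_dsum_iso x y : isomorphic x y -> is_dsum (fun _ : unit => x) y.
Proof.
case=> f [g [fg gf]]; exists (fun=> f), (fun=> g); split=> [a|[] []|] //.
by rewrite (big_pred1 tt) // => [[]].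
Qed.

Lemma is_dsum_sigma (I : finType) (S : I -> C) z (J : I -> finType)
    (T : forall a, J a -> C) :
  is_dsum S z -> (forall a, is_dsum (@T a) (S a)) ->
  is_dsum (fun u : {a : I & J a} => T (tag u) (tagged u)) z.
Proof.
case=> i [p [ip1 ip0 pi1]] dS.
pose j a := projT1 (cid (dS a)).
pose q a := projT1 (cid (projT2 (cid (dS a)))).
have jq a : [/\ forall c, j a c ;; q a c = idm (T a c),
        forall c d, c != d -> j a c ;; q a d = 0
      & \sum_c (q a c ;; j a c) = idm (S a)].
  exact: (projT2 (cid (projT2 (cid (dS a))))).
exists (fun u => j (tag u) (tagged u) ;; i (tag u)).
exists (fun u => p (tag u) ;; q (tag u) (tagged u)); split.
- move=> [a c] /=; have [q1 _ _] := jq a.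
  by rewrite compA -(compA _ (i a)) ip1 compm1 q1.
- move=> [a c] [b d] /= ne; rewrite compA -(compA _ (i a)).
  have [eab|neab] := eqVneq a b; last by rewrite ip0 // compm0 comp0m.
  case: _ / eab d ne => d ne; have [_ q0 _] := jq a.
  rewrite ip1 compm1 q0 //; apply: contraNneq ne => ->; exact: eqxx.
- rewrite -pi1.
  transitivity (\sum_a \sum_c (p a ;; q a c ;; (j a c ;; i a))).
    by rewrite sig_big_dep.
  apply: eq_bigr => a _; have [_ _ qj1] := jq a.
  rewrite -[p a in RHS]compm1 -qj1 comp_sumr comp_suml.
  by apply: eq_bigr => c _; rewrite !compA.
Qed.

End LinCatTheory.

Record monCat (k : fieldType) := MonCat {
  mcat :> linCat k;
  munit : mcat;
  tens : mcat -> mcat -> mcat;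
  tensm : forall x x' y y' : mcat,
    hom x x' -> hom y y' -> hom (tens x y) (tens x' y');
  tensm1 : forall x y, tensm (idm x) (idm y) = idm (tens x y);
  tensm_comp : forall x x' x'' y y' y'' (f : hom x x') (f' : hom x' x'')
    (g : hom y y') (g' : hom y' y''),
    tensm (f ;; f') (g ;; g') = tensm f g ;; tensm f' g';
  tensmPl : forall x x' y y' a (f f' : hom x x') (g : hom y y'),
    tensm (a *: f + f') g = a *: tensm f g + tensm f' g;
  tensmPr : forall x x' y y' a (f : hom x x') (g g' : hom y y'),
    tensm f (a *: g + g') = a *: tensm f g + tensm f g';
  assoc : forall x y z, hom (tens (tens x y) z) (tens x (tens y z));
  iassoc : forall x y z, hom (tens x (tens y z)) (tens (tens x y) z);
  assocK : forall x y z, assoc x y z ;; iassoc x y z = idm _;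
  iassocK : forall x y z, iassoc x y z ;; assoc x y z = idm _;
  assoc_nat : forall x x' y y' z z'
    (f : hom x x') (g : hom y y') (h : hom z z'),
    tensm (tensm f g) h ;; assoc x' y' z' =
    assoc x y z ;; tensm f (tensm g h);
  lunit : forall x, hom (tens munit x) x;
  lunit_iso : forall x, is_iso (lunit x);
  lunit_nat : forall x y (f : hom x y),
    tensm (idm munit) f ;; lunit y = lunit x ;; f;
  runit : forall x, hom (tens x munit) x;
  runit_iso : forall x, is_iso (runit x);
  runit_nat : forall x y (f : hom x y),
    tensm f (idm munit) ;; runit y = runit x ;; f;
  pentagon : forall x y z t,
    assoc (tens x y) z t ;; assoc x y (tens z t) =
    tensm (assoc x y z) (idm t) ;; assoc x (tens y z) t
      ;; tensm (idm x) (assoc y z t);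
  triangle : forall x y,
    assoc x munit y ;; tensm (idm x) (lunit y) = tensm (runit x) (idm y)
}.
Arguments munit {k m}.
Arguments tens {k m} x y.
Arguments tensm {k m x x' y y'} f g.
Arguments assoc {k m} x y z.
Arguments iassoc {k m} x y z.
Arguments lunit {k m} x.
Arguments runit {k m} x.
Notation "x \ox y" := (tens x y).
Notation "f \om g" := (tensm f g).

Section MonCatTheory.
Context (k : fieldType) (C : monCat k).
Implicit Types x y z : C.

Lemma tensmDl x x' y y' (f f' : hom x x') (g : hom y y') :
  (f + f') \om g = f \om g + f' \om g.
Proof. by have := tensmPl 1 f f' g; rewrite !scale1r. Qed.

Lemma tensmDr x x' y y' (f : hom x x') (g g' : hom y y') :
  f \om (g + g') = f \om g + f \om g'.
Proof. by have := tensmPr 1 f g g'; rewrite !scale1r. Qed.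

Lemma tens0m x x' y y' (g : hom y y') : (0 : hom x x') \om g = 0.
Proof. by apply: (addIr (0 \om g)); rewrite -tensmDl !add0r. Qed.

Lemma tensm0 x x' y y' (f : hom x x') : f \om (0 : hom y y') = 0.
Proof. by apply: (addIr (f \om 0)); rewrite -tensmDr !add0r. Qed.

Lemma tensmZl x x' y y' a (f : hom x x') (g : hom y y') :
  (a *: f) \om g = a *: (f \om g).
Proof. by have := tensmPl a f 0 g; rewrite tens0m !addr0. Qed.

Lemma tensmZr x x' y y' a (f : hom x x') (g : hom y y') :
  f \om (a *: g) = a *: (f \om g).
Proof. by have := tensmPr a f g 0; rewrite tensm0 !addr0. Qed.

Lemma tensmBl x x' y y' (f f' : hom x x') (g : hom y y') :
  (f - f') \om g = f \om g - f' \om g.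
Proof. by rewrite tensmDl -scaleN1r tensmZl scaleN1r. Qed.

Lemma tensmBr x x' y y' (f : hom x x') (g g' : hom y y') :
  f \om (g - g') = f \om g - f \om g'.
Proof. by rewrite tensmDr -scaleN1r tensmZr scaleN1r. Qed.

Lemma tensm_suml x x' y y' (I : finType) (F : I -> hom x x') (g : hom y y') :
  (\sum_a F a) \om g = \sum_a (F a \om g).
Proof. by elim/big_rec2: _ => [|a f f' _ <-]; rewrite ?tens0m ?tensmDl. Qed.

Lemma tensm_sumr x x' y y' (I : finType) (f : hom x x') (F : I -> hom y y') :
  f \om (\sum_a F a) = \sum_a (f \om F a).
Proof. by elim/big_rec2: _ => [|a g g' _ <-]; rewrite ?tensm0 ?tensmDr. Qed.

Lemma is_dsum_tens (I J : finType) (S : I -> C) (T : J -> C) x y :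
  is_dsum S x -> is_dsum T y ->
  is_dsum (fun u : I * J => S u.1 \ox T u.2) (x \ox y).
Proof.
case=> i [p [ip1 ip0 pi1]] [j [q [jq1 jq0 qj1]]].
exists (fun u => i u.1 \om j u.2), (fun u => p u.1 \om q u.2); split.
- by move=> [a b] /=; rewrite -tensm_comp ip1 jq1 tensm1.
- move=> [a b] [a' b'] /=; rewrite xpair_eqE negb_and -tensm_comp.
  by case/orP=> ne; [rewrite ip0 // tens0m | rewrite jq0 // tensm0].
- rewrite -tensm1 -pi1 -qj1 tensm_suml.
  under [RHS]eq_bigr => a _ do rewrite tensm_sumr.
  by rewrite pair_bigA /=; apply: eq_bigr => u _; rewrite tensm_comp.
Qed.

End MonCatTheory.

(* A tensor ideal: subgroups [null x y] of the Hom spaces, stable under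
   scaling, composition and tensor product with arbitrary morphisms. *)
Record tensIdeal (k : fieldType) (C : monCat k) := TensIdeal {
  null : forall x y : C, zmodClosed (hom x y);
  nullZ : forall x y a (f : hom x y), f \in null x y -> a *: f \in null x y;
  null_compl : forall x y z (f : hom x y) (g : hom y z),
    f \in null x y -> f ;; g \in null x z;
  null_compr : forall x y z (f : hom x y) (g : hom y z),
    g \in null y z -> f ;; g \in null x z;
  null_tensl : forall x x' y y' (f : hom x x') (g : hom y y'),
    f \in null x x' -> f \om g \in null (x \ox y) (x' \ox y');
  null_tensr : forall x x' y y' (f : hom x x') (g : hom y y'),
    g \in null y y' -> f \om g \in null (x \ox y) (x' \ox y')
}.

Section Quotient.
Context (k : fieldType) (C : monCat k) (N : tensIdeal C).
Implicit Types x y z : C.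

Definition qhom x y := Quotient.quot (null N x y).
HB.instance Definition _ x y := GRing.Zmodule.on (qhom x y).

Definition qpi x y (f : hom x y) : qhom x y := \pi f.

Lemma qpiP x y (f g : hom x y) : qpi f = qpi g <-> f - g \in null N x y.
Proof. by rewrite /qpi Quotient.idealrBE; split=> [->|/eqP]. Qed.

Lemma qpi_repr x y (F : qhom x y) : qpi (repr F) = F.
Proof. exact: reprK. Qed.

Lemma repr_qpi x y (f : hom x y) : repr (qpi f) - f \in null N x y.
Proof. by apply/qpiP; rewrite qpi_repr. Qed.

Lemma qpiD x y (f g : hom x y) : qpi (f + g) = qpi f + qpi g.
Proof. exact: (raddfD (\pi_(qhom x y))). Qed.

Lemma qpi_sum x y (I : finType) (F : I -> hom x y) :
  qpi (\sum_a F a) = \sum_a qpi (F a).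
Proof. exact: (raddf_sum (\pi_(qhom x y))). Qed.

Lemma qpi0 x y : qpi (0 : hom x y) = 0.
Proof. exact: (raddf0 (\pi_(qhom x y))). Qed.

Definition qscale x y a (F : qhom x y) : qhom x y := qpi (a *: repr F).

Lemma qscaleE x y a (f : hom x y) : qscale a (qpi f) = qpi (a *: f).
Proof. by apply/qpiP; rewrite -scalerBr nullZ ?repr_qpi. Qed.

Lemma qscaleA x y a b (F : qhom x y) : qscale a (qscale b F) = qscale (a * b) F.
Proof. by rewrite -(qpi_repr F) !qscaleE scalerA. Qed.

Lemma qscale1 x y : left_id 1 (@qscale x y).
Proof. by move=> F; rewrite -(qpi_repr F) qscaleE scale1r. Qed.

Lemma qscaleDr x y : right_distributive (@qscale x y) +%R.
Proof.
by move=> a F G; rewrite -(qpi_repr F) -(qpi_repr G) -qpiD !qscaleE scalerDr qpiD.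
Qed.

Lemma qscaleDl x y (F : qhom x y) : {morph (@qscale x y)^~ F : a b / a + b}.
Proof. by move=> a b; rewrite -(qpi_repr F) !qscaleE scalerDl qpiD. Qed.

HB.instance Definition _ x y :=
  GRing.Zmodule_isLmodule.Build k (qhom x y)
    (@qscaleA x y) (@qscale1 x y) (@qscaleDr x y) (@qscaleDl x y).

Lemma qpiZ x y a (f : hom x y) : qpi (a *: f) = a *: qpi f.
Proof. by rewrite -qscaleE. Qed.

(* The locks only keep unification from unfolding these two operations. *)
Fact quot_key : unit. Proof. exact: tt. Qed.

Definition qcomp x y z (F : qhom x y) (G : qhom y z) : qhom x z :=
  locked_with quot_key (qpi (repr F ;; repr G)).

Definition qtensm x x' y y' (F : qhom x x') (G : qhom y y') :
  qhom (x \ox y) (x' \ox y') :=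
  locked_with quot_key (qpi (repr F \om repr G)).

Lemma qcompE x y z (f : hom x y) (g : hom y z) :
  qcomp (qpi f) (qpi g) = qpi (f ;; g).
Proof.
rewrite [LHS]unlock; apply/qpiP; set f' := repr _; set g' := repr _.
have -> : f' ;; g' - f ;; g = (f' - f) ;; g' + f ;; (g' - g).
  by rewrite compBl compBr addrA subrK.
by apply: rpredD; [apply: null_compl | apply: null_compr]; apply: repr_qpi.
Qed.

Lemma qtensmE x x' y y' (f : hom x x') (g : hom y y') :
  qtensm (qpi f) (qpi g) = qpi (f \om g).
Proof.
rewrite [LHS]unlock; apply/qpiP; set f' := repr _; set g' := repr _.
have -> : f' \om g' - f \om g = (f' - f) \om g' + f \om (g' - g).
  by rewrite tensmBl tensmBr addrA subrK.
by apply: rpredD; [apply: null_tensl | apply: null_tensr]; apply: repr_qpi.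
Qed.

Lemma qhomW x y (P : qhom x y -> Prop) : (forall f, P (qpi f)) -> forall F, P F.
Proof. by move=> Pf F; rewrite -(qpi_repr F). Qed.

Definition quotCat : linCat k.
Proof.
refine (@LinCat k C qhom (fun x => qpi (idm x)) qcomp _ _ _ _ _).
- by move=> x y; elim/qhomW=> f; rewrite qcompE comp1m.
- by move=> x y; elim/qhomW=> f; rewrite qcompE compm1.
- move=> x y z t; elim/qhomW=> f; elim/qhomW=> g; elim/qhomW=> h.
  by rewrite !qcompE compA.
- move=> x y z a; elim/qhomW=> f; elim/qhomW=> g; elim/qhomW=> h.
  by rewrite -qpiZ -qpiD !qcompE -qpiZ -qpiD compPl.
- move=> x y z a; elim/qhomW=> f; elim/qhomW=> g; elim/qhomW=> h.
  by rewrite -qpiZ -qpiD !qcompE -qpiZ -qpiD compPr.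
Defined.

Lemma qcompEc (x y z : quotCat) (f : @hom k C x y) (g : @hom k C y z) :
  (qpi f : hom x y) ;; (qpi g : hom y z) = qpi (f ;; g).
Proof. exact: qcompE. Qed.

Lemma qpi_iso (x y : quotCat) (f : @hom k C x y) :
  is_iso f -> is_iso (qpi f : hom x y).
Proof.
by case=> g [fg gf]; exists (qpi g); rewrite !qcompEc fg gf.
Qed.

Definition quotMonCat : monCat k.
Proof.
refine (@MonCat k quotCat munit (fun x y : C => x \ox y) qtensm _ _ _ _
  (fun x y z : C => qpi (assoc x y z)) (fun x y z : C => qpi (iassoc x y z))
  _ _ _ (fun x : C => qpi (lunit x)) _ _ (fun x : C => qpi (runit x)) _ _ _ _).
- by move=> x y; rewrite /= qtensmE tensm1.
- move=> x x' x'' y y' y''.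
  elim/qhomW=> f; elim/qhomW=> f'; elim/qhomW=> g; elim/qhomW=> g'.
  by rewrite /= !qcompE !qtensmE !qcompE tensm_comp.
- move=> x x' y y' a; elim/qhomW=> f; elim/qhomW=> f'; elim/qhomW=> g.
  by rewrite -qpiZ -qpiD !qtensmE -qpiZ -qpiD tensmPl.
- move=> x x' y y' a; elim/qhomW=> f; elim/qhomW=> g; elim/qhomW=> g'.
  by rewrite -qpiZ -qpiD !qtensmE -qpiZ -qpiD tensmPr.
- by move=> x y z; rewrite /= qcompE assocK.
- by move=> x y z; rewrite /= qcompE iassocK.
- move=> x x' y y' z z'; elim/qhomW=> f; elim/qhomW=> g; elim/qhomW=> h.
  by rewrite /= !qtensmE !qcompE assoc_nat.
- by move=> x; apply/qpi_iso/lunit_iso.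
- by move=> x y; elim/qhomW=> f; rewrite /= qtensmE !qcompE lunit_nat.
- by move=> x; apply/qpi_iso/runit_iso.
- by move=> x y; elim/qhomW=> f; rewrite /= qtensmE !qcompE runit_nat.
- by move=> x y z t; rewrite /= !qtensmE !qcompE pentagon.
- by move=> x y; rewrite /= !qtensmE !qcompE triangle.
Defined.

End Quotient.

Section FullSub.
Context (k : fieldType) (C : monCat k) (P : C -> Prop).
Hypotheses (P1 : P munit) (PT : forall x y, P x -> P y -> P (x \ox y)).

Definition subCat : linCat k :=
  @LinCat k {x : C | P x} (fun x y => hom (sval x) (sval y))
    (fun x => idm (sval x)) (fun x y z f g => f ;; g)
    (fun x y f => comp1m f) (fun x y f => compm1 f)
    (fun x y z t f g h => compA f g h)
    (fun x y z a f f' g => compPl a f f' g)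
    (fun x y z a f g g' => compPr a f g g').

Definition subMonCat : monCat k :=
  @MonCat k subCat (exist P munit P1)
    (fun x y => exist P (sval x \ox sval y) (PT (svalP x) (svalP y)))
    (fun x x' y y' f g => f \om g)
    (fun x y => tensm1 (sval x) (sval y))
    (fun x x' x'' y y' y'' f f' g g' => tensm_comp f f' g g')
    (fun x x' y y' a f f' g => tensmPl a f f' g)
    (fun x x' y y' a f g g' => tensmPr a f g g')
    (fun x y z => assoc (sval x) (sval y) (sval z))
    (fun x y z => iassoc (sval x) (sval y) (sval z))
    (fun x y z => assocK (sval x) (sval y) (sval z))
    (fun x y z => iassocK (sval x) (sval y) (sval z))
    (fun x x' y y' z z' f g h => assoc_nat f g h)
    (fun x => lunit (sval x)) (fun x => lunit_iso (sval x))
    (fun x y f => lunit_nat f)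
    (fun x => runit (sval x)) (fun x => runit_iso (sval x))
    (fun x y f => runit_nat f)
    (fun x y z t => pentagon (sval x) (sval y) (sval z) (sval t))
    (fun x y => triangle (sval x) (sval y)).

End FullSub.

Section Center.
Context (k : fieldType) (C : monCat k).

(* An object of the Drinfeld center: an object with a half-braiding
   [Y \ox Z -> Z \ox Y], natural in [Y] and satisfying the hexagon axiom. *)
Record halfBraided := HalfBraided {
  hb_ob : C;
  hb : forall Y : C, hom (Y \ox hb_ob) (hb_ob \ox Y);
  hb_iso : forall Y, is_iso (hb Y);
  hb_nat : forall Y Y' (f : hom Y Y'),
    (f \om idm hb_ob) ;; hb Y' = hb Y ;; (idm hb_ob \om f);
  hb_hex : forall X Y,
    hb (X \ox Y) = assoc X Y hb_ob ;; (idm X \om hb Y)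
      ;; iassoc X hb_ob Y ;; (hb X \om idm Y) ;; assoc hb_ob X Y
}.

Definition braided (Z W : halfBraided) : {pred hom (hb_ob Z) (hb_ob W)} :=
  fun f => `[< forall Y, (idm Y \om f) ;; hb W Y = hb Z Y ;; (f \om idm Y) >].
Arguments braided : clear implicits.

Lemma braided_submod Z W : submod_closed (braided Z W).
Proof.
split=> [|a f g /asboolP bf /asboolP bg]; apply/asboolP=> Y.
  by rewrite tens0m tensm0 comp0m compm0.
by rewrite tensmPr tensmPl compPl compPr bf bg.
Qed.

HB.instance Definition _ Z W :=
  GRing.isSubmodClosed.Build k (hom (hb_ob Z) (hb_ob W)) (braided Z W)
    (braided_submod Z W).

Record zhom (Z W : halfBraided) :=
  ZHom { zval :> hom (hb_ob Z) (hb_ob W); zvalP : zval \in braided Z W }.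

HB.instance Definition _ Z W := [isSub of zhom Z W for @zval Z W].
HB.instance Definition _ Z W := [Choice of zhom Z W by <:].
HB.instance Definition _ Z W := [SubChoice_isSubLmodule of zhom Z W by <:].

Lemma zid_subproof Z : idm (hb_ob Z) \in braided Z Z.
Proof. by apply/asboolP=> Y; rewrite !tensm1 comp1m compm1. Qed.

Lemma zcomp_subproof Z W V (f : zhom Z W) (g : zhom W V) :
  zval f ;; zval g \in braided Z V.
Proof.
have /asboolP bf := zvalP f; have /asboolP bg := zvalP g; apply/asboolP=> Y.
rewrite -[in LHS](comp1m (idm Y)) -[in RHS](comp1m (idm Y)) !tensm_comp.
by rewrite -compA bg compA bf compA.
Qed.

Definition zcomp Z W V (f : zhom Z W) (g : zhom W V) : zhom Z V :=
  ZHom (zcomp_subproof f g).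

Definition center : linCat k.
Proof.
refine (@LinCat k halfBraided zhom (fun Z => ZHom (zid_subproof Z)) zcomp
  _ _ _ _ _).
- by move=> Z W f; apply: val_inj; rewrite /= comp1m.
- by move=> Z W f; apply: val_inj; rewrite /= compm1.
- by move=> Z W V U f g h; apply: val_inj; rewrite /= compA.
- by move=> Z W V a f f' g; apply: val_inj; rewrite /= compPl.
- by move=> Z W V a f g g'; apply: val_inj; rewrite /= compPr.
Defined.

End Center.
Arguments braided {k C} Z W _.

Section TensMx.
Context (R : comNzRingType).

Lemma tensmxDl m n p q (A A' : 'M[R]_(m, n)) (B : 'M[R]_(p, q)) a :
  (a *: A + A') *t B = a *: (A *t B) + A' *t B.
Proof. by apply/matrixP=> i j; rewrite !mxE mulrDl mulrA. Qed.

Lemma tensmxDr m n p q (A : 'M[R]_(m, n)) (B B' : 'M[R]_(p, q)) a :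
  A *t (a *: B + B') = a *: (A *t B) + A *t B'.
Proof. by apply/matrixP=> i j; rewrite !mxE mulrDr mulrCA. Qed.

Lemma sum_mxtens (V : nmodType) m n (F : 'I_(m * n) -> V) :
  \sum_u F u = \sum_i \sum_j F (mxtens_index (i, j)).
Proof.
rewrite pair_bigA /= (reindex (@mxtens_index m n)) /=.
  by apply: eq_bigr => [[]].
by exists (@mxtens_unindex m n) => u _; rewrite (mxtens_indexK, mxtens_unindexK).
Qed.

Lemma eq_mxtens m n (i i' : 'I_m) (j j' : 'I_n) :
  (mxtens_index (i, j) == mxtens_index (i', j')) = (i == i') && (j == j').
Proof. by rewrite (can_eq (@mxtens_indexK m n)) xpair_eqE. Qed.

Lemma tensmx11 m n : (1%:M : 'M[R]_m) *t (1%:M : 'M[R]_n) = 1%:M.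
Proof.
apply/matrixP=> u v; case: (mxtens_indexP u) => i j.
case: (mxtens_indexP v) => i' j'.
by rewrite tensmxE !mxE eq_mxtens -natrM mulnb.
Qed.

(* Partial traces over the second, resp. first, tensor factor. *)
Definition ptracer m n p (A : 'M[R]_(m * p, n * p)) : 'M[R]_(m, n) :=
  \matrix_(i, j) \sum_u A (mxtens_index (i, u)) (mxtens_index (j, u)).
Definition ptracel m n p (A : 'M[R]_(p * m, p * n)) : 'M[R]_(m, n) :=
  \matrix_(i, j) \sum_u A (mxtens_index (u, i)) (mxtens_index (u, j)).

Lemma mul_tens1E m n p q (A : 'M[R]_(m, n)) (B : 'M[R]_(n * p, q)) i u v :
  ((A *t (1%:M : 'M_p)) *m B) (mxtens_index (i, u)) v =
  \sum_j A i j * B (mxtens_index (j, u)) v.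
Proof.
rewrite mxE sum_mxtens; apply: eq_bigr => j _.
rewrite (bigD1 u) //= tensmxE mxE eqxx mulr1 big1 ?addr0 // => w ne.
by rewrite tensmxE mxE eq_sym (negPf ne) mulr0 mul0r.
Qed.

Lemma mul_1tensE m n p q (A : 'M[R]_(m, n)) (B : 'M[R]_(p * n, q)) i u v :
  (((1%:M : 'M_p) *t A) *m B) (mxtens_index (u, i)) v =
  \sum_j A i j * B (mxtens_index (u, j)) v.
Proof.
rewrite mxE sum_mxtens exchange_big; apply: eq_bigr => j _ /=.
rewrite (bigD1 u) //= tensmxE mxE eqxx mul1r big1 ?addr0 // => w ne.
by rewrite tensmxE mxE eq_sym (negPf ne) !mul0r.
Qed.

Lemma mul_tens1rE m n p q (A : 'M[R]_(m, n)) (B : 'M[R]_(q, m * p)) v j u :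
  (B *m (A *t (1%:M : 'M_p))) v (mxtens_index (j, u)) =
  \sum_i B v (mxtens_index (i, u)) * A i j.
Proof.
rewrite mxE sum_mxtens; apply: eq_bigr => i _.
rewrite (bigD1 u) //= tensmxE mxE eqxx mulr1 big1 ?addr0 // => w ne.
by rewrite tensmxE mxE (negPf ne) !mulr0.
Qed.

Lemma mul_1tensrE m n p q (A : 'M[R]_(m, n)) (B : 'M[R]_(q, p * m)) v j u :
  (B *m ((1%:M : 'M_p) *t A)) v (mxtens_index (u, j)) =
  \sum_i B v (mxtens_index (u, i)) * A i j.
Proof.
rewrite mxE sum_mxtens exchange_big; apply: eq_bigr => i _ /=.
rewrite (bigD1 u) //= tensmxE mxE eqxx mul1r big1 ?addr0 // => w ne.
by rewrite tensmxE mxE (negPf ne) mul0r mulr0.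
Qed.

Lemma ptracer_tens1 m n r p (A : 'M[R]_(m, n)) (B : 'M[R]_(n * p, r * p)) :
  ptracer ((A *t 1%:M) *m B) = A *m ptracer B.
Proof.
apply/matrixP=> i j; rewrite !mxE.
under eq_bigr do rewrite mul_tens1E.
by rewrite exchange_big; apply: eq_bigr => l _ /=; rewrite mxE -mulr_sumr.
Qed.

Lemma ptracer_tens1r m n r p (A : 'M[R]_(n, r)) (B : 'M[R]_(m * p, n * p)) :
  ptracer (B *m (A *t 1%:M)) = ptracer B *m A.
Proof.
apply/matrixP=> i j; rewrite !mxE.
under eq_bigr do rewrite mul_tens1rE.
by rewrite exchange_big; apply: eq_bigr => l _ /=; rewrite mxE -mulr_suml.
Qed.

Lemma ptracer_1tens m n p (A : 'M[R]_p) (B : 'M[R]_(m * p, n * p)) :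
  ptracer ((1%:M *t A) *m B) = ptracer (B *m (1%:M *t A)).
Proof.
apply/matrixP=> i j; rewrite !mxE.
under eq_bigr do rewrite mul_1tensE; rewrite exchange_big /=.
by apply: eq_bigr => u _; rewrite mul_1tensrE; apply: eq_bigr => w _; rewrite mulrC.
Qed.

Lemma ptracel_1tens m n r p (A : 'M[R]_(m, n)) (B : 'M[R]_(p * n, p * r)) :
  ptracel ((1%:M *t A) *m B) = A *m ptracel B.
Proof.
apply/matrixP=> i j; rewrite !mxE.
under eq_bigr do rewrite mul_1tensE.
by rewrite exchange_big; apply: eq_bigr => l _ /=; rewrite mxE -mulr_sumr.
Qed.

Lemma ptracel_1tensr m n r p (A : 'M[R]_(n, r)) (B : 'M[R]_(p * m, p * n)) :
  ptracel (B *m (1%:M *t A)) = ptracel B *m A.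
Proof.
apply/matrixP=> i j; rewrite !mxE.
under eq_bigr do rewrite mul_1tensrE.
by rewrite exchange_big; apply: eq_bigr => l _ /=; rewrite mxE -mulr_suml.
Qed.

Lemma ptracel_tens1 m n p (A : 'M[R]_p) (B : 'M[R]_(p * m, p * n)) :
  ptracel ((A *t 1%:M) *m B) = ptracel (B *m (A *t 1%:M)).
Proof.
apply/matrixP=> i j; rewrite !mxE.
under eq_bigr do rewrite mul_tens1E; rewrite exchange_big /=.
by apply: eq_bigr => u _; rewrite mul_tens1rE; apply: eq_bigr => w _; rewrite mulrC.
Qed.

Lemma mxtrace_ptracer m p (A : 'M[R]_(m * p)) : \tr (ptracer A) = \tr A.
Proof. by rewrite /mxtrace sum_mxtens; apply: eq_bigr => i _; rewrite mxE. Qed.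

Lemma mxtrace_ptracel m p (A : 'M[R]_(p * m)) : \tr (ptracel A) = \tr A.
Proof.
rewrite /mxtrace sum_mxtens exchange_big; apply: eq_bigr => i _.
by rewrite mxE.
Qed.

(* With the row-major indexing of tensor products, the associativity and unit
   isomorphisms do not move basis vectors: their matrices are identity
   matrices between types of equal but not convertible dimensions. *)
Definition reindex_mx m n : 'M[R]_(m, n) :=
  \matrix_(i, j) (i == j :> nat)%:R.

Lemma mul_reindexE m n p (e : m = n) (A : 'M[R]_(n, p)) i j :
  (reindex_mx m n *m A) i j = A (cast_ord e i) j.
Proof.
case: n / e A => A; rewrite cast_ord_id; set J := reindex_mx _ _.
suff -> : J = 1%:M by rewrite mul1mx.
by apply/matrixP=> a b; rewrite !mxE.
Qed.

Lemma mul_reindexrE m n p (e : m = n) (A : 'M[R]_(p, m)) i j :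
  (A *m reindex_mx m n) i j = A i (cast_ord (esym e) j).
Proof.
case: n / e j => j; rewrite cast_ord_id; set J := reindex_mx _ _.
suff -> : J = 1%:M by rewrite mulmx1.
by apply/matrixP=> a b; rewrite !mxE.
Qed.

Lemma mul_reindex m n p : m = n -> reindex_mx m n *m reindex_mx n p = reindex_mx m p.
Proof. by move=> e; apply/matrixP=> i j; rewrite (mul_reindexE e) !mxE. Qed.

Lemma reindex_mxid m : reindex_mx m m = 1%:M.
Proof. by apply/matrixP=> i j; rewrite !mxE. Qed.

Lemma mul_reindexV m n : m = n -> reindex_mx m n *m reindex_mx n m = 1%:M.
Proof. by move=> e; rewrite mul_reindex // reindex_mxid. Qed.

Lemma tens_1reindex m n p : n = p -> 1%:M *t reindex_mx n p = reindex_mx (m * n) (m * p).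
Proof. by case: p /; rewrite !reindex_mxid tensmx11. Qed.

Lemma tens_reindex1 m n p : n = p -> reindex_mx n p *t 1%:M = reindex_mx (n * m) (p * m).
Proof. by case: p /; rewrite !reindex_mxid tensmx11. Qed.

Lemma tensmxA m m' n n' p p'
    (A : 'M[R]_(m, m')) (B : 'M[R]_(n, n')) (D : 'M[R]_(p, p')) :
  ((A *t B) *t D) *m reindex_mx (m' * n' * p') (m' * (n' * p')) =
  reindex_mx (m * n * p) (m * (n * p)) *m (A *t (B *t D)).
Proof.
apply/matrixP=> u v; case: (mxtens_indexP u) => w c.
case: (mxtens_indexP w) => a b; case: (mxtens_indexP v) => a' w'.
case: (mxtens_indexP w') => b' c'.
have e := mulnA m n p; have e' := mulnA m' n' p'.
rewrite (mul_reindexE (esym e)) (mul_reindexrE (esym e')) esymK.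
have -> : cast_ord (esym e) (mxtens_index (mxtens_index (a, b), c)) =
          mxtens_index (a, mxtens_index (b, c)).
  by apply: val_inj; rewrite /= mulnDl mulnA addnA.
have -> : cast_ord e' (mxtens_index (a', mxtens_index (b', c'))) =
          mxtens_index (mxtens_index (a', b'), c').
  by apply: val_inj; rewrite /= mulnDl mulnA addnA.
by rewrite !tensmxE mulrA.
Qed.

Lemma tens1mx_reindex m n (A : 'M[R]_(m, n)) :
  ((1%:M : 'M_1) *t A) *m reindex_mx (1 * n) n = reindex_mx (1 * m) m *m A.
Proof.
apply/matrixP=> u j; case: (mxtens_indexP u) => o i.
rewrite (mul_reindexE (mul1n m)) (mul_reindexrE (mul1n n)).
have -> : cast_ord (mul1n m) (mxtens_index (o, i)) = i.
  by apply: val_inj; rewrite /= ord1 mul0n.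
have -> : cast_ord (esym (mul1n n)) j = mxtens_index (0, j).
  by apply: val_inj; rewrite /= mul0n.
by rewrite tensmxE [o]ord1 mxE mul1r.
Qed.

Lemma tensmx1_reindex m n (A : 'M[R]_(m, n)) :
  (A *t (1%:M : 'M_1)) *m reindex_mx (n * 1) n = reindex_mx (m * 1) m *m A.
Proof.
apply/matrixP=> u j; case: (mxtens_indexP u) => i o.
rewrite (mul_reindexE (muln1 m)) (mul_reindexrE (muln1 n)).
have -> : cast_ord (muln1 m) (mxtens_index (i, o)) = i.
  by apply: val_inj; rewrite /= ord1 addn0 muln1.
have -> : cast_ord (esym (muln1 n)) j = mxtens_index (j, 0).
  by apply: val_inj; rewrite /= addn0 muln1.
by rewrite tensmxE [o]ord1 mxE mulr1.
Qed.

End TensMx.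
Arguments reindex_mx {R} m n.

Section Rep.
Context (k : fieldType) (gT : finGroupType) (G : {group gT}).
Local Notation rep := (representation k G).
Implicit Types V W U : rep.

Definition intertwiner V W : {pred 'M[k]_(rdegree V, rdegree W)} :=
  fun f => [forall x in G, V x *m f == f *m W x].
Arguments intertwiner : clear implicits.

Lemma intertwinerP V W f :
  reflect (forall x, x \in G -> V x *m f = f *m W x) (f \in intertwiner V W).
Proof. exact: 'forall_in_eqP. Qed.

Lemma intertwiner_submod V W : submod_closed (intertwiner V W).
Proof.
split=> [|a f g /intertwinerP cf /intertwinerP cg]; apply/intertwinerP=> x Gx.
  by rewrite mulmx0 mul0mx.
by rewrite mulmxDr mulmxDl -scalemxAl -scalemxAr cf ?cg.
Qed.

HB.instance Definition _ V W :=
  GRing.isSubmodClosed.Build k 'M[k]_(rdegree V, rdegree W) (intertwiner V W)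
    (intertwiner_submod V W).

Record rhom V W :=
  RHom { rmx :> 'M[k]_(rdegree V, rdegree W); rmxP : rmx \in intertwiner V W }.

HB.instance Definition _ V W := [isSub of rhom V W for @rmx V W].
HB.instance Definition _ V W := [Choice of rhom V W by <:].
HB.instance Definition _ V W := [SubChoice_isSubLmodule of rhom V W by <:].

Lemma rmxC V W (f : rhom V W) x : x \in G -> V x *m f = f *m W x.
Proof. exact/intertwinerP/rmxP. Qed.

Lemma rid_subproof V : 1%:M \in intertwiner V V.
Proof. by apply/intertwinerP=> x _; rewrite mul1mx mulmx1. Qed.

Lemma rcomp_subproof V W U (f : rhom V W) (g : rhom W U) :
  (f : 'M_(_, _)) *m g \in intertwiner V U.
Proof.
by apply/intertwinerP=> x Gx; rewrite mulmxA rmxC // -!mulmxA rmxC.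
Qed.

Definition rid V : rhom V V := RHom (rid_subproof V).
Definition rcomp V W U (f : rhom V W) (g : rhom W U) : rhom V U :=
  RHom (rcomp_subproof f g).

Definition repCat : linCat k.
Proof.
refine (@LinCat k rep rhom rid rcomp _ _ _ _ _).
- by move=> V W f; apply: val_inj; rewrite /= mul1mx.
- by move=> V W f; apply: val_inj; rewrite /= mulmx1.
- by move=> V W U T f g h; apply: val_inj; rewrite /= mulmxA.
- by move=> V W U a f f' g; apply: val_inj; rewrite /= mulmxDl scalemxAl.
- by move=> V W U a f g g'; apply: val_inj; rewrite /= mulmxDr scalemxAr.
Defined.

Lemma triv_repr : mx_repr G (fun=> 1%:M : 'M[k]_1).
Proof. by split=> // x y _ _; rewrite mulmx1. Qed.

Definition triv_rep : rep := Representation (MxRepresentation triv_repr).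

Lemma tens_repr V W : mx_repr G (fun x => V x *t W x).
Proof.
split=> [|x y Gx Gy]; first by rewrite !repr_mx1 tensmx11.
by rewrite !repr_mxM // tensmx_mul.
Qed.

Definition tens_rep V W : rep :=
  Representation (MxRepresentation (tens_repr V W)).

Lemma rtens_subproof V V' W W' (f : rhom V V') (g : rhom W W') :
  (f : 'M_(_, _)) *t g \in intertwiner (tens_rep V W) (tens_rep V' W').
Proof. by apply/intertwinerP=> x Gx; rewrite /= !tensmx_mul !rmxC. Qed.

Definition rtens V V' W W' (f : rhom V V') (g : rhom W W') :
  rhom (tens_rep V W) (tens_rep V' W') := RHom (rtens_subproof f g).

Lemma rassoc_subproof V W U :
  reindex_mx _ _ \in
    intertwiner (tens_rep (tens_rep V W) U) (tens_rep V (tens_rep W U)).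
Proof. by apply/intertwinerP=> x _ /=; rewrite tensmxA. Qed.

Definition rassoc V W U := RHom (rassoc_subproof V W U).

Lemma riassoc_subproof V W U :
  reindex_mx _ _ \in
    intertwiner (tens_rep V (tens_rep W U)) (tens_rep (tens_rep V W) U).
Proof.
apply/intertwinerP=> x _ /=.
rewrite -[LHS]mul1mx -(mul_reindexV k (mulnA _ _ _)) -!mulmxA; congr (_ *m _).
rewrite mulmxA -tensmxA -mulmxA mul_reindexV ?mulmx1 //.
exact/esym/mulnA.
Qed.

Definition riassoc V W U := RHom (riassoc_subproof V W U).

Lemma rlunit_subproof V : reindex_mx _ _ \in intertwiner (tens_rep triv_rep V) V.
Proof. by apply/intertwinerP=> x _ /=; rewrite tens1mx_reindex. Qed.

Lemma rilunit_subproof V : reindex_mx _ _ \in intertwiner V (tens_rep triv_rep V).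
Proof.
apply/intertwinerP=> x _ /=.
rewrite -[LHS]mul1mx -(mul_reindexV k (esym (mul1n _))) -!mulmxA; congr (_ *m _).
by rewrite mulmxA -tens1mx_reindex -mulmxA mul_reindexV ?mulmx1 ?mul1n.
Qed.

Lemma rrunit_subproof V : reindex_mx _ _ \in intertwiner (tens_rep V triv_rep) V.
Proof. by apply/intertwinerP=> x _ /=; rewrite tensmx1_reindex. Qed.

Lemma rirunit_subproof V : reindex_mx _ _ \in intertwiner V (tens_rep V triv_rep).
Proof.
apply/intertwinerP=> x _ /=.
rewrite -[LHS]mul1mx -(mul_reindexV k (esym (muln1 _))) -!mulmxA; congr (_ *m _).
by rewrite mulmxA -tensmx1_reindex -mulmxA mul_reindexV ?mulmx1 ?muln1.
Qed.

Definition repMonCat : monCat k.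
Proof.
refine (@MonCat k repCat triv_rep tens_rep rtens _ _ _ _ rassoc riassoc
  _ _ _ (fun V => RHom (rlunit_subproof V)) _ _
  (fun V => RHom (rrunit_subproof V)) _ _ _ _).
- by move=> V W; apply: val_inj; rewrite /= tensmx11.
- by move=> V V' V'' W W' W'' f f' g g'; apply: val_inj; rewrite /= tensmx_mul.
- by move=> V V' W W' a f f' g; apply: val_inj; rewrite /= tensmxDl.
- by move=> V V' W W' a f g g'; apply: val_inj; rewrite /= tensmxDr.
- by move=> V W U; apply: val_inj; rewrite /= mul_reindexV ?mulnA.
- by move=> V W U; apply: val_inj; rewrite /= mul_reindexV ?mulnA.
- by move=> V V' W W' U U' f g h; apply: val_inj; rewrite /= tensmxA.
- move=> V; exists (RHom (rilunit_subproof V)).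
  by split; apply: val_inj; rewrite /= mul_reindexV ?mul1n.
- by move=> V W f; apply: val_inj; rewrite /= tens1mx_reindex.
- move=> V; exists (RHom (rirunit_subproof V)).
  by split; apply: val_inj; rewrite /= mul_reindexV ?muln1.
- by move=> V W f; apply: val_inj; rewrite /= tensmx1_reindex.
- move=> V W U T; apply: val_inj; rewrite /=.
  by rewrite tens_reindex1 ?tens_1reindex ?mul_reindex // !mulnA.
- move=> V W; apply: val_inj; rewrite /=.
  by rewrite tens_reindex1 ?tens_1reindex ?mul_reindex // ?muln1 ?mul1n ?mulnA.
Defined.

(* The trace of an endomorphism in the symmetric category of representations
   is its matrix trace. *)
Definition negligible V W : {pred rhom V W} :=
  fun f => `[< forall g : rhom W V, \tr (rmx f *m rmx g) = 0 >].
Arguments negligible : clear implicits.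

Lemma negligibleP V W (f : rhom V W) :
  f \in negligible V W <-> forall g : rhom W V, \tr (rmx f *m rmx g) = 0.
Proof. by split=> [/asboolP|?]; last apply/asboolP. Qed.

Lemma negligible_zmod V W : zmod_closed (negligible V W).
Proof.
split=> [|f f' /negligibleP nf /negligibleP nf']; apply/negligibleP=> g /=.
  by rewrite mul0mx mxtrace0.
by rewrite mulmxBl linearB /= nf nf' subr0.
Qed.

HB.instance Definition _ V W :=
  GRing.isZmodClosed.Build (rhom V W) (negligible V W) (negligible_zmod V W).

Lemma negligibleZ V W a (f : rhom V W) :
  f \in negligible V W -> a *: f \in negligible V W.
Proof.
move/negligibleP=> nf; apply/negligibleP=> g.
by rewrite /= -scalemxAl mxtraceZ nf mulr0.
Qed.

Lemma negligible_compl V W U (f : rhom V W) (g : rhom W U) :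
  f \in negligible V W -> rcomp f g \in negligible V U.
Proof.
move/negligibleP=> nf; apply/negligibleP=> h.
by rewrite /= -mulmxA; apply: (nf (rcomp g h)).
Qed.

Lemma negligible_compr V W U (f : rhom V W) (g : rhom W U) :
  g \in negligible W U -> rcomp f g \in negligible V U.
Proof.
move/negligibleP=> ng; apply/negligibleP=> h.
by rewrite /= -mulmxA mxtrace_mulC -mulmxA; apply: (ng (rcomp h f)).
Qed.

Lemma ptracer_intertwiner V W U (h : rhom (tens_rep W U) (tens_rep V U)) :
  ptracer (rmx h) \in intertwiner W V.
Proof.
apply/intertwinerP=> x Gx; rewrite -ptracer_tens1.
have -> : W x *t (1%:M : 'M_(rdegree U)) =
          (1%:M *t U x^-1%g) *m (W x *t U x).
  by rewrite tensmx_mul mul1mx -repr_mxM ?groupV // mulVg repr_mx1.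
rewrite -mulmxA [_ *m rmx h](rmxC h Gx) /= ptracer_1tens -mulmxA tensmx_mul.
by rewrite mulmx1 -repr_mxM ?groupV // mulgV repr_mx1 ptracer_tens1r.
Qed.

Lemma ptracel_intertwiner V W U (h : rhom (tens_rep U W) (tens_rep U V)) :
  ptracel (rmx h) \in intertwiner W V.
Proof.
apply/intertwinerP=> x Gx; rewrite -ptracel_1tens.
have -> : (1%:M : 'M_(rdegree U)) *t W x =
          (U x^-1%g *t 1%:M) *m (U x *t W x).
  by rewrite tensmx_mul mul1mx -repr_mxM ?groupV // mulVg repr_mx1.
rewrite -mulmxA [_ *m rmx h](rmxC h Gx) /= ptracel_tens1 -mulmxA tensmx_mul.
by rewrite mulmx1 -repr_mxM ?groupV // mulgV repr_mx1 ptracel_1tensr.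
Qed.

Lemma negligible_tensl V V' W W' (f : rhom V V') (g : rhom W W') :
  f \in negligible V V' ->
  rtens f g \in negligible (tens_rep V W) (tens_rep V' W').
Proof.
move/negligibleP=> nf; apply/negligibleP=> h.
pose h' := rcomp (rtens (rid V') g) h.
have -> : rmx (rtens f g) *m rmx h = (rmx f *t 1%:M) *m rmx h'.
  by rewrite /= mulmxA tensmx_mul mulmx1 mul1mx.
rewrite -mxtrace_ptracer ptracer_tens1.
exact: (nf (RHom (ptracer_intertwiner h'))).
Qed.

Lemma negligible_tensr V V' W W' (f : rhom V V') (g : rhom W W') :
  g \in negligible W W' ->
  rtens f g \in negligible (tens_rep V W) (tens_rep V' W').
Proof.
move/negligibleP=> ng; apply/negligibleP=> h.
pose h' := rcomp (rtens f (rid W')) h.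
have -> : rmx (rtens f g) *m rmx h = (1%:M *t rmx g) *m rmx h'.
  by rewrite /= mulmxA tensmx_mul mulmx1 mul1mx.
rewrite -mxtrace_ptracel ptracel_1tens.
exact: (ng (RHom (ptracel_intertwiner h'))).
Qed.

Definition negligible_ideal : tensIdeal repMonCat :=
  @TensIdeal k repMonCat (fun V W => negligible V W) negligibleZ
    negligible_compl negligible_compr negligible_tensl negligible_tensr.

Definition semisimplification : monCat k := quotMonCat negligible_ideal.

End Rep.
Arguments intertwiner {k gT G} V W _.
Arguments negligible {k gT G} V W _.

Section NatMx.
Context (k : fieldType) (char5 : 5%N \in [pchar k]).

(* Computable matrices over the prime field, given by lists of rows. *)
Definition ent (s : seq (seq nat)) i j := nth 0%N (nth [::] s i) j.
Definition nat_mx m n (s : seq (seq nat)) : 'M[k]_(m, n) :=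
  \matrix_(i, j) (ent s i j)%:R.

Definition nmk m n (f : nat -> nat -> nat) : seq (seq nat) :=
  mkseq (fun i => mkseq (fun j => (f i j %% 5)%N) n) m.
Definition nid m := nmk m m (fun i j => (i == j)%N).
Definition nmul m n p s t :=
  nmk m p (fun i j => sumn [seq (ent s i l * ent t l j)%N | l <- iota 0 n]).
Definition nadd m n s t := nmk m n (fun i j => (ent s i j + ent t i j)%N).
Definition ntens m n p q s t :=
  nmk (m * p) (n * q)
    (fun i j => (ent s (i %/ p) (j %/ q) * ent t (i %% p) (j %% q))%N).
Definition npow m s n := iter n (nmul m m m s) (nid m).

Lemma natr_mod5 n : (n %% 5)%:R = n%:R :> k.
Proof. by rewrite {2}(divn_eq n 5) natrD natrM (pcharf0 char5) mulr0 add0r. Qed.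

Lemma nmkE m n f (i : 'I_m) (j : 'I_n) : nat_mx m n (nmk m n f) i j = (f i j)%:R.
Proof. by rewrite mxE /ent !nth_mkseq // natr_mod5. Qed.

Lemma nidE m : 1%:M = nat_mx m m (nid m).
Proof. by apply/matrixP=> i j; rewrite nmkE mxE. Qed.

Lemma n0E m n : 0 = nat_mx m n (nmk m n (fun _ _ => 0)).
Proof. by apply/matrixP=> i j; rewrite nmkE mxE. Qed.

Lemma nmulE m n p s t :
  nat_mx m n s *m nat_mx n p t = nat_mx m p (nmul m n p s t).
Proof.
apply/matrixP=> i j; rewrite nmkE mxE sumnE big_map natr_sum.
have -> : iota 0 n = index_iota 0 n by rewrite /index_iota subn0.
rewrite big_mkord.
by apply: eq_bigr => l _; rewrite !mxE natrM.
Qed.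

Lemma naddE m n s t : nat_mx m n s + nat_mx m n t = nat_mx m n (nadd m n s t).
Proof. by apply/matrixP=> i j; rewrite nmkE !mxE natrD. Qed.

Lemma ntensE m n p q s t :
  nat_mx m n s *t nat_mx p q t = nat_mx (m * p) (n * q) (ntens m n p q s t).
Proof. by apply/matrixP=> i j; rewrite nmkE !mxE natrM. Qed.

End NatMx.

Section Ver5.
Context (k : fieldType) (char5 : 5%N \in [pchar k]).

Definition jordan3 : 'M[k]_3 := \matrix_(i, j) ((j == i) || (j == i.+1 :> nat))%:R.

Let sJ := [:: [:: 1; 1; 0]; [:: 0; 1; 1]; [:: 0; 0; 1]]%N.

Lemma jordan3E : jordan3 = nat_mx k 3 3 sJ.
Proof.
by apply/matrixP=> i j; rewrite !mxE; case: i => [[|[|[]]]] //= ?;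
  case: j => [[|[|[]]]].
Qed.

Lemma jordan3X n : jordan3 ^+ n = nat_mx k 3 3 (npow 3 sJ n).
Proof.
elim: n => [|n IHn]; first by rewrite expr0 -[1]/1%:M (nidE char5).
by rewrite exprS IHn jordan3E -[_ * _]/(_ *m _) (nmulE char5).
Qed.

Lemma jordan3X5 : jordan3 ^+ 5 = 1.
Proof. by rewrite jordan3X -[1]/1%:M (nidE char5). Qed.

Lemma jordan3_repr : mx_repr [set: 'Z_5] (fun x => jordan3 ^+ x).
Proof.
split=> [|x y _ _]; first exact: expr0.
rewrite -[_ *m _]/(_ * _) -exprD /=.
by rewrite [in RHS](divn_eq (x + y) 5) exprD mulnC exprM jordan3X5 expr1n mul1r.
Qed.

Definition jordan3_rep : representation k [set: 'Z_5] :=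
  Representation (MxRepresentation jordan3_repr).

Definition Ver5 : monCat k := semisimplification k [set: 'Z_5].

Definition L3 : Ver5 := jordan3_rep.

(* The full subcategory on these objects is the fusion subcategory with simple
   objects [1] and [L3]. *)
Definition sum_of_1_L3 (V : Ver5) : Prop :=
  exists (I : finType) (S : I -> Ver5),
    (forall a, S a = munit \/ S a = L3) /\ is_dsum S V.

Lemma sum_of_1_L3_1 : sum_of_1_L3 munit.
Proof.
exists unit, (fun=> munit); split=> [_|]; first by left.
by apply: is_dsum_iso; exists (idm _), (idm _); rewrite comp1m.
Qed.

Lemma sum_of_1_L3_dsum (I : finType) (S : I -> Ver5) V :
  (forall a, sum_of_1_L3 (S a)) -> is_dsum S V -> sum_of_1_L3 V.
Proof.
move=> sS dV.
pose J a := projT1 (cid (sS a)).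
pose T a : J a -> Ver5 := projT1 (cid (projT2 (cid (sS a)))).
have TP a : (forall c, T a c = munit \/ T a c = L3) /\ is_dsum (T a) (S a).
  exact: projT2 (cid (projT2 (cid (sS a)))).
exists {a : I & J a}, (fun u => T (tag u) (tagged u)); split.
  by move=> u; case: (TP (tag u)).
by apply: (is_dsum_sigma dV) => a; case: (TP a).
Qed.

Lemma sum_of_1_L3_iso (U V : Ver5) :
  U = munit \/ U = L3 -> isomorphic U V -> sum_of_1_L3 V.
Proof.
move=> U1 iUV; exists unit, (fun=> U); split=> //; exact: is_dsum_iso.
Qed.

(* In the tensor square of the Jordan block, [su] and [sB] are the inclusions
   of the summands of dimensions 1 and 3, [sw] and [sC] the corresponding
   projections, and the remaining summand, free of rank 1, is cut out by the
   relative trace of [st]. *)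
Let su := [:: [:: 0; 0; 3; 0; 2; 4; 3; 4; 1]]%N.
Let sw := [:: [:: 0]; [:: 3]; [:: 4]; [:: 1]; [:: 1]; [:: 0]; [:: 4]; [:: 0]; [:: 0]]%N.
Let sB := [:: [:: 0; 3; 4; 2; 3; 4; 0; 1; 2]; [:: 0; 0; 3; 0; 0; 0; 2; 0; 3];
  [:: 0; 0; 0; 0; 0; 3; 0; 2; 0]]%N.
Let sC := [:: [:: 0; 0; 2]; [:: 1; 1; 2]; [:: 0; 1; 0]; [:: 4; 4; 3];
  [:: 0; 0; 0]; [:: 0; 0; 1]; [:: 0; 4; 0]; [:: 0; 0; 4]; [:: 0; 0; 0]]%N.
Let st := [:: [:: 4; 0; 0; 0; 0; 0; 0; 0; 0]; [:: 0; 0; 0; 0; 0; 0; 0; 0; 0];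
  [:: 0; 3; 0; 0; 0; 0; 0; 0; 0]; [:: 4; 0; 0; 0; 0; 0; 0; 0; 0];
  [:: 1; 0; 0; 0; 0; 0; 0; 0; 0]; [:: 3; 0; 0; 0; 0; 0; 0; 0; 0];
  [:: 1; 0; 0; 0; 0; 0; 0; 0; 0]; [:: 3; 0; 0; 0; 0; 0; 0; 0; 0];
  [:: 1; 0; 0; 0; 0; 0; 0; 0; 0]]%N.
Let sK n := ntens 3 3 3 3 (npow 3 sJ n) (npow 3 sJ n).

Local Notation T := (tens_rep jordan3_rep jordan3_rep).

Lemma sq_jordan3E (x : 'Z_5) : T x = nat_mx k (3 * 3) (3 * 3) (sK x).
Proof. by rewrite /= jordan3X (ntensE char5). Qed.

Lemma forall_Z5 (P : 'Z_5 -> Prop) :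
  P 0 -> P 1 -> P 2 -> P 3 -> P 4 -> forall x, P x.
Proof.
move=> P0 P1 P2 P3 P4 [[|[|[|[|[|//]]]]] lt_x].
- by rewrite (_ : Ordinal _ = 0) //; apply: val_inj.
- by rewrite (_ : Ordinal _ = 1) //; apply: val_inj.
- by rewrite (_ : Ordinal _ = 2) //; apply: val_inj.
- by rewrite (_ : Ordinal _ = 3) //; apply: val_inj.
- by rewrite (_ : Ordinal _ = 4) //; apply: val_inj.
Qed.

Lemma sq_jordan3_incl1 : nat_mx k 1 (3 * 3) su \in intertwiner (triv_rep k _) T.
Proof.
apply/intertwinerP=> x _; rewrite sq_jordan3E mul1mx (nmulE char5).
by move: x; apply: forall_Z5; apply: congr1; vm_compute.
Qed.

Lemma sq_jordan3_proj1 : nat_mx k (3 * 3) 1 sw \in intertwiner T (triv_rep k _).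
Proof.
apply/intertwinerP=> x _; rewrite sq_jordan3E mulmx1 (nmulE char5).
by move: x; apply: forall_Z5; apply: congr1; vm_compute.
Qed.

Lemma sq_jordan3_incl3 : nat_mx k 3 (3 * 3) sB \in intertwiner jordan3_rep T.
Proof.
apply/intertwinerP=> x _; rewrite sq_jordan3E /= jordan3X !(nmulE char5).
by move: x; apply: forall_Z5; apply: congr1; vm_compute.
Qed.

Lemma sq_jordan3_proj3 : nat_mx k (3 * 3) 3 sC \in intertwiner T jordan3_rep.
Proof.
apply/intertwinerP=> x _; rewrite sq_jordan3E /= jordan3X !(nmulE char5).
by move: x; apply: forall_Z5; apply: congr1; vm_compute.
Qed.

Lemma sq_jordan3_dec :
  1%:M = nat_mx k (3 * 3) 1 sw *m nat_mx k 1 (3 * 3) su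
       + nat_mx k (3 * 3) 3 sC *m nat_mx k 3 (3 * 3) sB
       + \sum_(x : 'Z_5) T x^-1%g *m nat_mx k (3 * 3) (3 * 3) st *m T x.
Proof.
rewrite !big_ord_recl big_ord0 addr0 !sq_jordan3E (nidE char5).
rewrite !(nmulE char5) !(naddE char5); apply: congr1.
by vm_compute.
Qed.

(* Relative traces are negligible because 5 = 0 in [k]. *)
Lemma rel_trace_negligible (t : 'M_(3 * 3)) (h : rhom T T) :
  \tr ((\sum_(x : 'Z_5) T x^-1%g *m t *m T x) *m rmx h) = 0.
Proof.
have tr_x (x : 'Z_5) : \tr (T x^-1%g *m t *m T x *m rmx h) = \tr (t *m rmx h).
  rewrite -mulmxA (rmxC h (in_setT x)) -mulmxA mxtrace_mulC -2!mulmxA.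
  by rewrite -repr_mxM ?in_setT // mulgV repr_mx1 mulmx1.
rewrite mulmx_suml linear_sum (eq_bigr _ (fun x _ => tr_x x)).
by rewrite sumr_const card_ord -mulr_natr (pcharf0 char5) mulr0.
Qed.

Lemma sum_of_1_L3_L3 : sum_of_1_L3 (L3 \ox L3).
Proof.
pose S (b : bool) : Ver5 := if b then munit : Ver5 else L3.
exists bool, S; split; first by case; [left | right].
pose N := negligible_ideal k [set: 'Z_5].
pose i b : hom (S b) (L3 \ox L3) :=
  if b return hom (S b) (L3 \ox L3)
  then qpi N (RHom sq_jordan3_incl1) else qpi N (RHom sq_jordan3_incl3).
pose p b : hom (L3 \ox L3) (S b) :=
  if b return hom (L3 \ox L3) (S b)
  then qpi N (RHom sq_jordan3_proj1) else qpi N (RHom sq_jordan3_proj3).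
exists i, p; split.
- case; rewrite /= qcompE; apply: congr1; apply: val_inj; rewrite /=;
  by rewrite (nmulE char5) (nidE char5); apply: congr1; vm_compute.
- case=> [] [] // _; rewrite /= qcompE -[RHS](qpi0 N);
  apply: congr1; apply: val_inj; rewrite /=;
  by rewrite (nmulE char5) (n0E char5); apply: congr1; vm_compute.
- rewrite big_bool /= !qcompE -(qpiD N); apply/qpiP/negligibleP=> h.
  rewrite /= sq_jordan3_dec opprD addrA subrr sub0r mulNmx.
  by rewrite raddfN /= rel_trace_negligible oppr0.
Qed.

Lemma sum_of_1_L3_tens (V W : Ver5) :
  sum_of_1_L3 V -> sum_of_1_L3 W -> sum_of_1_L3 (V \ox W).
Proof.
case=> I [S [S1 dS]] [J [T' [T1 dT]]].
apply: sum_of_1_L3_dsum (is_dsum_tens dS dT) => [[a b]] /=.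
have lU (U : Ver5) : U = munit \/ U = L3 -> sum_of_1_L3 (munit \ox U).
  move=> U1; apply: (sum_of_1_L3_iso U1).
  by case: (lunit_iso U) => g [fg gf]; exists g, (lunit U).
have rU (U : Ver5) : U = munit \/ U = L3 -> sum_of_1_L3 (U \ox munit).
  move=> U1; apply: (sum_of_1_L3_iso U1).
  by case: (runit_iso U) => g [fg gf]; exists g, (runit U).
case: (S1 a) => ->; first exact: lU.
case: (T1 b) => ->; first by apply: rU; right.
exact: sum_of_1_L3_L3.
Qed.

Definition Ver5plus : monCat k := subMonCat sum_of_1_L3_1 sum_of_1_L3_tens.

End Ver5.

(* Main.v *)
(** By naturality a half-braiding on Z = m 1 + n X is determined by the map
   X (x) Z -> Z (x) X, hence by five matrices, and in terms of the 6j-symbols of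
   Ver5plus the hexagon axiom is a system of quadratic equations for them.  In
   characteristic 5 the general solution is polynomial in three matrices
   a : m x n, b : n x m and t : n x n subject to a t = 0, t b = 0, b a = t^2, so
   the center is equivalent to the modules over a Brauer tree algebra with two
   edges and one exceptional vertex of multiplicity 2.  Its indecomposable
   modules are eight strings and two biserial projectives: unless one of these
   ten splits off, successive inclusions between kernels and images of a, b, t
   force the module to vanish. *)

Require Import Defs.
From HB Require Import structures.
From mathcomp Require Import all_boot all_algebra.
From mathcomp Require Import all_fingroup all_character boolp mxtens ring.
(* all_algebra shadows [hom] of Defs. *)
Import Defs GRing.Theory.


Set Implicit Arguments.
Unset Strict Implicit.
Unset Printing Implicit Defensive.

Local Open Scope ring_scope.

(** * Modules over the Brauer tree algebra *)

(** The dimension of X is a root of x^2 - x - 1, which is (x - 3)^2 modulo 5. Hence the 6j-symbols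
    lie in the prime field and can be evaluated, while the global dimension 1 + 3^2 vanishes. That
    is why the center is not semisimple and a nilpotent t appears.

    The number of strings has a conceptual count. Once the two projectives have split off, every
    path of length two acts by zero. The module then amounts to a representation of the quiver 1
    -a-> X <-t- X -b-> 1 of type A4, with tops at the sources and socles at the sinks. That quiver
    has ten indecomposables, and the simples at 1 and at X each occur twice, as a source and as a
    sink, which leaves eight modules.

    The classification reduces to producing one retract: an indecomposable object with a nonzero
    direct summand from the list is isomorphic to that summand. Indecomposability of the ten modules
    is read off from endomorphisms with a single eigenvalue, and the functor to the center, being
    fully faithful, transports both arguments. *)

Section BrauerModules.
Context (k : fieldType).

(* Vectors are rows: [bm] and [bn] are the dimensions at the vertices 1 and X,
   with arrows a : 1 -> X, b : X -> 1 and a loop t at X, acting from the right. *)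
Record bmod := Bmod {
  bm : nat; bn : nat;
  ba : 'M[k]_(bm, bn); bb : 'M[k]_(bn, bm); bt : 'M[k]_bn;
  ba_bt : ba *m bt = 0; bt_bb : bt *m bb = 0; bb_ba : bb *m ba = bt *m bt
}.
Implicit Types D E : bmod.

Definition bpair D E : Type := ('M[k]_(bm D, bm E) * 'M[k]_(bn D, bn E))%type.
HB.instance Definition _ D E := GRing.Lmodule.on (bpair D E).

Definition bmorph D E : {pred bpair D E} := fun u =>
  [&& u.1 *m ba E == ba D *m u.2, u.2 *m bb E == bb D *m u.1 & u.2 *m bt E == bt D *m u.2].
Arguments bmorph : clear implicits.

Lemma bmorphP D E (u : bpair D E) : reflect
  [/\ u.1 *m ba E = ba D *m u.2, u.2 *m bb E = bb D *m u.1 & u.2 *m bt E = bt D *m u.2]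
  (u \in bmorph D E).
Proof. by apply: (iffP and3P) => [][/eqP? /eqP? /eqP?]; split=> //; apply/eqP. Qed.

Lemma bmorph_submod D E : submod_closed (bmorph D E).
Proof.
split=> [|c u v /bmorphP[ua ub ut] /bmorphP[va vb vt]]; apply/bmorphP.
  by split; rewrite /= !mul0mx mulmx0.
by split; rewrite /= mulmxDl mulmxDr -scalemxAl -scalemxAr ?(ua, ub, ut) ?(va, vb, vt).
Qed.
HB.instance Definition _ D E :=
  GRing.isSubmodClosed.Build k (bpair D E) (bmorph D E) (bmorph_submod D E).

Record bhom D E := BHom { bval :> bpair D E; bvalP : bval \in bmorph D E }.
HB.instance Definition _ D E := [isSub of bhom D E for @bval D E].
HB.instance Definition _ D E := [Choice of bhom D E by <:].
HB.instance Definition _ D E := [SubChoice_isSubLmodule of bhom D E by <:].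

Lemma bid_subproof D : (1%:M, 1%:M) \in bmorph D D.
Proof. by apply/bmorphP; rewrite /= !mul1mx !mulmx1. Qed.

Lemma bcomp_subproof D E G (u : bhom D E) (v : bhom E G) :
  ((bval u).1 *m (bval v).1, (bval u).2 *m (bval v).2) \in bmorph D G.
Proof.
have /bmorphP[ua ub ut] := bvalP u; have /bmorphP[va vb vt] := bvalP v.
by apply/bmorphP; split; rewrite /= -mulmxA ?(va, vb, vt) mulmxA ?(ua, ub, ut) mulmxA.
Qed.

Definition bcat : linCat k.
Proof.
refine (@LinCat k bmod bhom (fun D => BHom (bid_subproof D))
  (fun D E G u v => BHom (bcomp_subproof u v)) _ _ _ _ _).
- by move=> D E [[f g] ?]; apply: val_inj; rewrite /= !mul1mx.
- by move=> D E [[f g] ?]; apply: val_inj; rewrite /= !mulmx1.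
- by move=> D E G H u v w; apply: val_inj; rewrite /= !mulmxA.
- by move=> D E G c u u' v; apply: val_inj; rewrite /= !mulmxDl -!scalemxAl.
- by move=> D E G c u v v'; apply: val_inj; rewrite /= !mulmxDr -!scalemxAr.
Defined.

Lemma bhomP (D E : bcat) (u v : hom D E) :
  (bval u).1 = (bval v).1 -> (bval u).2 = (bval v).2 -> u = v.
Proof.
move=> e1 e2; apply: val_inj; apply/eqP => /=.
by rewrite -pair_eqE /= /pair_eq e1 e2 !eqxx.
Qed.

Lemma bis_iso (D E : bcat) (u : hom D E) (v1 : 'M_(_, _)) (v2 : 'M_(_, _)) :
  (bval u).1 *m v1 = 1%:M -> v1 *m (bval u).1 = 1%:M ->
  (bval u).2 *m v2 = 1%:M -> v2 *m (bval u).2 = 1%:M -> is_iso u.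
Proof.
move=> uv1 vu1 uv2 vu2; have /bmorphP[ua ub ut] := bvalP u.
have vP : (v1, v2) \in bmorph E D.
  apply/bmorphP; split=> /=.
  - by rewrite -[LHS]mulmx1 -uv2 mulmxA -(mulmxA v1) -ua !mulmxA vu1 mul1mx.
  - by rewrite -[LHS]mulmx1 -uv1 mulmxA -(mulmxA v2) -ub !mulmxA vu2 mul1mx.
  - by rewrite -[LHS]mulmx1 -uv2 mulmxA -(mulmxA v2) -ut !mulmxA vu2 mul1mx.
by exists (BHom vP); split; apply: bhomP.
Qed.

Lemma bendo_iso (D : bcat) (u : hom D D) :
  (bval u).1 \in unitmx -> (bval u).2 \in unitmx -> is_iso u.
Proof. by move=> u1 u2; apply: bis_iso (mulmxV u1) (mulVmx u1) (mulmxV u2) (mulVmx u2). Qed.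

(* The complement of a retract is the image of the complementary idempotent,
   realised on the bases of its row spaces. *)
Lemma retract_dsum (D E : bcat) (i : hom E D) (p : hom D E) :
  i ;; p = idm E ->
  exists G : bcat, is_dsum (fun b : bool => if b then E else G) D.
Proof.
move=> ip; set e := idm D - p ;; i.
have ie : i ;; e = 0 by rewrite compBr compm1 compA ip comp1m subrr.
have ep : e ;; p = 0 by rewrite compBl comp1m -compA ip compm1 subrr.
have ee : e ;; e = e by rewrite {1}/e compBl comp1m -compA ie compm0 subr0.
have /bmorphP[ea eb et] := bvalP e.
pose F := (bval e).1; pose H := (bval e).2.
have FF : F *m F = F := congr1 (fun u : bhom D D => (bval u).1) ee.
have HH : H *m H = H := congr1 (fun u : bhom D D => (bval u).2) ee.
(* A rank factorisation [M = B' B]; for an idempotent, cancelling the outer factors in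
   [B' B B' B = B' B] leaves [B B' = 1]. *)
have splitM n (M : 'M[k]_n) : M *m M = M ->
    exists r (B : 'M_(r, n)) (B' : 'M_(n, r)), B' *m B = M /\ B *m B' = 1%:M.
  move=> MM; exists (\rank M), (row_base M), (col_base M); rewrite mulmx_base; split=> //.
  apply: (row_free_inj (row_base_free M)); rewrite mul1mx.
  apply: (row_full_inj (col_base_full M)) => /=.
  by rewrite -(mulmxA (row_base M)) mulmx_base mulmxA mulmx_base MM.
have [rF [RF [CF [CRF RCF]]]] := splitM _ F FF.
have [rH [RH [CH [CRH RCH]]]] := splitM _ H HH.
have RFF : RF *m F = RF by rewrite -CRF mulmxA RCF mul1mx.
have RHH : RH *m H = RH by rewrite -CRH mulmxA RCH mul1mx.
have FCF : F *m CF = CF by rewrite -CRF -mulmxA RCF mulmx1.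
have HCH : H *m CH = CH by rewrite -CRH -mulmxA RCH mulmx1.
rewrite -/F -/H in ea eb et.
have mid n (x : 'M_(n, _)) q r (y : 'M_(_, q)) (z : 'M_(q, r)) :
    x *m CH *m (RH *m y *m z) = x *m H *m y *m z.
  by rewrite -(mulmxA RH) mulmxA -(mulmxA x) CRH mulmxA.
have midF n (x : 'M_(n, _)) q r (y : 'M_(_, q)) (z : 'M_(q, r)) :
    x *m CF *m (RF *m y *m z) = x *m F *m y *m z.
  by rewrite -(mulmxA RF) mulmxA -(mulmxA x) CRF mulmxA.
have G1 : (RF *m ba D *m CH) *m (RH *m bt D *m CH) = 0.
  by rewrite mid -(mulmxA RF) -ea !mulmxA -(mulmxA _ (ba D)) ba_bt mulmx0 mul0mx.
have G2 : (RH *m bt D *m CH) *m (RH *m bb D *m CF) = 0.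
  by rewrite mid -(mulmxA RH) -et !mulmxA -(mulmxA _ (bt D)) bt_bb mulmx0 mul0mx.
have G3 : (RH *m bb D *m CF) *m (RF *m ba D *m CH) = (RH *m bt D *m CH) *m (RH *m bt D *m CH).
  rewrite midF mid -(mulmxA RH) -eb -(mulmxA RH (bt D) H) -et !mulmxA.
  by rewrite -(mulmxA _ (bb D)) bb_ba mulmxA.
pose G : bcat := Bmod G1 G2 G3; exists G.
have jP : (RF, RH) \in bmorph G D.
  apply/bmorphP; split; rewrite /= -mulmxA ?(CRF, CRH) -mulmxA.
  - by rewrite -ea mulmxA RFF.
  - by rewrite -eb mulmxA RHH.
  - by rewrite -et mulmxA RHH.
have qP : (CF, CH) \in bmorph D G.
  apply/bmorphP; split; rewrite /= !mulmxA ?(CRF, CRH).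
  - by rewrite ea -mulmxA HCH.
  - by rewrite eb -mulmxA FCF.
  - by rewrite et -mulmxA HCH.
pose j : hom G D := BHom jP; pose q : hom D G := BHom qP.
have jq : j ;; q = idm G by apply: bhomP.
have qj : q ;; j = e by apply: bhomP.
have iq : i ;; q = 0.
  by rewrite -[q]compm1 -jq (compA q) qj compA ie comp0m.
have jp : j ;; p = 0.
  by rewrite -[j]comp1m -jq -(compA j) qj -compA ep compm0.
exists (fun b => if b as b0 return hom (if b0 then E else G) D then i else j).
exists (fun b => if b as b0 return hom D (if b0 then E else G) then p else q).
split; first by case.
- by case=> [] [] // _.
- by rewrite big_bool; change (p ;; i + q ;; j = idm D); rewrite qj /e addrC subrK.
Qed.

(** The characteristic polynomial of [g] is that of the scalar [c], given by its values. Having the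
    same [c] at both vertices is what makes an idempotent endomorphism 0 or 1 at both
    simultaneously. *)
Definition one_eigenvalue n c (g : 'M[k]_n) := forall x, \det (g - x%:M) = (c - x) ^+ n.

(* An idempotent with a single eigenvalue is 0 or 1. *)
Lemma one_eigenvalue_local (D : bcat) : (0 < bm D + bn D)%N ->
  (forall u : hom D D, exists c, one_eigenvalue c (bval u).1 /\ one_eigenvalue c (bval u).2) ->
  ~ is_zero D /\ forall e : hom D D, e ;; e = e -> e = 0 \/ e = idm D.
Proof.
move=> D0 loc; split=> [z|e ee].
  have u1 : 1%:M = 0 :> 'M[k]_(bm D) := congr1 (fun u : bhom D D => (bval u).1) z.
  have u2 : 1%:M = 0 :> 'M[k]_(bn D) := congr1 (fun u : bhom D D => (bval u).2) z.
  have no n (n0 : (0 < n)%N) : 1%:M <> 0 :> 'M[k]_n.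
    move/matrixP/(_ (Ordinal n0) (Ordinal n0)).
    by rewrite !mxE eqxx => /eqP; rewrite oner_eq0.
  case: (posnP (bm D)) => [m0|/no/(_ u1) //].
  by rewrite m0 add0n in D0; apply: (no _ D0).
have [c [c1 c2]] := loc e.
have e1 : (bval e).1 *m (bval e).1 = (bval e).1 := congr1 (fun u : bhom D D => (bval u).1) ee.
have e2 : (bval e).2 *m (bval e).2 = (bval e).2 := congr1 (fun u : bhom D D => (bval u).2) ee.
have U n (g : 'M[k]_n) x : one_eigenvalue c g -> c != x -> g - x%:M \in unitmx.
  by move=> cg cx; rewrite unitmxE cg unitfE expf_neq0 // subr_eq0.
have [c0|c0] := eqVneq c 0; [left | right].
  have Z n (g : 'M[k]_n) : one_eigenvalue c g -> g *m g = g -> g = 0.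
    move=> cg gg; have gU : g - 1%:M \in unitmx by apply: U; rewrite // c0 eq_sym oner_eq0.
    by rewrite -(mulmxK gU g) mulmxBr gg mulmx1 subrr mul0mx.
  by apply: bhomP; [rewrite (Z _ _ c1 e1)|rewrite (Z _ _ c2 e2)].
have Z n (g : 'M[k]_n) : one_eigenvalue c g -> g *m g = g -> g = 1%:M.
  move=> cg gg; have := U n g 0 cg c0; rewrite raddf0 subr0 => gU.
  by rewrite -(mulmxK gU g) gg mulmxV.
by apply: bhomP; [rewrite (Z _ _ c1 e1)|rewrite (Z _ _ c2 e2)].
Qed.

Lemma one_eigenvalue0 c (g : 'M[k]_0) : one_eigenvalue c g.
Proof. by move=> x; rewrite det_mx00. Qed.

Lemma one_eigenvalue1 c : one_eigenvalue c (c%:M : 'M[k]_1).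
Proof. by move=> x; rewrite det_mx11 !mxE. Qed.

Lemma one_eigenvalue_block n p c u (g : 'M[k]_n) (h : 'M[k]_p) :
  one_eigenvalue c g -> one_eigenvalue c h -> one_eigenvalue c (block_mx g u 0 h).
Proof.
move=> cg ch x; rewrite scalar_mx_block opp_block_mx add_block_mx !oppr0 !addr0.
by rewrite det_ublock cg ch exprD.
Qed.

(** * The ten indecomposable modules *)

Local Notation I1 := (1%:M : 'M[k]_1).
Local Notation N2 := (block_mx 0 I1 0 0 : 'M[k]_(1 + 1)).
Local Notation r01 := (row_mx 0 I1 : 'M[k]_(1, 1 + 1)).
Local Notation r10 := (row_mx I1 0 : 'M[k]_(1, 1 + 1)).
Local Notation c10 := (col_mx I1 0 : 'M[k]_(1 + 1, 1)).
Local Notation N3 := (block_mx 0 r10 0 N2 : 'M[k]_(1 + (1 + 1))).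

(* The strings [mod_ta], [mod_tb], [mod_tab] are 1 -a-> X <-t- X,
   X <-t- X -b-> 1 and 1 -a-> X <-t- X -b-> 1; [proj_1] and [proj_X] are the
   projective covers of the simple modules. *)
Definition mod_1 : bmod.
Proof. by apply: (@Bmod 1 0 0 0 0); rewrite ?mulmx0 ?mul0mx. Defined.
Definition mod_X : bmod.
Proof. by apply: (@Bmod 0 1 0 0 0); rewrite ?mulmx0 ?mul0mx. Defined.
Definition mod_a : bmod.
Proof. by apply: (@Bmod 1 1 I1 0 0); rewrite ?mulmx0 ?mul0mx. Defined.
Definition mod_b : bmod.
Proof. by apply: (@Bmod 1 1 0 I1 0); rewrite ?mulmx0 ?mul0mx. Defined.

Lemma N2N2 : N2 *m N2 = 0.
Proof. by rewrite mulmx_block !mulmx0 !mul0mx !addr0 block_mx0. Qed.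

Lemma r01N2 : r01 *m N2 = 0.
Proof. by rewrite mul_row_block !mulmx0 !mul0mx !addr0 row_mx0. Qed.

Lemma N2c10 : N2 *m c10 = 0.
Proof. by rewrite mul_block_col !mulmx0 !mul0mx !addr0 col_mx0. Qed.

Lemma r10N2 : r10 *m N2 = r01.
Proof. by rewrite mul_row_block !(mulmx0, mul0mx, addr0, mul1mx). Qed.

Definition mod_t : bmod.
Proof. by apply: (@Bmod 0 (1 + 1) 0 0 N2); rewrite ?mulmx0 ?mul0mx ?N2N2. Defined.
Definition mod_ta : bmod.
Proof. by apply: (@Bmod 1 (1 + 1) r01 0 N2); rewrite ?mulmx0 ?mul0mx ?r01N2 ?N2N2. Defined.
Definition mod_tb : bmod.
Proof. by apply: (@Bmod 1 (1 + 1) 0 c10 N2); rewrite ?mulmx0 ?mul0mx ?N2c10 ?N2N2. Defined.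
Definition mod_tab : bmod.
Proof. by apply: (@Bmod (1 + 1) (1 + 1) N2 N2 N2); rewrite N2N2. Defined.
Definition proj_1 : bmod.
Proof.
apply: (@Bmod (1 + 1) 1 c10 r01 0); rewrite ?mulmx0 ?mul0mx //.
by rewrite mul_row_col mulmx0 mul0mx addr0.
Defined.
Definition proj_X : bmod.
Proof.
apply: (@Bmod 1 (1 + (1 + 1)) (row_mx 0 r01) (col_mx I1 0) N3).
- by rewrite mul_row_block r01N2 !(mul0mx, mulmx0, addr0) row_mx0.
- by rewrite mul_block_col !(mul0mx, mulmx0, addr0) col_mx0.
- by rewrite mul_col_row mulmx_block r10N2 N2N2 !(mul0mx, mul1mx, mulmx0, add0r).
Defined.

Definition string_modules : 10.-tuple bmod :=
  [tuple mod_1; mod_X; mod_a; mod_b; mod_t; mod_ta; mod_tb; mod_tab; proj_1; proj_X].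

Lemma mx1E (g : 'M[k]_1) : exists c, g = c%:M.
Proof. by exists (g 0 0); rewrite -mx11_scalar. Qed.

Lemma mx2E (g : 'M[k]_(1 + 1)) :
  exists c u v d, g = block_mx (c%:M : 'M_1) (u%:M : 'M_1) (v%:M : 'M_1) (d%:M : 'M_1).
Proof.
have [c ec] := mx1E (ulsubmx g); have [u eu] := mx1E (ursubmx g).
have [v ev] := mx1E (dlsubmx g); have [d ed] := mx1E (drsubmx g).
by exists c, u, v, d; rewrite -ec -eu -ev -ed submxK.
Qed.

Lemma scalar_mx1_inj (c d : k) : c%:M = d%:M :> 'M_1 -> c = d.
Proof. by move/matrixP/(_ 0 0); rewrite !mxE eqxx !mulr1n. Qed.

(** Matrices commuting with a nilpotent Jordan block are polynomials in it, hence triangular with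
    constant diagonal. For [N3] below, the lower right corner commutes with [N2], which reduces that
    case to this one. *)
Lemma comm_N2 (g : 'M[k]_(1 + 1)) :
  g *m N2 = N2 *m g -> exists c (u : 'M_1), g = block_mx (c%:M : 'M_1) u 0 (c%:M : 'M_1).
Proof.
have [c [u [v [d ->]]]] := mx2E g.
rewrite !mulmx_block !(mulmx0, mul0mx, addr0, add0r, mul1mx, mulmx1).
case/eq_block_mx => /esym -> /scalar_mx1_inj -> _ _.
by exists d, u%:M.
Qed.

Lemma one_eigenvalue_N2 c (u : 'M_1) : one_eigenvalue c (block_mx (c%:M : 'M_1) u 0 (c%:M
  : 'M_1)).
Proof. by apply: one_eigenvalue_block; apply: one_eigenvalue1. Qed.

Lemma comm_N3 (g : 'M[k]_(1 + (1 + 1))) : g *m N3 = N3 *m g ->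
  exists c (u : 'M_1) w, g = block_mx (c%:M : 'M_1) w 0 (block_mx (c%:M : 'M_1) u 0 (c%:M
    : 'M_1)).
Proof.
rewrite -(submxK g); set w := ursubmx g; set x := dlsubmx g.
have [c ->] := mx1E (ulsubmx g); set h := drsubmx g.
rewrite !mulmx_block !(mulmx0, mul0mx, addr0, add0r).
case/eq_block_mx => r10x cw E2x.
have x0 : x = 0.
  move: r10x E2x; rewrite -[x]vsubmxK mul_row_col mul_block_col.
  rewrite !(mulmx0, mul0mx, addr0, add0r, mul1mx, mulmx1) => <- x2.
  by have /eq_col_mx[<- _] := etrans (col_mx0 _ _ _ _) x2; rewrite col_mx0.
rewrite x0 mul0mx add0r => /comm_N2[d [u hE]].
move: cw; rewrite hE mul_mx_row -[w]hsubmxK !mul_row_block.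
rewrite !(mulmx0, mul0mx, addr0, add0r, mul1mx, mulmx1) add_row_mx addr0.
by case/eq_row_mx => -> _; exists d, u, w; rewrite hsubmxK.
Qed.

(** Where t is nonzero, the component at X commutes with a single Jordan block and so has one
    eigenvalue; compatibility with a or b carries that eigenvalue over to the vertex 1. In the
    remaining cases the blocks have size 1, or a and b force a triangular shape. *)
Lemma string_local (i : 'I_10) : let D : bcat := tnth string_modules i in
  ~ is_zero D /\ forall e : hom D D, e ;; e = e -> e = 0 \/ e = idm D.
Proof.
case: i => [[|[|[|[|[|[|[|[|[|[|//]]]]]]]]]] lt_i] D; (apply: one_eigenvalue_local; first by []);
  move=> u; have /bmorphP := bvalP u; case: (bval u) => /= f g [ua ub ut];
    rewrite /= in f g ua ub ut *.
- by have [c ->] := mx1E f; exists c; split; [apply: one_eigenvalue1|apply: one_eigenvalue0].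
- by have [c ->] := mx1E g; exists c; split; [apply: one_eigenvalue0|apply: one_eigenvalue1].
- move: ua; have [c ->] := mx1E f; rewrite mulmx1 mul1mx => <-.
  by exists c; split; apply: one_eigenvalue1.
- move: ub; have [c ->] := mx1E g; rewrite mulmx1 mul1mx => <-.
  by exists c; split; apply: one_eigenvalue1.
- have [c [v ->]] := comm_N2 ut; exists c; split;
  [exact: one_eigenvalue0|exact: one_eigenvalue_N2].
- move: ua; have [c [v ->]] := comm_N2 ut; exists c; split; last exact: one_eigenvalue_N2.
  move: ua; rewrite mul_mx_row mul_row_block !(mulmx0, mul0mx, addr0, add0r, mul1mx, mulmx1).
  by case/eq_row_mx => _ ->; apply: one_eigenvalue1.
- move: ub; have [c [v ->]] := comm_N2 ut; exists c; split; last exact: one_eigenvalue_N2.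
  move: ub; rewrite mul_block_col mul_col_mx !(mulmx0, mul0mx, addr0, add0r, mul1mx, mulmx1).
  by case/eq_col_mx => <- _; apply: one_eigenvalue1.
- have [c [v eg]] := comm_N2 ut; move: ua ub; rewrite eg.
  have [c' [u' [v' [d ->]]]] := mx2E f.
  rewrite !mulmx_block !(mulmx0, mul0mx, addr0, add0r, mul1mx, mulmx1).
  case/eq_block_mx => _ -> _ -> /eq_block_mx[_ <- _ _].
  by exists c; split; apply: one_eigenvalue_N2.
- move: ua ub; have [c [u' [v [d ->]]]] := mx2E f; have [e ->] := mx1E g.
  rewrite mul_block_col mul_col_mx mul_mx_row mul_row_block.
  rewrite !(mulmx0, mul0mx, addr0, add0r, mul1mx, mulmx1).
  case/eq_col_mx => -> -> /eq_row_mx[_ <-].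
  by exists e; split; [apply: one_eigenvalue_N2|apply: one_eigenvalue1].
- have [c [v [w eg]]] := comm_N3 ut; exists c; rewrite eg; split; last first.
    by apply: one_eigenvalue_block; [apply: one_eigenvalue1|apply: one_eigenvalue_N2].
  move: ua; rewrite eg mul_mx_row mul_row_block !mulmx0 mul0mx add0r => /eq_row_mx[_].
  rewrite mul_mx_row mul0mx add0r mul_row_block.
  by rewrite !(mulmx0, mul0mx, addr0, add0r, mul1mx, mulmx1) => /eq_row_mx[_ ->];
    apply: one_eigenvalue1.
Qed.

(** These three invariants separate the list: dimension vectors coincide only for [mod_a], [mod_b]
    and for [mod_ta], [mod_tb], and in each pair a vanishes for exactly one module. *)
Lemma isomorphic_dims (D E : bcat) : isomorphic D E ->
  [/\ bm D = bm E, bn D = bn E & (ba D == 0) = (ba E == 0)].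
Proof.
have dims n p (A : 'M[k]_(n, p)) B : A *m B = 1%:M -> B *m A = 1%:M -> n = p.
  by move=> /mulmx1_min np /mulmx1_min pn; apply/eqP; rewrite eqn_leq np.
case=> u [v [uv vu]].
have uv1 : (bval u).1 *m (bval v).1 = 1%:M := congr1 (fun w : bhom D D => (bval w).1) uv.
have vu1 : (bval v).1 *m (bval u).1 = 1%:M := congr1 (fun w : bhom E E => (bval w).1) vu.
have uv2 : (bval u).2 *m (bval v).2 = 1%:M := congr1 (fun w : bhom D D => (bval w).2) uv.
have vu2 : (bval v).2 *m (bval u).2 = 1%:M := congr1 (fun w : bhom E E => (bval w).2) vu.
split; [exact: dims uv1 vu1|exact: dims uv2 vu2|].
have /bmorphP[ua _ _] := bvalP u; have /bmorphP[va _ _] := bvalP v.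
apply/eqP/eqP => a0.
  by rewrite -[LHS]mul1mx -vu1 -mulmxA ua a0 mul0mx mulmx0.
by rewrite -[LHS]mul1mx -uv1 -mulmxA va a0 mul0mx mulmx0.
Qed.

Lemma string_inj (i j : 'I_10) :
  @isomorphic k bcat (tnth string_modules i) (tnth string_modules j) -> i = j.
Proof.
move=> /isomorphic_dims[]; have N2n0 : N2 != 0.
  by rewrite block_mx_eq0 eqxx /= oner_eq0.
have r01n0 : r01 != 0 by rewrite row_mx_eq0 eqxx oner_eq0.
case: i => [[|[|[|[|[|[|[|[|[|[|//]]]]]]]]]] ?];
  case: j => [[|[|[|[|[|[|[|[|[|[|//]]]]]]]]]] ?] //=;
  rewrite ?eqxx ?(negPf N2n0) ?(negPf r01n0) ?oner_eq0 //; by move=> *; apply: val_inj.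
Qed.

(** Asking only for an invertible composite allows triangular composites; the inverse is absorbed
    into the projection when the summand is split off. *)
Definition retract_up_to_iso (E D : bcat) :=
  exists (u : hom E D) (v : hom D E), is_iso (u ;; v).

(* Each of the ten modules is recognised as a retract by vectors spanning a copy of
   it and functionals separating them; the composite is then triangular. *)
Lemma retract_intro (E D : bcat) f g f' g' :
  (f, g) \in bmorph E D -> (f', g') \in bmorph D E ->
  f *m f' \in unitmx -> g *m g' \in unitmx -> retract_up_to_iso E D.
Proof. by move=> P Q; exists (BHom P), (BHom Q); apply: bendo_iso. Qed.

Lemma unitmx1 (x : 'M[k]_1) : x != 0 -> x \in unitmx.
Proof.
rewrite [x]mx11_scalar unitmxE det_scalar1 unitfE; apply: contraNneq => ->.
by rewrite raddf0.
Qed.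

Lemma unitmx_block n p (x : 'M[k]_n) (y : 'M_p) z :
  x \in unitmx -> y \in unitmx -> block_mx x z 0 y \in unitmx.
Proof. by rewrite !unitmxE det_ublock unitrM => -> ->. Qed.

(** * Recognising the ten modules as direct summands *)

Section Retracts.
Context (D : bcat).
Local Notation a := (ba D).
Local Notation b := (bb D).
Local Notation t := (bt D).

Lemma act_ba p (x : 'M_(p, _)) : x *m b *m a = x *m t *m t.
Proof. by rewrite -!mulmxA bb_ba. Qed.
Lemma act_at p (x : 'M_(p, _)) : x *m a *m t = 0.
Proof. by rewrite -mulmxA ba_bt mulmx0. Qed.
Lemma act_tb p (x : 'M_(p, _)) : x *m t *m b = 0.
Proof. by rewrite -mulmxA bt_bb mulmx0. Qed.
Lemma act_ttt p (x : 'M_(p, _)) : x *m t *m t *m t = 0.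
Proof. by rewrite -(act_ba x) act_at. Qed.
Lemma ba_bt' p (x : 'M_(_, p)) : a *m (t *m x) = 0.
Proof. by rewrite mulmxA ba_bt mul0mx. Qed.
Lemma bt_bb' p (x : 'M_(_, p)) : t *m (b *m x) = 0.
Proof. by rewrite mulmxA bt_bb mul0mx. Qed.

Lemma bt_bt_bt' p (x : 'M_(_, p)) : t *m (t *m (t *m x)) = 0.
Proof. by rewrite (mulmxA t t) -bb_ba -mulmxA ba_bt' mulmx0. Qed.

Local Ltac mx := rewrite ?(mul_block_col, mul_row_block, mul_col_row, mul_mx_row, mul_row_col)
  ?mul_col_mx ?(mulmx0, mul0mx, addr0, add0r, mul1mx, mulmx1).

(** [v] defines a map out of the projective [proj_X], and [x] a map into it, since it is injective
    as well. The composite is invertible because it does not vanish on the socle, spanned by v t^2 =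
    v b a. *)
Lemma retract_proj_X (v : 'rV_(bn D)) (x : 'cV_(bn D)) :
  v *m t *m t *m x != 0 -> retract_up_to_iso proj_X D.
Proof.
move=> nz.
apply: (@retract_intro proj_X D (v *m b) (col_mx v (col_mx (v *m t) (v *m t *m t)))
  (a *m x) (row_mx (t *m (t *m x)) (row_mx (t *m x) x))).
- apply/bmorphP; split=> /=.
  + by mx; rewrite act_ba.
  + by mx; rewrite !act_tb !col_mx0.
  + by mx; rewrite act_ttt.
- apply/bmorphP; split=> /=.
  + by mx; rewrite !ba_bt'.
  + by mx; rewrite !mulmxA bb_ba.
  + by mx; rewrite bt_bt_bt' add_row_mx addr0 add0r.
- by have /unitmx1 : v *m b *m (a *m x) != 0 by rewrite mulmxA act_ba.
- mx; rewrite !mulmxA !act_ttt !mul0mx col_mx0.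
  apply: unitmx_block; first exact: unitmx1.
  by mx; apply: unitmx_block; apply: unitmx1.
Qed.

Lemma retract_proj_1 (v : 'rV_(bm D)) (x : 'cV_(bm D)) :
  v *m a *m b *m x != 0 -> retract_up_to_iso proj_1 D.
Proof.
move=> nz.
apply: (@retract_intro proj_1 D (col_mx v (v *m a *m b)) (v *m a)
  (row_mx (a *m (b *m x)) x) (b *m x)).
- apply/bmorphP; split=> /=.
  + by mx; rewrite act_ba !act_at !mul0mx.
  + by mx.
  + by mx; rewrite act_at.
- apply/bmorphP; split=> /=.
  + by mx.
  + by mx; rewrite (mulmxA b a) bb_ba -mulmxA bt_bb' mulmx0.
  + by mx; rewrite bt_bb'.
- mx; rewrite !mulmxA act_ba !act_at !mul0mx.
  by apply: unitmx_block; apply: unitmx1.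
- by have /unitmx1 : v *m a *m (b *m x) != 0 by rewrite mulmxA.
Qed.

Hypothesis tt0 : t *m t = 0.

Lemma act_tt p (x : 'M_(p, _)) : x *m t *m t = 0.
Proof. by rewrite -mulmxA tt0 mulmx0. Qed.
Lemma bt_bt' p (x : 'M_(_, p)) : t *m (t *m x) = 0.
Proof. by rewrite mulmxA tt0 mul0mx. Qed.
Lemma bb_ba' p (x : 'M_(_, p)) : b *m (a *m x) = 0.
Proof. by rewrite mulmxA bb_ba tt0 mul0mx. Qed.

(** All diagonal entries of the composite equal m a x = n t x = n b y, so one nonvanishing number
    suffices. *)
Lemma retract_mod_tab (m : 'rV_(bm D)) (n : 'rV_(bn D)) (x : 'cV_(bn D)) (y : 'cV_(bm D)) :
  m *m a = n *m t -> t *m x = b *m y -> m *m a *m x != 0 -> retract_up_to_iso mod_tab D.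
Proof.
move=> man txy nz.
apply: (@retract_intro mod_tab D (col_mx m (n *m b)) (col_mx n (n *m t))
  (row_mx (a *m x) y) (row_mx (t *m x) x)).
- apply/bmorphP; split=> /=.
  + by mx; rewrite act_ba act_tt man.
  + by mx; rewrite act_tb.
  + by mx; rewrite act_tt.
- apply/bmorphP; split=> /=.
  + by mx; rewrite ba_bt'.
  + by mx; rewrite bb_ba' txy.
  + by mx; rewrite bt_bt'.
- mx; rewrite !mulmxA act_ba act_tt mul0mx -(mulmxA n) -txy mulmxA -man.
  by apply: unitmx_block; apply: unitmx1.
- mx; rewrite !mulmxA act_tt mul0mx -man.
  by apply: unitmx_block; apply: unitmx1.
Qed.

Lemma retract_mod_tb (n : 'rV_(bn D)) (x : 'cV_(bn D)) (y : 'cV_(bm D)) :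
  a *m x = 0 -> t *m x = b *m y -> n *m t *m x != 0 -> retract_up_to_iso mod_tb D.
Proof.
move=> ax txy nz.
apply: (@retract_intro mod_tb D (n *m b) (col_mx n (n *m t)) y (row_mx (t *m x) x)).
- apply/bmorphP; split=> /=.
  + by mx; rewrite act_ba act_tt.
  + by mx; rewrite act_tb.
  + by mx; rewrite act_tt.
- apply/bmorphP; split=> /=.
  + by mx; rewrite ba_bt' ax row_mx0.
  + by mx.
  + by mx; rewrite bt_bt'.
- by have /unitmx1 : n *m b *m y != 0 by rewrite -mulmxA -txy mulmxA.
- mx; rewrite !mulmxA act_tt mul0mx.
  by apply: unitmx_block; apply: unitmx1.
Qed.

Lemma retract_mod_ta (m : 'rV_(bm D)) (n : 'rV_(bn D)) (x : 'cV_(bn D)) :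
  m *m a = n *m t -> n *m b = 0 -> n *m t *m x != 0 -> retract_up_to_iso mod_ta D.
Proof.
move=> man nb nz.
apply: (@retract_intro mod_ta D m (col_mx n (n *m t)) (a *m x) (row_mx (t *m x) x)).
- apply/bmorphP; split=> /=.
  + by mx.
  + by mx; rewrite nb act_tb col_mx0.
  + by mx; rewrite act_tt.
- apply/bmorphP; split=> /=.
  + by mx; rewrite ba_bt'.
  + by mx; rewrite bb_ba'.
  + by mx; rewrite bt_bt'.
- by have /unitmx1 : m *m (a *m x) != 0 by rewrite mulmxA man.
- mx; rewrite !mulmxA act_tt mul0mx.
  by apply: unitmx_block; apply: unitmx1.
Qed.

Lemma retract_mod_t (n : 'rV_(bn D)) (x : 'cV_(bn D)) :
  n *m b = 0 -> a *m x = 0 -> n *m t *m x != 0 -> retract_up_to_iso mod_t D.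
Proof.
move=> nb ax nz.
apply: (@retract_intro mod_t D 0 (col_mx n (n *m t)) 0 (row_mx (t *m x) x)).
- apply/bmorphP; split=> /=.
  + by mx; apply/matrixP => [[]].
  + by mx; rewrite nb act_tb col_mx0.
  + by mx; rewrite act_tt.
- apply/bmorphP; split=> /=.
  + by mx; rewrite ba_bt' ax row_mx0.
  + by mx.
  + by mx; rewrite bt_bt'.
- by rewrite unitmxE det_mx00 unitr1.
- mx; rewrite !mulmxA act_tt mul0mx.
  by apply: unitmx_block; apply: unitmx1.
Qed.

Hypothesis ab0 : a *m b = 0.

Lemma act_ab p (x : 'M_(p, _)) : x *m a *m b = 0.
Proof. by rewrite -mulmxA ab0 mulmx0. Qed.
Lemma ba_bb' p (x : 'M_(_, p)) : a *m (b *m x) = 0.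
Proof. by rewrite mulmxA ab0 mul0mx. Qed.

Lemma retract_mod_a (m : 'rV_(bm D)) (x : 'cV_(bn D)) :
  t *m x = 0 -> m *m a *m x != 0 -> retract_up_to_iso mod_a D.
Proof.
move=> tx nz; apply: (@retract_intro mod_a D m (m *m a) (a *m x) x).
- by apply/bmorphP; split=> /=; mx; rewrite ?act_at ?act_ab.
- by apply/bmorphP; split=> /=; mx; rewrite ?bb_ba' ?tx.
- by have /unitmx1 : m *m (a *m x) != 0 by rewrite mulmxA.
- exact: unitmx1.
Qed.

Lemma retract_mod_b (n : 'rV_(bn D)) (y : 'cV_(bm D)) :
  n *m t = 0 -> n *m b *m y != 0 -> retract_up_to_iso mod_b D.
Proof.
move=> nt nz; apply: (@retract_intro mod_b D (n *m b) n y (b *m y)).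
- by apply/bmorphP; split=> /=; mx; rewrite ?act_ba ?act_tt ?nt.
- by apply/bmorphP; split=> /=; mx; rewrite ?ba_bb' ?bt_bb'.
- exact: unitmx1.
- by have /unitmx1 : n *m (b *m y) != 0 by rewrite mulmxA.
Qed.

Lemma retract_mod_X (n : 'rV_(bn D)) (x : 'cV_(bn D)) :
  n *m t = 0 -> n *m b = 0 -> a *m x = 0 -> t *m x = 0 -> n *m x != 0 ->
  retract_up_to_iso mod_X D.
Proof.
move=> nt nb ax tx nz; apply: (@retract_intro mod_X D 0 n 0 x).
- by apply/bmorphP; split=> /=; mx; rewrite ?nt ?nb //; apply/matrixP => [[]].
- by apply/bmorphP; split=> /=; mx; rewrite ?ax ?tx //; apply/matrixP => ? [].
- by rewrite unitmxE det_mx00 unitr1.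
- exact: unitmx1.
Qed.

Lemma retract_mod_1 (m : 'rV_(bm D)) (y : 'cV_(bm D)) :
  m *m a = 0 -> b *m y = 0 -> m *m y != 0 -> retract_up_to_iso mod_1 D.
Proof.
move=> ma b_y nz; apply: (@retract_intro mod_1 D m 0 y 0).
- by apply/bmorphP; split=> /=; mx; rewrite ?ma //; apply/matrixP => [[]].
- by apply/bmorphP; split=> /=; mx; rewrite ?b_y //; apply/matrixP => ? [].
- exact: unitmx1.
- by rewrite unitmxE det_mx00 unitr1.
Qed.

End Retracts.

Lemma mx_test n p (A : 'M[k]_(n, p)) :
  (forall (v : 'rV_n) (x : 'cV_p), v *m A *m x = 0) -> A = 0.
Proof.
move=> A0; apply/matrixP => i j; have := A0 (delta_mx 0 i) (delta_mx j 0).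
by move/matrixP/(_ 0 0); rewrite -rowE -colE !mxE.
Qed.

Lemma rowvec_test n p (A : 'M[k]_(n, p)) : (forall v : 'rV_n, v *m A = 0) -> A = 0.
Proof. by move=> A0; apply: mx_test => v x; rewrite A0 mul0mx. Qed.

Lemma colvec_test n p (A : 'M[k]_(n, p)) : (forall v : 'cV_p, A *m v = 0) -> A = 0.
Proof. by move=> A0; apply: mx_test => v x; rewrite -mulmxA A0 mulmx0. Qed.

(** The columns of [cokermx B] lie in the kernel of [B], so [A] kills them, and this is the
    criterion for the row space of [A] to lie in that of [B]. *)
Lemma row_factor n p q (A : 'M[k]_(p, n)) (B : 'M[k]_(q, n)) :
  (forall x : 'cV_n, B *m x = 0 -> A *m x = 0) -> exists C, A = C *m B.
Proof.
move=> AB; apply/submxP; rewrite submxE; apply/eqP/matrixP => i j.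
have /AB : B *m (cokermx B *m (delta_mx j 0 : 'cV_n)) = 0 by rewrite mulmxA mulmx_coker mul0mx.
rewrite mulmxA -colE => /matrixP/(_ i 0); rewrite mxE => ->; by rewrite !mxE.
Qed.

Lemma col_factor n p q (A : 'M[k]_(n, p)) (B : 'M[k]_(n, q)) :
  (forall x : 'rV_n, x *m B = 0 -> x *m A = 0) -> exists C, A = B *m C.
Proof.
move=> AB; have [x xB|C eC] := @row_factor n _ _ A^T B^T.
  by apply: trmx_inj; rewrite trmx_mul trmxK trmx0 AB //; apply: trmx_inj;
    rewrite trmx_mul trmxK trmx0.
by exists C^T; apply: trmx_inj; rewrite trmx_mul trmxK.
Qed.

Lemma string_retract (D : bcat) : ~ is_zero D ->
  exists i : 'I_10, retract_up_to_iso (tnth string_modules i) D.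
Proof.
move=> nz; apply: contrapT => none; apply: nz.
have no (i : 'I_10) : ~ retract_up_to_iso (tnth string_modules i) D.
  by move=> r; apply: none; exists i.
have absurd (i : 'I_10) n p (x : 'M[k]_(n, p)) :
    (x != 0 -> retract_up_to_iso (tnth string_modules i) D) -> x = 0.
  by move=> r; apply/eqP/negPn/negP => /r/no.
(* [o i isT] is position i in [string_modules], counted from 0. The two projectives, 9 and 8, are
   excluded first; afterwards all paths of length two are zero. *)
pose o n (l : (n < 10)%N) := Ordinal l.
have tt0 : bt D *m bt D = 0.
  apply: mx_test => v x; rewrite mulmxA; apply: (absurd (o 9 isT)).
  exact: retract_proj_X.
have ab0 : ba D *m bb D = 0.
  apply: mx_test => v x; rewrite mulmxA; apply: (absurd (o 8 isT)).
  exact: retract_proj_1.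
(* Since [mod_a] does not split off, a kills the kernel of t and therefore factors through t; dually
   for b and [mod_b]. *)
have [C aE] : exists C, ba D = C *m bt D.
  apply: row_factor => x tx; apply: rowvec_test => v; rewrite mulmxA.
  by apply: (absurd (o 2 isT)); apply: retract_mod_a.
have [C' bE] : exists C', bb D = bt D *m C'.
  apply: col_factor => v vt; apply: colvec_test => x.
  by apply: (absurd (o 3 isT)); apply: retract_mod_b.
(* The factorisations supply the data of [mod_tab]: n = v C satisfies n t = v a, and x = C' y
   satisfies t x = b y. *)
have aC' : ba D *m C' = 0.
  apply: mx_test => v y; rewrite mulmxA -mulmxA; apply: (absurd (o 7 isT)).
  apply: (@retract_mod_tab _ _ _ (v *m C) _ y) => //.
    by rewrite aE mulmxA.
  by rewrite bE mulmxA.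
(* Now n = v C also satisfies n b = v C t C' = v a C' = 0, the extra condition for [mod_ta]. *)
have a0 : ba D = 0.
  apply: mx_test => v x; rewrite aE mulmxA; apply: (absurd (o 5 isT)).
  apply: (@retract_mod_ta _ _ v) => //; first by rewrite aE mulmxA.
  by rewrite bE mulmxA -(mulmxA v) -aE -mulmxA aC' mulmx0.
have b0 : bb D = 0.
  apply: mx_test => v y; rewrite bE mulmxA -mulmxA; apply: (absurd (o 6 isT)).
  apply: (@retract_mod_tb _ _ _ _ y) => //; first by rewrite a0 mul0mx.
  by rewrite bE mulmxA.
have t0 : bt D = 0.
  apply: mx_test => v x; apply: (absurd (o 4 isT)).
  by apply: retract_mod_t; rewrite // ?b0 ?a0 ?mulmx0 ?mul0mx.
apply: bhomP => /=; apply: mx_test => v x; rewrite mulmx1.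
  apply: (absurd (o 0 isT)).
  by apply: retract_mod_1; rewrite // ?b0 ?a0 ?mulmx0 ?mul0mx.
apply: (absurd (o 1 isT)).
by apply: retract_mod_X; rewrite // ?b0 ?a0 ?t0 ?mulmx0 ?mul0mx.
Qed.

End BrauerModules.
Arguments bmorph {k} D E u.

(** * Half-braidings in coordinates *)

Section Skeleton.
Context (k : fieldType) (C : monCat k) (L : finType) (S : L -> C).

(** A Kronecker delta with values in morphisms. Labels may be equal only propositionally, so the
    identity is transported along the equality. *)
Definition lid x y : hom (S x) (S y) :=
  if x =P y is ReflectT e then ecast z (hom (S x) (S z)) e (idm (S x)) else 0.

Lemma lidxx x : lid x x = idm (S x).
Proof. by rewrite /lid; case: eqP => // e; rewrite eq_axiomK. Qed.

Lemma lid_neq x y : x != y -> lid x y = 0.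
Proof. by rewrite /lid; case: eqP. Qed.

Lemma iassoc_nat (x x' y y' z z' : C) (f : hom x x') (g : hom y y') (e : hom z z') :
  iassoc x y z ;; ((f \om g) \om e) = (f \om (g \om e)) ;; iassoc x' y' z'.
Proof.
rewrite -[LHS]compm1 -assocK compA -(compA (iassoc x y z)) assoc_nat.
by rewrite !compA iassocK comp1m.
Qed.

(** [is_dsum] only asserts that inclusions and projections exist; here they are data in which
    coordinates can be taken, with both orthogonality relations in one formula. *)
Record frame (I : finType) (l : I -> L) (Z : C) := Frame {
  fin : forall a, hom (S (l a)) Z;
  fpr : forall a, hom Z (S (l a));
  fin_pr : forall a b, fin a ;; fpr b = (a == b)%:R *: lid (l a) (l b);
  fpr_in : \sum_a fpr a ;; fin a = idm Z
}.

Lemma frame_of_dsum (I : finType) (l : I -> L) (Z : C) :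
  is_dsum (fun a => S (l a)) Z -> exists _ : frame l Z, True.
Proof.
case=> i [p [ip1 ip0 pi1]]; suff ip a b : i a ;; p b = (a == b)%:R *: lid (l a) (l b).
  by exists (Frame ip pi1).
have [->|ne] := eqVneq a b; first by rewrite ip1 scale1r lidxx.
by rewrite ip0 // scale0r.
Qed.

(* The 6j-symbols of a concrete category are computed with this criterion. *)
Lemma expand_triple (inc : forall x y r, hom (S r) (S x \ox S y))
    (prj : forall x y r, hom (S x \ox S y) (S r)) x y w r
    (f : hom (S r) ((S x \ox S y) \ox S w)) (c : L -> k) :
  (forall a b (g : hom (S a) (S b)), a != b -> g = 0) ->
  (forall a b, \sum_r prj a b r ;; inc a b r = idm (S a \ox S b)) ->
  (forall t, f ;; (prj x y t \om idm (S w)) ;; prj t w r = c t *: idm (S r)) ->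
  f = \sum_t c t *: (inc t w r ;; (inc x y t \om idm (S w))).
Proof.
move=> orth prj_inc fc; rewrite -[LHS]compm1 -tensm1 -prj_inc tensm_suml comp_sumr.
apply: eq_bigr => t _; rewrite -[idm (S w) in LHS]comp1m tensm_comp compA.
set h := f ;; _; rewrite -[h]compm1 -prj_inc comp_sumr comp_suml (bigD1 r) //= big1.
  by rewrite addr0 !compA /h fc compZl comp1m compZl.
by move=> r' ne; rewrite !compA (orth r r' (h ;; _)) 1?eq_sym // !comp0m.
Qed.

Context (N : L -> L -> L -> bool) (sixj : L -> L -> L -> L -> L -> L -> k).

(* Multiplicity-free fusion rules [N] and 6j-symbols.  No unit label is singled
   out: the unit constraints are 6j-symbols as well. *)
Record skeleton := Skeleton {
  schur : forall x y (f : hom (S x) (S y)), exists c, f = c *: lid x y;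
  simple_neq0 : forall x, idm (S x) <> 0;
  semisimple : forall V : C,
    exists (I : finType) (l : I -> L) (_ : frame l V), True;
  incS : forall x y r, hom (S r) (S x \ox S y);
  prjS : forall x y r, hom (S x \ox S y) (S r);
  incS_prj : forall x y r, incS x y r ;; prjS x y r = (N x y r)%:R *: idm (S r);
  prjS_inc : forall x y, \sum_r prjS x y r ;; incS x y r = idm (S x \ox S y);
  sixjN : forall x y w r s t, ~~ N x y t -> sixj x y w r s t = 0;
  sixjE : forall x y w r s,
    incS x s r ;; (idm (S x) \om incS y w s) ;; iassoc (S x) (S y) (S w) =
    \sum_t sixj x y w r s t *: (incS t w r ;; (incS x y t \om idm (S w)))
}.

Context (K : skeleton).
Local Notation inc := (incS K).
Local Notation prj := (prjS K).

Definition sc x y (f : hom (S x) (S y)) : k := projT1 (cid (schur K f)).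
Lemma scE x y (f : hom (S x) (S y)) : f = sc f *: lid x y.
Proof. exact: projT2 (cid (schur K f)). Qed.

Lemma simple_neq x y (f : hom (S x) (S y)) : x != y -> f = 0.
Proof. by move=> ne; rewrite (scE f) lid_neq ?scaler0. Qed.

Lemma scale_simple_inj x a b : a *: idm (S x) = b *: idm (S x) -> a = b.
Proof.
move=> e; have /eqP : (a - b) *: idm (S x) = 0 by rewrite scalerBl e subrr.
by rewrite scaler_eq0 subr_eq0 => /orP[/eqP //|/eqP /(simple_neq0 K)].
Qed.

Lemma inc_prjE x y r s : inc x y r ;; prj x y s = (N x y r)%:R *: lid r s.
Proof.
have [<-|ne] := eqVneq r s; first by rewrite incS_prj lidxx.
by rewrite lid_neq // scaler0; apply: simple_neq.
Qed.

(** A skeleton provides inclusions for all triples of labels; completeness, [prjS_inc], forces those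
    forbidden by [N] to vanish. *)
Lemma incN x y r : (N x y r)%:R *: inc x y r = inc x y r.
Proof.
rewrite -[in RHS](compm1 (inc x y r)) -(prjS_inc K) comp_sumr (bigD1 r) //=.
rewrite big1 ?addr0 => [|s ne]; rewrite compA.
  by rewrite incS_prj compZl comp1m.
by rewrite inc_prjE lid_neq 1?eq_sym // scaler0 comp0m.
Qed.

Section Frames.
Context (I : finType) (l : I -> L) (Z : C) (fZ : frame l Z).
Implicit Types (a b c d : I) (r s t x y z : L).

(** Over the admissible channels, [linc] and [rinc] are bases of the spaces of morphisms from [S s]
    to [S y \ox Z] and to [Z \ox S y]; [lprj] and [rprj] are the dual bases. *)
Definition linc y s b : hom (S s) (S y \ox Z) :=
  inc y (l b) s ;; (idm (S y) \om fin fZ b).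
Definition lprj y s b : hom (S y \ox Z) (S s) :=
  (idm (S y) \om fpr fZ b) ;; prj y (l b) s.
Definition rinc y s d : hom (S s) (Z \ox S y) :=
  inc (l d) y s ;; (fin fZ d \om idm (S y)).
Definition rprj y s d : hom (Z \ox S y) (S s) :=
  (fpr fZ d \om idm (S y)) ;; prj (l d) y s.

Lemma linc_lprj y s s' b b' :
  linc y s b ;; lprj y s' b' = ((b == b') && N y (l b) s)%:R *: lid s s'.
Proof.
rewrite /linc /lprj -compA [_ ;; (_ ;; prj _ _ _)]compA -tensm_comp compm1 fin_pr.
have [<-|ne] := eqVneq b b'; last by rewrite scale0r tensm0 comp0m compm0 scale0r.
by rewrite scale1r lidxx tensm1 comp1m inc_prjE.
Qed.

Lemma rinc_rprj y s s' d d' :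
  rinc y s d ;; rprj y s' d' = ((d == d') && N (l d) y s)%:R *: lid s s'.
Proof.
rewrite /rinc /rprj -compA [_ ;; (_ ;; prj _ _ _)]compA -tensm_comp compm1 fin_pr.
have [<-|ne] := eqVneq d d'; last by rewrite scale0r tens0m comp0m compm0 scale0r.
by rewrite scale1r lidxx tensm1 comp1m inc_prjE.
Qed.

Lemma lprj_linc y : \sum_b \sum_s lprj y s b ;; linc y s b = idm (S y \ox Z).
Proof.
rewrite -tensm1 -(fpr_in fZ) tensm_sumr; apply: eq_bigr => b _.
under eq_bigr => s _ do rewrite /lprj /linc -compA [prj _ _ _ ;; _]compA.
by rewrite -comp_sumr -comp_suml prjS_inc comp1m -tensm_comp compm1.
Qed.

Lemma rprj_rinc y : \sum_d \sum_s rprj y s d ;; rinc y s d = idm (Z \ox S y).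
Proof.
rewrite -tensm1 -(fpr_in fZ) tensm_suml; apply: eq_bigr => b _.
under eq_bigr => s _ do rewrite /rprj /rinc -compA [prj _ _ _ ;; _]compA.
by rewrite -comp_sumr -comp_suml prjS_inc comp1m -tensm_comp compm1.
Qed.

Lemma linc_ext y V (f g : hom (S y \ox Z) V) :
  (forall s b, linc y s b ;; f = linc y s b ;; g) -> f = g.
Proof.
move=> e; rewrite -(comp1m f) -(comp1m g) -lprj_linc !comp_suml.
apply: eq_bigr => b _; rewrite !comp_suml; apply: eq_bigr => s _.
by rewrite -!(compA _ (linc y s b)) e.
Qed.

Lemma rinc_ext y V (f g : hom (Z \ox S y) V) :
  (forall s b, rinc y s b ;; f = rinc y s b ;; g) -> f = g.
Proof.
move=> e; rewrite -(comp1m f) -(comp1m g) -rprj_rinc !comp_suml.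
apply: eq_bigr => b _; rewrite !comp_suml; apply: eq_bigr => s _.
by rewrite -!(compA _ (rinc y s b)) e.
Qed.

Lemma lincN y s b : (N y (l b) s)%:R *: linc y s b = linc y s b.
Proof. by rewrite /linc -compZl incN. Qed.

Lemma rincN y s b : (N (l b) y s)%:R *: rinc y s b = rinc y s b.
Proof. by rewrite /rinc -compZl incN. Qed.

(* [H s] is the matrix of a morphism on the multiplicity spaces of [S s]. *)
Definition coef := L -> I -> I -> k.
Definition lrep y (H : coef) (h : hom (S y \ox Z) (Z \ox S y)) :=
  forall s b, linc y s b ;; h = \sum_d H s b d *: rinc y s d.
Definition rrep y (H : coef) (h : hom (Z \ox S y) (S y \ox Z)) :=
  forall s b, rinc y s b ;; h = \sum_d H s b d *: linc y s d.

Lemma rinc_expand y s (f : hom (S s) (Z \ox S y)) :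
  f = \sum_d sc (f ;; rprj y s d) *: rinc y s d.
Proof.
rewrite -[LHS]compm1 -rprj_rinc comp_sumr; apply: eq_bigr => d _.
rewrite comp_sumr (bigD1 s) //= big1 ?addr0 => [|s' ne]; rewrite compA.
  by rewrite {1}[f ;; _]scE compZl lidxx comp1m.
by rewrite (simple_neq (f ;; _)) 1?eq_sym // comp0m.
Qed.

Lemma linc_expand y s (f : hom (S s) (S y \ox Z)) :
  f = \sum_d sc (f ;; lprj y s d) *: linc y s d.
Proof.
rewrite -[LHS]compm1 -lprj_linc comp_sumr; apply: eq_bigr => d _.
rewrite comp_sumr (bigD1 s) //= big1 ?addr0 => [|s' ne]; rewrite compA.
  by rewrite {1}[f ;; _]scE compZl lidxx comp1m.
by rewrite (simple_neq (f ;; _)) 1?eq_sym // comp0m.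
Qed.

Lemma linc_eq0 y s b : ~~ N y (l b) s -> linc y s b = 0.
Proof. by move/negPf => n; rewrite -lincN n scale0r. Qed.

Lemma rinc_eq0 y s b : ~~ N (l b) y s -> rinc y s b = 0.
Proof. by move/negPf => n; rewrite -rincN n scale0r. Qed.

(** Coefficients at forbidden channels are undetermined, because the vectors there vanish. Setting
    them to 0 allows comparison with explicit matrices entry by entry. *)
Lemma lrep_ex y h : exists2 H, @lrep y H h &
  forall s b d, ~~ (N y (l b) s && N (l d) y s) -> H s b d = 0.
Proof.
exists (fun s b d => if N y (l b) s && N (l d) y s then sc (linc y s b ;; h ;;
  rprj y s d) else 0).
  move=> s b; case: (boolP (N y (l b) s)) => /= [_|/linc_eq0 ->].
    rewrite {1}[LHS]rinc_expand; apply: eq_bigr => d _.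
    by case: (boolP (N (l d) y s)) => // /rinc_eq0 ->; rewrite !scaler0.
  by rewrite comp0m big1 // => d _; rewrite scale0r.
by move=> s b d /negPf ->.
Qed.

Lemma rrep_ex y h : exists2 H, @rrep y H h &
  forall s b d, ~~ (N (l b) y s && N y (l d) s) -> H s b d = 0.
Proof.
exists (fun s b d => if N (l b) y s && N y (l d) s then sc (rinc y s b ;; h ;;
  lprj y s d) else 0).
  move=> s b; case: (boolP (N (l b) y s)) => /= [_|/rinc_eq0 ->].
    rewrite {1}[LHS]linc_expand; apply: eq_bigr => d _.
    by case: (boolP (N y (l d) s)) => // /linc_eq0 ->; rewrite !scaler0.
  by rewrite comp0m big1 // => d _; rewrite scale0r.
by move=> s b d /negPf ->.
Qed.

Lemma lrep_comp y H H' h h' : @lrep y H h -> @rrep y H' h' ->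
  h ;; h' = idm (S y \ox Z) -> forall s b e, N y (l e) s ->
  \sum_d H s b d * H' s d e = (b == e)%:R.
Proof.
move=> Hh Hh' hh' s b e n; apply: (scale_simple_inj (x := s)).
transitivity (linc y s b ;; (h ;; h') ;; lprj y s e).
  rewrite compA Hh !comp_suml scaler_suml; apply: eq_bigr => d _.
  rewrite !compZl Hh' comp_suml (bigD1 e) //= big1 ?addr0 => [|e' ne].
    by rewrite compZl linc_lprj eqxx n lidxx scale1r scalerA.
  by rewrite compZl linc_lprj (negPf ne) scale0r scaler0.
rewrite hh' compm1 linc_lprj lidxx; congr (_%:R *: _).
by have [->|] := eqVneq b e; rewrite ?n.
Qed.

Lemma sum_rinc_rprj y s (c : I -> k) d :
  (\sum_e c e *: rinc y s e) ;; rprj y s d = (c d * (N (l d) y s)%:R) *: idm (S s).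
Proof.
rewrite comp_suml (bigD1 d) //= big1 ?addr0 => [|e ne].
  by rewrite compZl rinc_rprj eqxx lidxx scalerA.
by rewrite compZl rinc_rprj (negPf ne) scale0r scaler0.
Qed.

Definition lmor y (H : coef) : hom (S y \ox Z) (Z \ox S y) :=
  \sum_b \sum_s lprj y s b ;; (\sum_d H s b d *: rinc y s d).
Definition rmor y (H : coef) : hom (Z \ox S y) (S y \ox Z) :=
  \sum_b \sum_s rprj y s b ;; (\sum_d H s b d *: linc y s d).

Lemma lmorP y H : (forall s b d, ~~ N y (l b) s -> H s b d = 0) -> lrep H (lmor y H).
Proof.
move=> H0 s b; rewrite comp_sumr (bigD1 b) //= [X in _ + X]big1 => [|c ne].
  rewrite addr0 comp_sumr (bigD1 s) //= [X in _ + X]big1 => [|s' ne].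
    rewrite addr0 compA linc_lprj eqxx /= lidxx compZl comp1m scaler_sumr.
    apply: eq_bigr => d _; rewrite scalerA; case: (boolP (N _ _ _)) => n.
      by rewrite mul1r.
    by rewrite mul0r H0.
  by rewrite compA linc_lprj lid_neq 1?eq_sym // scaler0 comp0m.
rewrite comp_sumr big1 // => s' _; rewrite compA linc_lprj eq_sym (negPf ne).
by rewrite scale0r comp0m.
Qed.

Lemma rmorP y H : (forall s b d, ~~ N (l b) y s -> H s b d = 0) -> rrep H (rmor y H).
Proof.
move=> H0 s b; rewrite comp_sumr (bigD1 b) //= [X in _ + X]big1 => [|c ne].
  rewrite addr0 comp_sumr (bigD1 s) //= [X in _ + X]big1 => [|s' ne].
    rewrite addr0 compA rinc_rprj eqxx /= lidxx compZl comp1m scaler_sumr.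
    apply: eq_bigr => d _; rewrite scalerA; case: (boolP (N _ _ _)) => n.
      by rewrite mul1r.
    by rewrite mul0r H0.
  by rewrite compA rinc_rprj lid_neq 1?eq_sym // scaler0 comp0m.
rewrite comp_sumr big1 // => s' _; rewrite compA rinc_rprj eq_sym (negPf ne).
by rewrite scale0r comp0m.
Qed.

Lemma lrep_inv y H H' h h' : lrep H h -> rrep H' h' ->
  (forall s b e, \sum_d H s b d * H' s d e = ((b == e) && N y (l b) s)%:R) ->
  h ;; h' = idm (S y \ox Z).
Proof.
move=> Hh Hh' HH; apply: linc_ext => s b; rewrite compA Hh comp_suml compm1.
under eq_bigr => d _ do rewrite compZl Hh' scaler_sumr.
rewrite exchange_big /= -lincN (bigD1 b) //= [X in _ + X]big1 => [|e ne].
  rewrite addr0; under eq_bigr => d _ do rewrite scalerA.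
  by rewrite -scaler_suml HH eqxx.
under eq_bigr => d _ do rewrite scalerA.
by rewrite -scaler_suml HH eq_sym (negPf ne) scale0r.
Qed.

Lemma rrep_inv y H H' h h' : rrep H h -> lrep H' h' ->
  (forall s b e, \sum_d H s b d * H' s d e = ((b == e) && N (l b) y s)%:R) ->
  h ;; h' = idm (Z \ox S y).
Proof.
move=> Hh Hh' HH; apply: rinc_ext => s b; rewrite compA Hh comp_suml compm1.
under eq_bigr => d _ do rewrite compZl Hh' scaler_sumr.
rewrite exchange_big /= -rincN (bigD1 b) //= [X in _ + X]big1 => [|e ne].
  rewrite addr0; under eq_bigr => d _ do rewrite scalerA.
  by rewrite -scaler_suml HH eqxx.
under eq_bigr => d _ do rewrite scalerA.
by rewrite -scaler_suml HH eq_sym (negPf ne) scale0r.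
Qed.

Context (h : forall y, hom (S y \ox Z) (Z \ox S y)) (H : L -> coef).
Hypothesis hH : forall y, lrep (H y) (h y).

(** These vectors pass through the channel s of [S y' \ox Z], whereas those of [rinc2] pass through
    the channel t of [Z \ox S y]. The change of bracketing between the two is where 6j-symbols
    enter. *)
Definition linc2 y y' s r b : hom (S r) ((S y \ox S y') \ox Z) :=
  inc y s r ;; (idm (S y) \om linc y' s b) ;; iassoc (S y) (S y') Z.
Definition rinc2 y y' t r d : hom (S r) (Z \ox (S y \ox S y')) :=
  inc t y' r ;; (rinc y t d \om idm (S y')) ;; assoc Z (S y) (S y').
Definition rprj2 y y' t r d : hom (Z \ox (S y \ox S y')) (S r) :=
  iassoc Z (S y) (S y') ;; (rprj y t d \om idm (S y')) ;; prj t y' r.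

Lemma linc2_ext y y' V (f g : hom ((S y \ox S y') \ox Z) V) :
  (forall s r b, linc2 y y' s r b ;; f = linc2 y y' s r b ;; g) -> f = g.
Proof.
move=> e; rewrite -[f]comp1m -[g]comp1m -!assocK -!compA; congr (_ ;; _).
rewrite -[_ ;; f]comp1m -[_ ;; g]comp1m -tensm1 -lprj_linc !tensm_sumr !comp_suml.
apply: eq_bigr => b _; rewrite !tensm_sumr !comp_suml; apply: eq_bigr => s _.
rewrite -[in idm _ \om _](compm1 (idm (S y))) !tensm_comp -!compA.
congr (_ ;; _); rewrite -[idm _ \om _]comp1m -(prjS_inc K) !comp_suml.
apply: eq_bigr => r _; rewrite -!compA; congr (_ ;; _).
by rewrite ![inc _ _ _ ;; (_ ;; _)]compA ![_ ;; (iassoc _ _ _ ;; _)]compA e.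
Qed.

(** The two sides of the hexagon axiom in terms of braidings with simple objects only. In [hexl] the
    braiding with [S y \ox S y'] has been replaced, by naturality, by those with its simple
    summands. *)
Definition hexr y y' : hom ((S y \ox S y') \ox Z) (Z \ox (S y \ox S y')) :=
  assoc (S y) (S y') Z ;; (idm (S y) \om h y')
    ;; iassoc (S y) Z (S y') ;; (h y \om idm (S y')) ;; assoc Z (S y) (S y').
Definition hexl y y' : hom ((S y \ox S y') \ox Z) (Z \ox (S y \ox S y')) :=
  \sum_z (prj y y' z \om idm Z) ;; h z ;; (idm Z \om inc y y' z).

(** A single 6j-symbol appears, from moving the bracket between the two braidings, when Z stands in
    the middle. *)
Lemma linc2_hexr y y' s r b : linc2 y y' s r b ;; hexr y y' =
  \sum_t \sum_d (\sum_c H y' s b c * sixj y (l c) y' r s t * H y t c d) *: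
    rinc2 y y' t r d.
Proof.
rewrite /linc2 /hexr -!compA [iassoc _ _ _ ;; (assoc _ _ _ ;; _)]compA iassocK comp1m.
rewrite [(_ \om _) ;; ((_ \om h y') ;; _)]compA -tensm_comp comp1m hH tensm_sumr.
rewrite comp_suml comp_sumr.
under [RHS]eq_bigr => t _ do under eq_bigr => d _ do rewrite scaler_suml.
under [RHS]eq_bigr => t _ do rewrite exchange_big.
rewrite [RHS]exchange_big; apply: eq_bigr => c _ /=.
rewrite tensmZr compZl compZr /rinc.
rewrite -[in X in X \om _](compm1 (idm (S y))) tensm_comp -compA.
rewrite [(_ \om (_ \om _)) ;; _]compA -iassoc_nat !compA sixjE !comp_suml scaler_sumr.
apply: eq_bigr => t _; rewrite !compZl scalerA.
rewrite -(compA (inc t y' r)) -tensm_comp comp1m -/(linc y t c).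
rewrite -(compA (inc t y' r)) -tensm_comp compm1 hH tensm_suml comp_sumr comp_suml.
rewrite scaler_sumr; apply: eq_bigr => d _.
by rewrite tensmZl compZr compZl scalerA.
Qed.

(** Two 6j-symbols appear: one gathers [S y] and [S y'] into the channel z before the braiding, the
    other separates them again after it. *)
Lemma linc2_hexl y y' s r b : linc2 y y' s r b ;; hexl y y' =
  \sum_t \sum_d (\sum_z sixj y y' (l b) r s z * H z r b d * sixj (l d) y y' r z t) *:
    rinc2 y y' t r d.
Proof.
rewrite comp_sumr.
under [RHS]eq_bigr => t _ do under eq_bigr => d _ do rewrite scaler_suml.
under [RHS]eq_bigr => t _ do rewrite exchange_big.
rewrite [RHS]exchange_big; apply: eq_bigr => z _ /=.
have -> : linc2 y y' s r b ;; (prj y y' z \om idm Z ;; h z ;; (idm Z \om inc y y' z)) =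
    sixj y y' (l b) r s z *: (linc z r b ;; h z ;; (idm Z \om inc y y' z)).
  rewrite !compA -2!compZl; congr (_ ;; _ ;; _).
  rewrite /linc2 /linc -[in X in X \om _](compm1 (idm (S y))) tensm_comp -!compA.
  rewrite [(idm _ \om (idm _ \om _)) ;; _]compA -iassoc_nat tensm1 -compA -tensm_comp.
  rewrite comp1m compm1 -[prj _ _ _ in LHS]compm1 -[fin fZ b in LHS]comp1m tensm_comp.
  rewrite !compA sixjE -[RHS]compZl; congr (_ ;; _).
  rewrite comp_suml (bigD1 z) //= big1 => [|t ne].
    rewrite addr0 compZl -compA -tensm_comp comp1m incS_prj tensmZl tensm1 compZr compm1.
    rewrite scalerA; case: (boolP (N y y' z)) => [_|/(sixjN K) ->]; first by rewrite mulr1.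
    by rewrite mul0r.
  by rewrite compZl -compA -tensm_comp inc_prjE lid_neq // scaler0 tens0m compm0 scaler0.
rewrite hH comp_suml scaler_sumr.
rewrite exchange_big; apply: eq_bigr => d _ /=.
rewrite compZl scalerA -[rinc z r d]/(inc (l d) z r ;; (fin fZ d \om idm (S z))).
rewrite -compA -tensm_comp compm1 comp1m -[fin fZ d]comp1m -[inc y y' z]compm1.
rewrite tensm_comp compA.
have -> : inc (l d) z r ;; (idm (S (l d)) \om inc y y' z) =
  \sum_t sixj (l d) y y' r z t *:
    (inc t y' r ;; (inc (l d) y t \om idm (S y')) ;; assoc _ _ _).
  rewrite -[LHS]compm1 -iassocK compA sixjE comp_suml.
  by apply: eq_bigr => t _; rewrite compZl.
rewrite comp_suml scaler_sumr; apply: eq_bigr => t _.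
rewrite compZl scalerA -tensm1 -!compA -assoc_nat [(_ \om idm _) ;; (_ ;; _)]compA.
by rewrite -tensm_comp compm1 /rinc2 /rinc !compA.
Qed.

Lemma rinc2_rprj2 y y' t t' r d d' :
  rinc2 y y' t r d ;; rprj2 y y' t' r d' =
    [&& t == t', d == d', N (l d) y t & N t y' r]%:R *: idm (S r).
Proof.
rewrite /rinc2 /rprj2 !compA -(compA _ (assoc _ _ _)) assocK compm1.
rewrite -[_ ;; (rinc _ _ _ \om _) ;; _]compA -tensm_comp compm1 rinc_rprj.
have [<-|ne] := eqVneq t t'; last by rewrite lid_neq // scaler0 tens0m compm0 comp0m scale0r.
rewrite lidxx tensmZl tensm1 compZr compm1 compZl incS_prj scalerA -natrM mulnb.
by rewrite /= -andbA.
Qed.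

Lemma sum_rinc2_rprj2 y y' r (c : L -> I -> k) t d :
  (\sum_t \sum_d c t d *: rinc2 y y' t r d) ;; rprj2 y y' t r d =
  (c t d * (N (l d) y t && N t y' r)%:R) *: idm (S r).
Proof.
rewrite comp_suml (bigD1 t) //= [X in _ + X]big1 => [|t' ne]; last first.
  rewrite comp_suml big1 // => d' _.
  by rewrite compZl rinc2_rprj2 (negPf ne) scale0r scaler0.
rewrite addr0 comp_suml (bigD1 d) //= big1 => [|d' ne].
  by rewrite addr0 compZl rinc2_rprj2 !eqxx scalerA.
by rewrite compZl rinc2_rprj2 (negPf ne) andbF scale0r scaler0.
Qed.

(* The hexagon axiom at [S y \ox S y'], evaluated on [linc2] and read off on [rinc2]. *)
Definition hexeq y y' r s t b d :=
  \sum_c H y' s b c * sixj y (l c) y' r s t * H y t c d =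
  \sum_z sixj y y' (l b) r s z * H z r b d * sixj (l d) y y' r z t.

Lemma hex_of_eq y y' : (forall r s t b d, hexeq y y' r s t b d) -> hexl y y' = hexr y y'.
Proof.
move=> e; apply: linc2_ext => s r b; rewrite linc2_hexr linc2_hexl.
by do 2!(apply: eq_bigr => ? _); congr (_ *: _); rewrite e.
Qed.

Lemma eq_of_hex y y' r s t b d : N (l d) y t -> N t y' r ->
  hexl y y' = hexr y y' -> hexeq y y' r s t b d.
Proof.
move=> n1 n2 e; have := linc2_hexr y y' s r b; rewrite -e linc2_hexl.
move/(congr1 (fun f => f ;; rprj2 y y' t r d)); rewrite !sum_rinc2_rprj2 n1 n2 !mulr1.
by move/scale_simple_inj/esym.
Qed.

End Frames.

(** * Reduction from arbitrary objects to simple ones *)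

Section Natural.
Context (Z : C) (g : forall Y : C, hom (Y \ox Z) (Z \ox Y)).
Hypothesis g_nat : forall (Y Y' : C) (f : hom Y Y'),
  (f \om idm Z) ;; g Y' = g Y ;; (idm Z \om f).

Lemma nat_hexl y y' : g (S y \ox S y') = hexl (fun y => g (S y)) y y'.
Proof.
rewrite -[LHS]comp1m -tensm1 -(prjS_inc K) tensm_suml comp_suml.
apply: eq_bigr => z _; rewrite -[idm Z in LHS]comp1m tensm_comp -compA g_nat.
by rewrite compA.
Qed.

Definition hexfam Y Y' : hom ((Y \ox Y') \ox Z) (Z \ox (Y \ox Y')) :=
  assoc Y Y' Z ;; (idm Y \om g Y') ;; iassoc Y Z Y' ;; (g Y \om idm Y') ;; assoc Z Y Y'.

Lemma hexfam_nat Y V Y' V' (f : hom Y V) (f' : hom Y' V') :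
  ((f \om f') \om idm Z) ;; hexfam V V' = hexfam Y Y' ;; (idm Z \om (f \om f')).
Proof.
rewrite /hexfam !compA assoc_nat.
rewrite -(compA (assoc Y Y' Z)) -tensm_comp g_nat compm1 -[f in LHS]comp1m tensm_comp.
rewrite -!compA; congr (_ ;; (_ ;; _)).
rewrite [(f \om (idm Z \om f')) ;; _]compA -iassoc_nat -!compA; congr (_ ;; _).
rewrite [_ ;; (g V \om _ ;; _)]compA -tensm_comp g_nat compm1.
by rewrite -[f' in LHS]comp1m tensm_comp -compA assoc_nat.
Qed.

(** Both sides are natural in both variables, and every object is a sum of simple ones. *)
Lemma hexfam_simple :
  (forall y y', g (S y \ox S y') = hexfam (S y) (S y')) ->
  forall Y Y', g (Y \ox Y') = hexfam Y Y'.
Proof.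
move=> e Y Y'; have [I [l [f _]]] := semisimple K Y.
have [I' [l' [f' _]]] := semisimple K Y'.
rewrite -[LHS]comp1m -[RHS]comp1m -!tensm1 -(fpr_in f) -(fpr_in f').
rewrite !tensm_suml !comp_suml; apply: eq_bigr => a _.
rewrite !tensm_sumr !tensm_suml !comp_suml; apply: eq_bigr => b _.
by rewrite tensm_comp -[idm Z]comp1m tensm_comp -!compA g_nat hexfam_nat e.
Qed.

End Natural.

Lemma hb_hexlr (W : halfBraided C) y y' :
  hexl (fun y => hb W (S y)) y y' = hexr (fun y => hb W (S y)) y y'.
Proof. by rewrite -(nat_hexl (@hb_nat _ _ W)) hb_hex. Qed.

Lemma braided_simple (W V : halfBraided C) (f : hom (hb_ob W) (hb_ob V)) :
  (forall y, (idm (S y) \om f) ;; hb V (S y) = hb W (S y) ;; (f \om idm (S y))) ->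
  f \in braided W V.
Proof.
move=> e; apply/asboolP => Y; have [I [l [fr _]]] := semisimple K Y.
have E : idm (Y \ox hb_ob W) = \sum_a (fpr fr a ;; fin fr a) \om idm (hb_ob W).
  by rewrite -tensm_suml fpr_in tensm1.
rewrite -[LHS]comp1m -[hb W Y]comp1m E !comp_suml.
apply: eq_bigr => a _; set i := fin fr a; set p := fpr fr a; rewrite -?compA.
have -> : (p ;; i) \om idm (hb_ob W) ;; ((idm Y \om f) ;; hb V Y) =
    (p \om idm _) ;; ((idm _ \om f) ;; hb V (S (l a)) ;; (idm _ \om i)).
  rewrite -(compA _ (hb V (S (l a)))) -hb_nat !compA -!tensm_comp.
  by rewrite !comp1m !compm1.
rewrite e -[in RHS](comp1m (idm _)) [in RHS]tensm_comp -!compA; congr (_ ;; _).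
by rewrite [in RHS]compA hb_nat -compA -!tensm_comp !comp1m !compm1.
Qed.

Lemma simple_nat (Z : C) (h : forall y, hom (S y \ox Z) (Z \ox S y)) x y
    (f : hom (S x) (S y)) :
  (f \om idm Z) ;; h y = h x ;; (idm Z \om f).
Proof.
rewrite (scE f) tensmZl tensmZr compZl compZr; congr (_ *: _).
have [<-|ne] := eqVneq x y; first by rewrite lidxx !tensm1 comp1m compm1.
by rewrite lid_neq // tens0m tensm0 comp0m compm0.
Qed.

Section Extension.
Context (Z : C) (h : forall y, hom (S y \ox Z) (Z \ox S y)).
Context (h' : forall y, hom (Z \ox S y) (S y \ox Z)).

Definition frI V := projT1 (cid (semisimple K V)).
Definition frl V : frI V -> L := projT1 (cid (projT2 (cid (semisimple K V)))).
Definition fr V : frame (@frl V) V :=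
  projT1 (cid (projT2 (cid (projT2 (cid (semisimple K V)))))).

(** Extension of a family on simple objects along a chosen decomposition of each object. By Schur's
    lemma the family is automatically natural on simple objects, which makes the result natural and
    independent of the choice. *)
Definition hext V : hom (V \ox Z) (Z \ox V) :=
  \sum_a (fpr (fr V) a \om idm Z) ;; h (frl a) ;; (idm Z \om fin (fr V) a).
Definition hext' V : hom (Z \ox V) (V \ox Z) :=
  \sum_a (idm Z \om fpr (fr V) a) ;; h' (frl a) ;; (fin (fr V) a \om idm Z).

Lemma fin_hext V a : (fin (fr V) a \om idm Z) ;; hext V =
  h (frl a) ;; (idm Z \om fin (fr V) a).
Proof.
rewrite comp_sumr (bigD1 a) //= big1 ?addr0 => [|b ne].
  by rewrite !compA -tensm_comp compm1 fin_pr eqxx scale1r lidxx tensm1 comp1m.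
by rewrite !compA -tensm_comp fin_pr eq_sym (negPf ne) scale0r tens0m !comp0m.
Qed.

Lemma fin_hext' V a : (idm Z \om fin (fr V) a) ;; hext' V =
  h' (frl a) ;; (fin (fr V) a \om idm Z).
Proof.
rewrite comp_sumr (bigD1 a) //= big1 ?addr0 => [|b ne].
  by rewrite !compA -tensm_comp compm1 fin_pr eqxx scale1r lidxx tensm1 comp1m.
by rewrite !compA -tensm_comp fin_pr eq_sym (negPf ne) scale0r tensm0 !comp0m.
Qed.

Lemma hext_nat V W (f : hom V W) :
  (f \om idm Z) ;; hext W = hext V ;; (idm Z \om f).
Proof.
rewrite -[LHS]comp1m -tensm1 -(fpr_in (fr V)) tensm_suml !comp_suml.
apply: eq_bigr => a _; rewrite -[idm Z in LHS]comp1m tensm_comp -!compA.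
congr (_ ;; _); rewrite compA -!tensm_comp !comp1m.
have e : fin (fr V) a ;; f = \sum_b (fin (fr V) a ;; f ;; fpr (fr W) b) ;; fin (fr W) b.
  rewrite -[LHS]compm1 -(fpr_in (fr W)) comp_sumr.
  by apply: eq_bigr => b _; rewrite compA.
rewrite e tensm_suml tensm_sumr comp_suml comp_sumr.
apply: eq_bigr => b _; rewrite -[idm Z in LHS]comp1m tensm_comp.
rewrite -(compA _ _ (hext W)) fin_hext.
by rewrite compA simple_nat -compA -tensm_comp comp1m.
Qed.

Lemma hext_simple y : hext (S y) = h y.
Proof.
rewrite -[RHS]comp1m -tensm1 -(fpr_in (fr (S y))) tensm_suml comp_suml.
apply: eq_bigr => a _; rewrite -[idm Z in RHS]comp1m tensm_comp -!compA.
by rewrite simple_nat.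
Qed.

Lemma hextK V : (forall y, h y ;; h' y = idm _) -> hext V ;; hext' V = idm _.
Proof.
move=> hK; rewrite comp_suml -[RHS]tensm1 -(fpr_in (fr V)) tensm_suml.
apply: eq_bigr => a _; rewrite -compA fin_hext' -compA [h _ ;; _]compA hK comp1m.
by rewrite -tensm_comp comp1m.
Qed.

Lemma hextK' V : (forall y, h' y ;; h y = idm _) -> hext' V ;; hext V = idm _.
Proof.
move=> hK; rewrite comp_suml -[RHS]tensm1 -(fpr_in (fr V)) tensm_sumr.
apply: eq_bigr => a _; rewrite -compA fin_hext -compA [h' _ ;; _]compA hK comp1m.
by rewrite -tensm_comp comp1m.
Qed.

Hypothesis hK : forall y, h y ;; h' y = idm _.
Hypothesis hK' : forall y, h' y ;; h y = idm _.
Hypothesis h_hex : forall y y', hexl h y y' = hexr h y y'.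

Lemma hext_iso V : is_iso (hext V).
Proof. by exists (hext' V); rewrite hextK ?hextK'. Qed.

Lemma hext_hex V W : hext (V \ox W) = hexfam hext V W.
Proof.
apply: hexfam_simple => [Y Y' f|y y']; first exact: hext_nat.
rewrite (nat_hexl hext_nat) /hexfam !hext_simple -[RHS]h_hex.
by apply: eq_bigr => z _; rewrite hext_simple.
Qed.

Definition hb_of : halfBraided C := HalfBraided hext_iso hext_nat hext_hex.

End Extension.

Section Morphisms.
Context (I : finType) (l : I -> L) (Z : C) (f : frame l Z).
Context (I' : finType) (l' : I' -> L) (Z' : C) (f' : frame l' Z').
Implicit Type u : I -> I' -> k.

Definition fmor u : hom Z Z' :=
  \sum_b \sum_d u b d *: (fpr f b ;; lid (l b) (l' d) ;; fin f' d).

Lemma fin_fmor u b : fin f b ;; fmor u = \sum_d u b d *: (lid (l b) (l' d) ;; fin f' d).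
Proof.
rewrite comp_sumr (bigD1 b) //= [X in _ + X]big1 ?addr0 => [|c ne].
  rewrite comp_sumr; apply: eq_bigr => d _.
  by rewrite compZr !compA fin_pr eqxx scale1r lidxx comp1m.
rewrite comp_sumr big1 // => d _.
by rewrite compZr !compA fin_pr eq_sym (negPf ne) scale0r !comp0m scaler0.
Qed.

Lemma fmor_ex (g : hom Z Z') :
  exists u, g = fmor u /\ forall b d, l b != l' d -> u b d = 0.
Proof.
pose v b d := sc (fin f b ;; g ;; fpr f' d).
exists (fun b d => if l b == l' d then v b d else 0); split; last first.
  by move=> b d /negPf->.
rewrite -[LHS]comp1m -(fpr_in f) comp_suml; apply: eq_bigr => b _.
rewrite -[LHS]compm1 -(fpr_in f') comp_sumr; apply: eq_bigr => d _.
transitivity (fpr f b ;; (fin f b ;; g ;; fpr f' d) ;; fin f' d); first by rewrite !compA.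
rewrite [fin f b ;; g ;; _]scE -/(v b d) compZr compZl.
by case: eqVneq => // ne; rewrite lid_neq // compm0 comp0m !scaler0.
Qed.

Lemma fmor_inj u v : (forall b d, l b != l' d -> u b d = v b d) ->
  fmor u = fmor v -> u =2 v.
Proof.
move=> e0 e b d; have [lbd|] := eqVneq (l b) (l' d); last exact: e0.
have := congr1 (fun g => fin f b ;; g ;; fpr f' d) e; rewrite /= !fin_fmor.
have E w : (\sum_d w b d *: (lid (l b) (l' d) ;; fin f' d)) ;; fpr f' d =
    w b d *: lid (l b) (l' d).
  rewrite comp_suml (bigD1 d) //= big1 ?addr0 => [|c ne].
    by rewrite compZl -compA fin_pr eqxx scale1r lidxx compm1.
  by rewrite compZl -compA fin_pr (negPf ne) scale0r compm0 scaler0.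
rewrite !E -lbd lidxx; exact: scale_simple_inj.
Qed.

Section Braided.
Context (y : L) (H : coef I) (H' : coef I').
Context (h : hom (S y \ox Z) (Z \ox S y)) (h' : hom (S y \ox Z') (Z' \ox S y)).
Hypotheses (Hh : lrep f H h) (Hh' : lrep f' H' h').
Context (u : I -> I' -> k).
Hypothesis u0 : forall b d, l b != l' d -> u b d = 0.

Lemma linc_fmor s b : linc f y s b ;; (idm (S y) \om fmor u) =
  \sum_d u b d *: linc f' y s d.
Proof.
rewrite /linc -compA -tensm_comp comp1m fin_fmor tensm_sumr comp_sumr.
apply: eq_bigr => d _; rewrite tensmZr compZr.
have [lbd|ne] := eqVneq (l b) (l' d); last by rewrite u0 // !scale0r.
by congr (_ *: _); case: _ / lbd (fin f' d) => i; rewrite lidxx comp1m.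
Qed.

Lemma rinc_fmor s b : rinc f y s b ;; (fmor u \om idm (S y)) =
  \sum_d u b d *: rinc f' y s d.
Proof.
rewrite /rinc -compA -tensm_comp comp1m fin_fmor tensm_suml comp_sumr.
apply: eq_bigr => d _; rewrite tensmZl compZr.
have [lbd|ne] := eqVneq (l b) (l' d); last by rewrite u0 // !scale0r.
by congr (_ *: _); case: _ / lbd (fin f' d) => i; rewrite lidxx comp1m.
Qed.

Lemma fmor_braidedl s b :
  linc f y s b ;; ((idm (S y) \om fmor u) ;; h') =
  \sum_d (\sum_c u b c * H' s c d) *: rinc f' y s d.
Proof.
rewrite compA linc_fmor comp_suml.
under eq_bigr => c _ do rewrite compZl Hh' scaler_sumr.
rewrite exchange_big; apply: eq_bigr => d _ /=; rewrite scaler_suml.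
by apply: eq_bigr => c _; rewrite scalerA.
Qed.

Lemma fmor_braidedr s b :
  linc f y s b ;; (h ;; (fmor u \om idm (S y))) =
  \sum_d (\sum_c H s b c * u c d) *: rinc f' y s d.
Proof.
rewrite compA Hh comp_suml.
under eq_bigr => c _ do rewrite compZl rinc_fmor scaler_sumr.
rewrite exchange_big; apply: eq_bigr => d _ /=; rewrite scaler_suml.
by apply: eq_bigr => c _; rewrite scalerA.
Qed.

Lemma fmor_braided :
  (forall s b d, \sum_c u b c * H' s c d = \sum_c H s b c * u c d) ->
  (idm (S y) \om fmor u) ;; h' = h ;; (fmor u \om idm (S y)).
Proof.
move=> e; apply: (linc_ext (fZ := f)) => s b; rewrite fmor_braidedl fmor_braidedr.
by apply: eq_bigr => d _; rewrite e.
Qed.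

Lemma braided_fmor s b d :
  (idm (S y) \om fmor u) ;; h' = h ;; (fmor u \om idm (S y)) -> N (l' d) y s ->
  \sum_c u b c * H' s c d = \sum_c H s b c * u c d.
Proof.
move=> e n; have := fmor_braidedl s b; rewrite e fmor_braidedr.
move/(congr1 (fun g => g ;; rprj f' y s d)); rewrite !sum_rinc_rprj n !mulr1.
by move/scale_simple_inj/esym.
Qed.

End Braided.
End Morphisms.

Lemma fmor_comp (I1 I2 I3 : finType) (l1 : I1 -> L) (l2 : I2 -> L) (l3 : I3 -> L)
    (Z1 Z2 Z3 : C) (f1 : frame l1 Z1) (f2 : frame l2 Z2) (f3 : frame l3 Z3)
    (u : I1 -> I2 -> k) (v : I2 -> I3 -> k) :
  (forall b c, l1 b != l2 c -> u b c = 0) ->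
  fmor f1 f2 u ;; fmor f2 f3 v = fmor f1 f3 (fun b d => \sum_c u b c * v c d).
Proof.
move=> u0; rewrite comp_suml; apply: eq_bigr => b _.
transitivity (\sum_c \sum_d (u b c * v c d) *: (fpr f1 b ;; lid (l1 b) (l3 d) ;; fin f3 d)).
  rewrite comp_suml; apply: eq_bigr => c _; rewrite compZl -compA fin_fmor.
  rewrite comp_sumr scaler_sumr; apply: eq_bigr => d _.
  rewrite compZr scalerA; have [e|ne] := eqVneq (l1 b) (l2 c);
    last by rewrite u0 // !mul0r !scale0r.
  suff -> : lid (l1 b) (l3 d) = lid (l1 b) (l2 c) ;; lid (l2 c) (l3 d) by rewrite !compA.
  by rewrite e lidxx comp1m.
by rewrite exchange_big; apply: eq_bigr => d _; rewrite scaler_suml.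
Qed.

Lemma fmor_id (I : finType) (l : I -> L) (Z : C) (f : frame l Z) :
  fmor f f (fun b d => (b == d)%:R) = idm Z.
Proof.
rewrite -(fpr_in f); apply: eq_bigr => b _; rewrite (bigD1 b) //= big1 => [|d ne].
  by rewrite eqxx scale1r lidxx compm1 addr0.
by rewrite eq_sym (negPf ne) scale0r.
Qed.

End Skeleton.

(** * The hexagon equations of the Fibonacci fusion rules *)

Section MatrixEntries.
Context (k : fieldType).

Lemma sum_coefs p q r (A : 'M[k]_(p, q)) (B : 'M[k]_(q, r)) i j x :
  \sum_c A i c * x * B c j = x * (A *m B) i j.
Proof. by rewrite mxE mulr_sumr; apply: eq_bigr => c _; rewrite mulrCA mulrA. Qed.

Lemma sum_coefs1 p q r (A : 'M[k]_(p, q)) (B : 'M[k]_(q, r)) i j :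
  \sum_c A i c * B c j = (A *m B) i j.
Proof. by rewrite mxE. Qed.

Lemma sum_0l p q (B : 'M[k]_(p, q)) j (x : k) : \sum_c 0 * x * B c j = 0.
Proof. by rewrite big1 // => c _; rewrite !mul0r. Qed.

Lemma sum_0r p q (A : 'M[k]_(p, q)) i (x : k) : \sum_c A i c * x * 0 = 0.
Proof. by rewrite big1 // => c _; rewrite mulr0. Qed.

Lemma sum_00 p (x : k) : \sum_(c < p) 0 * x * 0 = 0.
Proof. by rewrite big1 // => c _; rewrite mulr0. Qed.

Lemma big_mul0l (I : finType) (F : I -> k) : \sum_i 0 * F i = 0.
Proof. by rewrite big1 // => i _; rewrite mul0r. Qed.

Lemma big_mul0r (I : finType) (F : I -> k) : \sum_i F i * 0 = 0.
Proof. by rewrite big1 // => i _; rewrite mulr0. Qed.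

Lemma addmxE p q (A B : 'M[k]_(p, q)) i j : (A + B) i j = A i j + B i j.
Proof. by rewrite mxE. Qed.
Lemma scalemxE p q (A : 'M[k]_(p, q)) x i j : (x *: A) i j = x * A i j.
Proof. by rewrite mxE. Qed.
Lemma scalar_mxE p x i j : (x%:M : 'M[k]_p) i j = x * (i == j)%:R.
Proof. by rewrite mxE mulr_natr. Qed.
Lemma zeromxE p q i j : (0 : 'M[k]_(p, q)) i j = 0.
Proof. by rewrite mxE. Qed.
Lemma oppmxE p q (A : 'M[k]_(p, q)) i j : (- A) i j = - A i j.
Proof. by rewrite mxE. Qed.
Definition linmxE := (addmxE, oppmxE, scalemxE, scalar_mxE, zeromxE).

End MatrixEntries.

(* Closes identities between linear combinations of matrices, products being atoms. *)
Local Ltac lin := apply/matrixP => ? ?; rewrite !linmxE; ring.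

Section Fibonacci.

(** Apart from X \ox X = 1 + X, the fusion rules are those of the group of order two. *)
Definition fus (x y r : bool) : bool := (x && y) || (r == x (+) y).

(* The labels [false] and [true] stand for 1 and X.  The values at
   x = y = w = r = X depend on the normalisation of [inc_list] and [prj_list];
   they come from evaluating [sixj_list] modulo 5. *)
Definition nsixj (x y w r s t : bool) : nat :=
  if [&& x, y, w & r] then (if s then 3 else if t then 4 else 2)%N
  else [&& fus y w s, fus x s r, fus x y t & fus t w r].

Context (k : fieldType) (char5 : 5%N \in [pchar k]).

Definition sixj x y w r s t : k := (nsixj x y w r s t)%:R.

Definition isX m n (c : 'I_m + 'I_n) : bool := if c is inr _ then true else false.

Section Coefs.
Context (m n : nat).
Local Notation I := ('I_m + 'I_n)%type.

(** For y = X, the channel X receives all summands of Z, giving the block matrix [[P, Q], [R, T]],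
    while the channel 1 receives only copies of X, giving S. Braiding with 1 is the identity, as
    [H_unit] shows to be forced. *)
Definition coefs (P : 'M[k]_m) (Q : 'M[k]_(m, n)) (R : 'M[k]_(n, m)) (S T : 'M[k]_n)
    (y s : bool) (c d : I) : k :=
  if y then
    match s, c, d with
    | true, inl i, inl j => P i j
    | true, inl i, inr j => Q i j
    | true, inr i, inl j => R i j
    | true, inr i, inr j => T i j
    | false, inr i, inr j => S i j
    | _, _, _ => 0
    end
  else (c == d)%:R * (s == isX c)%:R.

Definition hexall (H : bool -> bool -> I -> I -> k) := forall y y' r s t b d,
  hexeq sixj (@isX m n) H y y' r s t b d.

Lemma hex_coefs_l P Q R S T y' r s t b d :
  hexeq sixj (@isX m n) (coefs P Q R S T) false y' r s t b d.
Proof.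
rewrite /hexeq [in LHS](bigD1 d) //= [X in _ + X]big1 => [|c ne]; last first.
  by rewrite (negPf ne) mul0r mulr0.
rewrite eqxx mul1r addr0 big_bool /sixj.
by case: y' => /=; case: r; case: s; case: t; case: b => b; case: d => d;
  rewrite /nsixj /= ?(mul0r, mulr0, mul1r, mulr1, addr0, add0r).
Qed.

Lemma hex_coefs_r P Q R S T y r s t b d :
  hexeq sixj (@isX m n) (coefs P Q R S T) y false r s t b d.
Proof.
rewrite /hexeq [in LHS](bigD1 b) //= [X in _ + X]big1 => [|c ne]; last first.
  by rewrite eq_sym (negPf ne) !mul0r.
rewrite eqxx mul1r addr0 big_bool /sixj.
by case: y => /=; case: r; case: s; case: t; case: b => b; case: d => d;
  rewrite /nsixj /= ?(mul0r, mulr0, mul1r, mulr1, addr0, add0r).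
Qed.

Lemma eq_congr2 (x y x' y' : k) : x = y -> x' = x -> y = y' -> x' = y'.
Proof. by move=> -> ->. Qed.

(** With M = [[P, Q], [R, T]], the first group is the channel r = 1 and says M^2 = diag(1, S). For r
    = X, the second group has s = 1 or t = 1, the third s = t = X. Coefficients are products of
    values of [nsixj], left unreduced so that [ring] matches them. *)
Lemma hex_coefs (P : 'M[k]_m) (Q : 'M[k]_(m, n)) (R : 'M[k]_(n, m)) (S T : 'M[k]_n) :
  [/\ P *m P + Q *m R = 1%:M, P *m Q + Q *m T = 0, R *m P + T *m R = 0
    & R *m Q + T *m T = S] ->
  [/\ 2 *: (S *m S) = 12 *: T + 4%:M, 4 *: (S *m R) = 4 *: R,
    4 *: (S *m T) = 12 *: T + 8%:M, 3 *: (Q *m S) = 3 *: Q & 3 *: (T *m S) = 9 *: T + 6%:M] ->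
  [/\ P *m P + 3 *: (Q *m R) = P, P *m Q + 3 *: (Q *m T) = 3 *: Q,
    R *m P + 3 *: (T *m R) = 3 *: R & R *m Q + 3 *: (T *m T) = 9 *: T + 12%:M] ->
  hexall (coefs P Q R S T).
Proof.
move=> [e1 e2 e3 e4] [e5 e6 e7 e8 e9] [e10 e11 e12 e13].
case; case=> r s t b d; last first.
- exact: hex_coefs_l.
- exact: hex_coefs_l.
- exact: hex_coefs_r.
rewrite /hexeq; case: r; case: s; case: t; case: b => b; case: d => d;
 rewrite big_sumType big_bool /sixj /= ?(sum_0l, sum_0r, sum_00, sum_coefs) /nsixj /=
   ?(inj_eq inl_inj) ?(inj_eq inr_inj);
 (try ring);
 (let t e := (apply: (eq_congr2 (congr1 (fun A => fun_of_matrix A b d) e));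
  rewrite ?linmxE; ring) in
 first [t e1|t e2|t e3|t e4|t e5|t e6|t e7|t e8|t e9|t e10|t e11|t e12|t e13]).
Qed.

End Coefs.

(** Reduces an identity modulo 5 to one with integer coefficients: the witness [Z] is a fifth of the
    difference of the two sides. *)
Lemma mod5 p q (X Y Z : 'M[k]_(p, q)) : X = Y + 5 *: Z -> X = Y.
Proof. by rewrite (pcharf0 char5) scale0r addr0. Qed.

Lemma coefs_inv m n (P P' : 'M[k]_m) (Q Q' : 'M[k]_(m, n)) (R R' : 'M[k]_(n, m)) (S S' T T'
  : 'M[k]_n) :
  P *m P' + Q *m R' = 1%:M -> P *m Q' + Q *m T' = 0 -> R *m P' + T *m R' = 0 ->
  R *m Q' + T *m T' = 1%:M -> S *m S' = 1%:M ->
  forall y s c e, \sum_d coefs P Q R S T y s c d * coefs P' Q' R' S' T' y s d e =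
    ((c == e) && fus y (isX c) s)%:R.
Proof.
move=> e1 e2 e3 e4 e5 [] s c e /=; last first.
  rewrite (bigD1 c) //= big1 => [|d ne]; last by rewrite eq_sym (negPf ne) !mul0r.
  rewrite eqxx mul1r addr0 mulrCA -natrM mulnb andbb -natrM mulnb.
  by case: s; case: c => c.
case: s; case: c => c; case: e => e; rewrite big_sumType /= ?(inj_eq inl_inj) ?(inj_eq inr_inj)
  ?andbT ?andbF;
  rewrite ?sum_coefs1 -?addmxE ?(e1, e2, e3, e4, e5) ?zeromxE ?[1%:M _ _]mxE //;
  do ?[rewrite big1 => [|? _]; last by rewrite ?mul0r ?mulr0]; by rewrite ?addr0 ?add0r.
Qed.

Lemma coefs_supp m n (P : 'M[k]_m) (Q : 'M[k]_(m, n)) R (S T : 'M[k]_n) y s c d :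
  ~~ (fus y (isX c) s && fus y (isX d) s) -> coefs P Q R S T y s c d = 0.
Proof.
case: y => /=; first by case: s; case: c; case: d.
have [->|_] := eqVneq c d; last by rewrite mul0r.
by rewrite andbb /fus => /= /negPf; case: (isX d) => ->; rewrite mulr0.
Qed.

Section ModuleCoefs.
Context (D : bcat k).
Local Notation a := (ba D).
Local Notation b := (bb D).
Local Notation t := (bt D).

(* The solution of the hexagon equations attached to a module: [[1 - a b, a], [2 b, t - 1]]
   on the copies of X in X \ox Z and [modS] on those of 1.  Primes denote the inverse. *)
Definition modP : 'M[k]_(bm D) := 1%:M - a *m b.
Definition modS : 'M[k]_(bn D) := 1%:M - 2 *: t + 3 *: (t *m t).
Definition modT : 'M[k]_(bn D) := t - 1%:M.
(** Let M be the block matrix of [modP], a, 2 b, [modT]. Since M^2 = diag(1, S), its inverse is M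
    diag(1, S^-1). As a t = 0, only the last block changes, to [modT' = modT *m modS']; that [modS']
    inverts [modS] follows from t^3 = 0. *)
Definition modS' : 'M[k]_(bn D) := 1%:M + 2 *: t + t *m t.
Definition modT' : 'M[k]_(bn D) := t *m t - t - 1%:M.

Definition bcoefs := coefs modP a (2 *: b) modS modT.
Definition bcoefs' := coefs modP a (2 *: b) modS' modT'.

Lemma bt_bt_bt : t *m t *m t = 0.
Proof. by rewrite -bb_ba -mulmxA ba_bt mulmx0. Qed.

Let expand := (mulmxDl, mulmxDr, mulmxN, mulNmx, mulmxBl, mulmxBr, mul1mx, mulmx1, mulmxA).
Let reduce := (act_ba, act_at, act_tb, act_ttt, ba_bt, bt_bb, bb_ba, bt_bt_bt, mulmx0, mul0mx,
  scaler0).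

Local Ltac nrm := rewrite ?expand -?scalemxAl -?scalemxAr ?mulmxA ?reduce.

Lemma bcoefs_hex : hexall bcoefs.
Proof.
apply: hex_coefs; rewrite /modP /modS /modT; split; nrm; try lin.
- by apply: (@mod5 _ _ _ _ (2%:M - 4 *: t + 4 *: (t *m t))); lin.
- by apply: (@mod5 _ _ _ _ (- 4 *: (t *m t))); lin.
- by apply: (@mod5 _ _ _ _ (- 3 *: (t *m t))); lin.
- by apply: (@mod5 _ _ _ _ (a *m b)); lin.
- by apply: (@mod5 _ _ _ _ (- a)); lin.
- by apply: (@mod5 _ _ _ _ (- 2 *: b)); lin.
- by apply: (@mod5 _ _ _ _ (t *m t - 3 *: t)); lin.
Qed.

Lemma bcoefsK y s c e : \sum_d bcoefs y s c d * bcoefs' y s d e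
  = ((c == e) && fus y (isX c) s)%:R.
Proof.
by apply: coefs_inv; rewrite /modP /modS /modT /modS' /modT'; nrm; lin.
Qed.

Lemma bcoefsK' y s c e : \sum_d bcoefs' y s c d * bcoefs y s d e
  = ((c == e) && fus y (isX c) s)%:R.
Proof.
by apply: coefs_inv; rewrite /modP /modS /modT /modS' /modT'; nrm; lin.
Qed.

End ModuleCoefs.

Lemma fusC x y r : fus x y r = fus y x r.
Proof. by case: x; case: y. Qed.

End Fibonacci.
Arguments sixj {k}.
Arguments bcoefs {k} D.
Arguments bcoefs' {k} D.

(** * The center as a module category *)

Section Center.
Context (k : fieldType) (char5 : 5%N \in [pchar k]).
Context (C : monCat k) (Sb : bool -> C) (K : skeleton Sb fus sixj).
Hypothesis sums : forall m n, exists (V : C) (_ : frame Sb (@isX m n) V), True.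

Definition sumob m n : C := projT1 (cid (sums m n)).
Definition sumfr m n : frame Sb (@isX m n) (sumob m n) := projT1 (cid (projT2 (cid (sums m n)))).

Section Functor.
Implicit Types D E : bcat k.

Definition F_hb D y := lmor K (sumfr (bm D) (bn D)) y (bcoefs D y).
Definition F_hb_inv D y := rmor K (sumfr (bm D) (bn D)) y (bcoefs' D y).

Lemma F_hb_rep D y : lrep K (sumfr (bm D) (bn D)) (bcoefs D y) (F_hb D y).
Proof. by apply: lmorP => s b d n; apply: coefs_supp; rewrite (negPf n). Qed.

Lemma F_hb_inv_rep D y : rrep K (sumfr (bm D) (bn D)) (bcoefs' D y) (F_hb_inv D y).
Proof. by apply: rmorP => s b d n; apply: coefs_supp; rewrite fusC (negPf n). Qed.

Lemma F_hbK D y : F_hb D y ;; F_hb_inv D y = idm _.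
Proof. by apply: (lrep_inv (@F_hb_rep D y) (@F_hb_inv_rep D y)) => s b e; rewrite bcoefsK. Qed.

Lemma F_hb_invK D y : F_hb_inv D y ;; F_hb D y = idm _.
Proof. by apply: (rrep_inv (@F_hb_inv_rep D y) (@F_hb_rep D y)) => s b e;
  rewrite bcoefsK' fusC. Qed.

Lemma F_hb_hex D y y' : hexl K (F_hb D) y y' = hexr (F_hb D) y y'.
Proof. apply: (hex_of_eq (@F_hb_rep D)) => r s t b d; exact: (bcoefs_hex char5). Qed.

Definition Fob D : center C := hb_of (F_hbK D) (F_hb_invK D) (F_hb_hex D).

Lemma Fob_hb D y : hb (Fob D) (Sb y) = F_hb D y.
Proof. exact: hext_simple. Qed.

Definition blockc m n m' n' (f : 'M[k]_(m, m')) (g : 'M[k]_(n, n'))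
    (c : 'I_m + 'I_n) (d : 'I_m' + 'I_n') : k :=
  match c, d with inl i, inl j => f i j | inr i, inr j => g i j | _, _ => 0 end.

Lemma blockc0 m n m' n' (f : 'M[k]_(m, m')) (g : 'M[k]_(n, n')) b d :
  isX b != isX d -> blockc f g b d = 0.
Proof. by case: b; case: d. Qed.

Definition Fmor D E (u : bpair D E) : hom (sumob (bm D) (bn D)) (sumob (bm E) (bn E)) :=
  fmor (sumfr _ _) (sumfr _ _) (blockc u.1 u.2).

Lemma blockc_coefs m n m' n' (f : 'M[k]_(m, m')) (g : 'M[k]_(n, n'))
    P Q R S T P' Q' R' S' T' :
  [/\ f *m P' = P *m f, f *m Q' = Q *m g & g *m R' = R *m f] ->
  g *m S' = S *m g -> g *m T' = T *m g -> forall y s b d,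
  \sum_c blockc f g b c * coefs P' Q' R' S' T' y s c d =
  \sum_c coefs P Q R S T y s b c * blockc f g c d.
Proof.
move=> [e1 e2 e3] e4 e5 [] s b d; last first.
  rewrite [in LHS](bigD1 d) //= [X in _ + X = _]big1 => [|c ne];
    last by rewrite (negPf ne) mul0r mulr0.
  rewrite [in RHS](bigD1 b) //= [X in _ = _ + X]big1 => [|c ne];
    last by rewrite eq_sym (negPf ne) !mul0r.
  rewrite !eqxx !mul1r !addr0 mulrC.
  have [->//|ne] := eqVneq (isX b) (isX d); by rewrite blockc0 // !mulr0.
by case: s; case: b => b; case: d => d; rewrite !big_sumType /= ?sum_coefs1 ?(e1, e2, e3, e4, e5)
  ?big_mul0l ?big_mul0r ?addr0 ?add0r.
Qed.

(** Each block of the half-braiding is a polynomial in a, b and t, with which a module morphism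
    commutes. *)
Lemma Fmor_braided D E (u : bpair D E) : u \in bmorph D E -> Fmor u \in braided (Fob D) (Fob E).
Proof.
move/bmorphP => [ua ub ut]; apply: (braided_simple K) => y; rewrite !Fob_hb.
apply: (fmor_braided (@F_hb_rep D y) (@F_hb_rep E y)); first by move=> b d; apply: blockc0.
apply: blockc_coefs.
- split; rewrite /modP ?mulmxBl ?mulmxBr ?mul1mx ?mulmx1 -?scalemxAl -?scalemxAr //.
  + by rewrite !mulmxA ua -!mulmxA ub.
  + by rewrite ub.
- rewrite /modS !(mulmxDl, mulmxDr, mulmxBl, mulmxBr) ?mulNmx ?mulmxN mul1mx mulmx1.
  by rewrite -!scalemxAl -!scalemxAr ut !mulmxA ut -!mulmxA ut.
- by rewrite /modT mulmxBl mulmxBr ut mul1mx mulmx1.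
Qed.

Definition Fhom D E (u : hom D E) : hom (Fob D) (Fob E) := ZHom (Fmor_braided (bvalP u)).

Lemma Fhom_id D : Fhom (idm D) = idm (Fob D).
Proof.
apply: val_inj; rewrite /= -[RHS](fmor_id (sumfr (bm D) (bn D))).
apply: eq_bigr => b _; apply: eq_bigr => d _; congr (_ *: _).
by case: b => b; case: d => d; rewrite /= ?mxE.
Qed.

Lemma Fhom_comp D E G (u : hom D E) (v : hom E G) : Fhom (u ;; v) = Fhom u ;; Fhom v.
Proof.
apply: val_inj; rewrite /= fmor_comp; last by move=> b c; apply: blockc0.
apply: eq_bigr => b _; apply: eq_bigr => d _; congr (_ *: _).
by case: b => b; case: d => d; rewrite big_sumType /= ?mxE ?big_mul0l ?big_mul0r ?addr0 ?add0r.
Qed.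

Lemma FhomD D E (u v : hom D E) : Fhom (u + v) = Fhom u + Fhom v.
Proof.
apply: val_inj; rewrite /= /Fmor /fmor -big_split; apply: eq_bigr => b _.
rewrite -big_split; apply: eq_bigr => d _ /=; rewrite -scalerDl; congr (_ *: _).
by case: b => b; case: d => d; rewrite /= ?mxE ?addr0.
Qed.

Lemma Fhom0 D E : Fhom (0 : hom D E) = 0.
Proof. by apply: (addIr (Fhom 0)); rewrite -FhomD !add0r. Qed.

Lemma Fhom_inj D E : injective (@Fhom D E).
Proof.
move=> u v /(congr1 val) /= /(fmor_inj K) e.
have {}e := e (fun b d n => etrans (blockc0 _ _ n) (esym (blockc0 _ _ n))).
apply: bhomP; apply/matrixP => i j; first exact: (e (inl i) (inl j)).
exact: (e (inr i) (inr j)).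
Qed.

(** The blocks a, 2 b and t - 1 all occur in the channel X of the braiding with X, so commuting with
    that one matrix gives back the three conditions on a module morphism. *)
Lemma Fhom_surj D E (w : hom (Fob D) (Fob E)) : exists u : hom D E, w = Fhom u.
Proof.
have [u [wE u0]] := fmor_ex K (sumfr (bm D) (bn D)) (sumfr (bm E) (bn E)) (zval w).
pose f : 'M[k]_(bm D, bm E) := \matrix_(i, j) u (inl i) (inl j).
pose g : 'M[k]_(bn D, bn E) := \matrix_(i, j) u (inr i) (inr j).
have uE : u =2 blockc f g.
  by case=> i [] j; rewrite /= ?mxE // u0.
have fgE : zval w = Fmor (f, g).
  by rewrite wE; apply: eq_bigr => b _; apply: eq_bigr => d _; rewrite uE.
have br s b d : fus (isX d) true s ->
  \sum_c blockc f g b c * bcoefs E true s c d = \sum_c bcoefs D true s b c * blockc f g c d.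
  apply: (braided_fmor (@F_hb_rep D true) (@F_hb_rep E true)); first by move=> ? ?;
    apply: blockc0.
  have /asboolP/(_ (Sb true)) := zvalP w; rewrite fgE.
  by rewrite !Fob_hb.
have P : (f, g) \in bmorph D E.
  apply/bmorphP; split => /=; apply/matrixP => i j.
  - have := br true (inl i) (inr j) isT; rewrite !big_sumType /= !sum_coefs1.
    rewrite [X in _ + X]big1 => [|? _]; last by rewrite mul0r.
    by rewrite [X in _ = X + _]big1 => [|? _]; rewrite ?mulr0 // addr0 add0r.
  - have := br true (inr i) (inl j) isT; rewrite !big_sumType /= !sum_coefs1.
    rewrite [X in X + _]big1 => [|? _]; last by rewrite mul0r.
    rewrite [X in _ = _ + X]big1 => [|? _]; last by rewrite mulr0.
    (* Multiplying by 3 turns the factor 2 of b into 6 = 1, which is visibly nonzero. *)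
    rewrite addr0 add0r -scalemxAl -scalemxAr !scalemxE => /(congr1 ( *%R 3)).
    by rewrite !mulrA => /(mulfI _) -> //; rewrite -natrM -(natr_mod5 char5) oner_neq0.
  - have := br true (inr i) (inr j) isT; rewrite !big_sumType /= !sum_coefs1.
    rewrite [X in X + _]big1 => [|? _]; last by rewrite mul0r.
    rewrite [X in _ = X + _]big1 => [|? _]; last by rewrite mulr0.
    by rewrite !add0r /modT mulmxBl mulmxBr mul1mx mulmx1 !addmxE => /addIr.
by exists (BHom P); apply: val_inj.
Qed.

End Functor.

End Center.

(** * Indecomposable objects and direct sums in linear categories *)

Section DirectSums.
Context (k : fieldType) (C : linCat k).
Implicit Types x y z : C.

Lemma local_end_indecomposable z : ~ is_zero z ->
  (forall e : hom z z, e ;; e = e -> e = 0 \/ e = idm z) -> indecomposable z.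
Proof.
move=> top_index loc; split=> // x y [i [p [ip1 ip0 _]]].
have ipT := ip1 true; have ipF := ip1 false.
have ipFT : i false ;; p true = 0 := ip0 false true isT.
have [|e0|e1] := loc (p true ;; i true).
- by rewrite compA -(compA (p true)) ipT compm1.
- left; change (idm x = 0); rewrite -ipT -[i true]comp1m.
  by rewrite -{1}ipT -!compA (compA (p true)) e0 comp0m compm0.
- right; change (idm y = 0); rewrite -ipF -[i false]compm1 -e1.
  by rewrite !compA ipFT !comp0m.
Qed.

Lemma dsum_zero_iso x y z :
  is_dsum (fun b : bool => if b then x else y) z -> is_zero y -> isomorphic z x.
Proof.
case=> i [p [ip1 _ pi1]] y0; exists (p true), (i true); split; last exact: ip1 true.
rewrite -pi1 big_bool /=.
have -> : p false = 0 by rewrite -[p false]compm1 [idm _]y0 compm0.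
by rewrite comp0m addr0.
Qed.

Lemma is_dsum_transport (I : finType) (S : I -> C) z z' :
  is_dsum S z -> isomorphic z z' -> is_dsum S z'.
Proof.
case=> i [p [ip1 ip0 pi1]] [f [g [fg gf]]].
exists (fun a => i a ;; f), (fun a => g ;; p a); split.
- by move=> a; rewrite compA -(compA _ f) fg compm1.
- by move=> a b ab; rewrite compA -(compA _ f) fg compm1 ip0.
rewrite -gf -[g in RHS]compm1 -pi1 comp_sumr comp_suml.
by apply: eq_bigr => a _; rewrite !compA.
Qed.

Lemma isomorphic_sym x y : isomorphic x y -> isomorphic y x.
Proof. by case=> f [g [fg gf]]; exists g, f. Qed.

End DirectSums.

(** Sorting the index set by label is what turns coefficients into blocks of matrices. *)
Lemma frame_split (k : fieldType) (C : monCat k) (Sb : bool -> C) (I : finType)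
    (l : I -> bool) (Z : C) : frame Sb l Z ->
  exists m n (_ : frame Sb (@isX m n) Z), True.
Proof.
move=> f; pose A := [pred a | ~~ l a]; pose B := [pred a | l a].
pose s (c : 'I_#|A| + 'I_#|B|) : I :=
  match c with inl i => enum_val i | inr j => enum_val j end.
have ls : l \o s = @isX _ _.
  apply/funext; case=> i /=; have := enum_valP i; rewrite inE; last by move=> ->.
  by move=> /negPf.
have s_inj : injective s.
  case=> i [] j e; first by move/enum_val_inj: e => ->.
  - have := enum_valP i; have := enum_valP j; rewrite /= in e.
    by rewrite e !inE => -> .
  - have := enum_valP i; have := enum_valP j; rewrite /= in e.
    by rewrite e !inE => /negPf ->.
  - by move/enum_val_inj: e => ->.
have s_bij : bijective s.
  apply: inj_card_bij => //; rewrite card_sum !card_ord addnC -(cardC B).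
  by rewrite leq_add2l; apply/subset_leq_card/subsetP => a; rewrite !inE.
exists #|A|, #|B|; rewrite -ls.
have fs a b : fin f (s a) ;; fpr f (s b) = (a == b)%:R *: lid Sb (l (s a)) (l (s b)).
  by rewrite fin_pr (inj_eq s_inj).
have sf : \sum_a fpr f (s a) ;; fin f (s a) = idm Z.
  by rewrite -(fpr_in f) [RHS](reindex s) //; apply: onW_bij.
by exists (@Frame _ _ _ _ _ (l \o s) Z (fun a => fin f (s a)) (fun a => fpr f (s a)) fs sf).
Qed.

(** * Every half-braiding comes from a module; the classification *)

Section Main.
Context (k : fieldType) (char5 : 5%N \in [pchar k]).
Context (C : monCat k) (Sb : bool -> C) (K : skeleton Sb fus sixj).
Hypothesis sums : forall m n, exists (V : C) (_ : frame Sb (@isX m n) V), True.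
Local Notation Fob := (Fob char5 K sums).
Local Notation Fhom := (Fhom char5 K sums).

Section Recover.
Context (m n : nat) (W : halfBraided C) (f : frame Sb (@isX m n) (hb_ob W)).
Context (H : bool -> bool -> 'I_m + 'I_n -> 'I_m + 'I_n -> k).
Hypothesis Hrep : forall y, lrep K f (H y) (hb W (Sb y)).
Hypothesis Hsupp : forall y s b d, ~~ (fus y (isX b) s && fus (isX d) y s) -> H y s b d = 0.

Lemma H_hex y y' r s t b d : fus (isX d) y t -> fus t y' r ->
  hexeq sixj (@isX m n) H y y' r s t b d.
Proof. by move=> n1 n2; exact: (eq_of_hex (h :=
  fun y => hb W (Sb y)) Hrep s b n1 n2 (hb_hexlr K W y y')). Qed.

Definition mxof (I I' : Type) p q (F : I -> I' -> k) (i : 'I_p -> I) (j : 'I_q -> I')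
  : 'M[k]_(p, q) :=
  \matrix_(a, b) F (i a) (j b).

(* The coefficients of the braiding with 1 form an idempotent matrix by the hexagon
   axiom at 1 \ox 1, and this matrix is invertible. *)
Lemma H_unit s b d : H false s b d = (b == d)%:R * (s == isX b)%:R.
Proof.
have [g [hg _]] := hb_iso W (Sb false).
have [H' Hrep' Hsupp'] := rrep_ex K f g.
have inv b' e : fus false (isX e) s -> \sum_c H false s b' c * H' s c e = (b' == e)%:R.
  exact: (lrep_comp (@Hrep false) Hrep' hg).
have s0 b' d' : ~~ ((s == isX b') && (s == isX d')) -> H false s b' d' = 0.
  by move=> n0; apply: Hsupp; move: n0; rewrite /fus; case: (isX d').
have idem b' d' : \sum_c H false s b' c * H false s c d' = H false s b' d'.
  have [ed|nd] := eqVneq s (isX d'); last first.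
    have z c : H false s c d' = 0 by rewrite s0 // (negPf nd) andbF.
    by rewrite z big1 // => c _; rewrite z mulr0.
  have n1 : fus (isX d') false s by rewrite ed /fus; case: (isX d').
  have n2 : fus s false s by rewrite /fus; case: (s).
  have := H_hex s b' n1 n2; rewrite /hexeq big_bool /= => e.
  transitivity (\sum_c H false s b' c * sixj false (isX c) false s s s * H false s c d').
    apply: eq_bigr => c _; have [ec|nc] := eqVneq s (isX c); last first.
      by rewrite s0 ?mul0r // (negPf nc) andbF.
    by rewrite -ec /sixj; case: (s); rewrite mulr1.
  rewrite e; have [eb|nb] := eqVneq s (isX b'); last first.
    rewrite [H false s b' d']s0 ?(negPf nb) // mulr0 mul0r addr0.
    by rewrite /sixj -ed; case: (s) nb; case: (isX b'); rewrite // !mul0r.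
  by rewrite -eb -ed /sixj; case: (s); rewrite /= !mul0r add0r mul1r mulr1.
have [ed|nd] := eqVneq s (isX d); last first.
  rewrite s0 ?(negPf nd) ?andbF //; have [bd|] := eqVneq b d; last by rewrite mul0r.
  by rewrite bd (negPf nd) mulr0.
have fd : fus false (isX d) s by rewrite /fus -ed eqxx.
transitivity ((b == d)%:R : k); last first.
  by case: eqVneq => [->|_]; rewrite ?mul0r // ed eqxx mulr1.
rewrite -inv //.
transitivity (\sum_a H false s b a * (a == d)%:R).
  rewrite (bigD1 d) //= big1 ?eqxx ?mulr1 ?addr0 // => a /negPf ->.
  by rewrite mulr0.
transitivity (\sum_a \sum_c H false s b a * (H false s a c * H' s c d)).
  by apply: eq_bigr => a _; rewrite -inv // mulr_sumr.
rewrite exchange_big; apply: eq_bigr => c _ /=; rewrite -idem mulr_suml.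
by apply: eq_bigr => a _; rewrite mulrA.
Qed.

Local Notation P := (mxof (H true true) (@inl _ 'I_n) (@inl _ 'I_n)).
Local Notation Q := (mxof (H true true) (@inl _ 'I_n) (@inr 'I_m _)).
Local Notation R := (mxof (H true true) (@inr 'I_m _) (@inl _ 'I_n)).
Local Notation T := (mxof (H true true) (@inr 'I_m _) (@inr 'I_m _)).
Local Notation S := (mxof (H true false) (@inr 'I_m _) (@inr 'I_m _)).

Lemma H_coefs y s b d : H y s b d = coefs P Q R S T y s b d.
Proof.
case: y; last exact: H_unit.
case: s; case: b => b; case: d => d; rewrite /= ?mxE // Hsupp //.
Qed.

(** For s = t = X the admissibility conditions of [H_hex] hold whatever the label of d, and the
    equations obtained are the first and third groups of [hex_coefs]. *)
Lemma H_rel :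
  [/\ P *m P + Q *m R = 1%:M, P *m Q + Q *m T = 0, R *m P + T *m R = 0
    & R *m Q + T *m T = S] /\
  [/\ P *m P + 3 *: (Q *m R) = P, P *m Q + 3 *: (Q *m T) = 3 *: Q,
    R *m P + 3 *: (T *m R) = 3 *: R & R *m Q + 3 *: (T *m T) = 9 *: T + 12%:M].
Proof.
have HE : H = coefs P Q R S T by do 4!apply/funext => ?; exact: H_coefs.
have hx := H_hex; move: P Q R S T HE hx => P Q R S T -> hx.
have e r b d : fus true true r -> hexeq sixj (@isX m n) (coefs P Q R S T) true true r true true
  b d.
  by move=> fr; apply: hx => //; case: (isX d).
have unit (x y x' y' : k) : x = y -> x' = x -> y' = y -> x' = y' by move=> -> -> ->.
split; split; apply/matrixP => i j;
  [have := e false (inl i) (inl j) isT|have := e false (inl i) (inr j) isT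
  |have := e false (inr i) (inl j) isT|have := e false (inr i) (inr j) isT
  |have := e true (inl i) (inl j) isT|have := e true (inl i) (inr j) isT
  |have := e true (inr i) (inl j) isT|have := e true (inr i) (inr j) isT];
  rewrite /hexeq big_sumType big_bool /= /sixj ?sum_coefs /nsixj /= ?(inj_eq inl_inj) ?(inj_eq
    inr_inj)
    => /unit; apply; rewrite ?linmxE; ring.
Qed.

(** The module has a = Q, b = 3 R and t = T + 1, inverse to the formulas for [bcoefs] because 2 and
    3 are inverse modulo 5. Each identity is a linear combination of two relations of [H_rel], up to
    a multiple of 5; thus 3 (P Q + 3 Q T - 3 Q) - 3 (P Q + Q T) = 6 Q T - 9 Q is congruent to Q (T +
    1). *)
Lemma rec_rel :
  [/\ Q *m (T + 1%:M) = 0, (T + 1%:M) *m (3 *: R) = 0 & (3 *: R) *m Q = (T + 1%:M) *m (T + 1%:M)]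
  /\ [/\ P = 1%:M - Q *m (3 *: R), R = 2 *: (3 *: R) &
         S = 1%:M - 2 *: (T + 1%:M) + 3 *: ((T + 1%:M) *m (T + 1%:M))].
Proof.
have [[e1 e2 e3 e4] [e5 e6 e7 e8]] := H_rel.
move: P Q R S T e1 e2 e3 e4 e5 e6 e7 e8 => P Q R S T e1 e2 e3 e4 e5 e6 e7 e8.
have {}e1 : P *m P + Q *m R - 1%:M = 0 by rewrite e1 subrr.
have {}e5 : P *m P + 3 *: (Q *m R) - P = 0 by rewrite e5 subrr.
have {}e6 : P *m Q + 3 *: (Q *m T) - 3 *: Q = 0 by rewrite e6 subrr.
have {}e7 : R *m P + 3 *: (T *m R) - 3 *: R = 0 by rewrite e7 subrr.
have {}e4 : R *m Q + T *m T - S = 0 by rewrite e4 subrr.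
have {}e8 : R *m Q + 3 *: (T *m T) - (9 *: T + 12%:M) = 0 by rewrite e8 subrr.
have lc p q c c' (d d' X Y Z : 'M[k]_(p, q)) :
    d = 0 -> d' = 0 -> X = Y + c *: d + c' *: d' + 5 *: Z -> X = Y.
  by move=> -> -> XY; apply: (mod5 char5 (Z := Z)); rewrite XY !scaler0 !addr0.
split; split; rewrite ?(mulmxDl, mulmxDr, mulmx1, mul1mx) -?scalemxAl -?scalemxAr.
- by apply: (lc _ _ 3 (-3) _ _ _ _ (2 *: Q - Q *m T) e6 e2); lin.
- by apply: (lc _ _ (-1) 1 _ _ _ _ (T *m R) e7 e3); lin.
- by apply: (lc _ _ 3 0 _ _ _ _ (7%:M + 5 *: T - 2 *: (T *m T)) e8 e8); lin.
- by apply: (lc _ _ (-1) 1 _ _ _ _ (Q *m R) e5 e1); lin.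
- by apply: (lc _ _ 0 0 _ _ _ _ (- R) e7 e7); lin.
- by apply: (lc _ _ (-1) 1 _ _ _ _ (T + 2%:M - T *m T) e4 e8); lin.
Qed.

End Recover.

Lemma Fob_surj (W : center C) : exists D, isomorphic W (Fob D).
Proof.
have [I [l [f0 _]]] := semisimple K (hb_ob W).
have [m [n [f _]]] := frame_split f0.
have repH y := lrep_ex K f (hb W (Sb y)).
pose H y := s2val (cid2 (repH y)).
have Hrep y : lrep K f (H y) (hb W (Sb y)) by exact: s2valP (cid2 (repH y)).
have Hsupp y s b d : ~~ (fus y (isX b) s && fus (isX d) y s) -> H y s b d = 0.
  by move: s b d; exact: s2valP' (cid2 (repH y)).
have [[at0 tb0 batt] [eP eR eS]] := rec_rel Hrep Hsupp.
have HE := H_coefs Hrep Hsupp.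
move: at0 tb0 batt eP eR eS HE.
set P := mxof _ _ _; set Q := mxof _ _ _; set R := mxof _ _ _; set S := mxof _ _ _;
  set T := mxof _ _ _.
move=> at0 tb0 batt eP eR eS HE.
pose D : bcat k := Bmod at0 tb0 batt; exists D.
have HD y s b d : H y s b d = bcoefs D y s b d.
  rewrite HE /bcoefs /modP /modS /modT /= -eS -eR -eP.
  by case: y => //; case: s; case: b => b; case: d => d; rewrite //= addrK.
have delta0 (b d : 'I_m + 'I_n) : isX b != isX d -> (b == d)%:R = 0 :> k.
  by have [->|_] := eqVneq b d; rewrite ?eqxx.
(* W and [Fob D] have the same coefficients in their respective frames, so the identity matrix
   between the frames is braided in both directions. *)
have br1 : fmor f (sumfr sums m n) (fun b d => (b == d)%:R) \in braided W (Fob D).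
  apply: (braided_simple K) => y; rewrite Fob_hb.
  apply: (fmor_braided (Hrep y) (@F_hb_rep _ _ _ K sums D y)) => [|s b d]; first exact: delta0.
  rewrite (bigD1 b) //= big1 => [|c ne]; last by rewrite eq_sym (negPf ne) mul0r.
  rewrite [in RHS](bigD1 d) //= [X in _ = _ + X]big1 => [|c ne]; last by rewrite (negPf ne) mulr0.
  by rewrite !eqxx mul1r mulr1 !addr0 HD.
have br2 : fmor (sumfr sums m n) f (fun b d => (b == d)%:R) \in braided (Fob D) W.
  apply: (braided_simple K) => y; rewrite Fob_hb.
  apply: (fmor_braided (@F_hb_rep _ _ _ K sums D y) (Hrep y)) => [|s b d]; first exact: delta0.
  rewrite (bigD1 b) //= big1 => [|c ne]; last by rewrite eq_sym (negPf ne) mul0r.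
  rewrite [in RHS](bigD1 d) //= [X in _ = _ + X]big1 => [|c ne]; last by rewrite (negPf ne) mulr0.
  by rewrite !eqxx mul1r mulr1 !addr0 HD.
have delta_comp (b d : 'I_m + 'I_n) : \sum_c (b == c)%:R * (c == d)%:R = (b == d)%:R :> k.
  rewrite (bigD1 b) //= big1 => [|c ne]; last by rewrite eq_sym (negPf ne) mul0r.
  by rewrite eqxx mul1r addr0.
exists (ZHom br1), (ZHom br2); split; apply: val_inj => /=;
  (rewrite fmor_comp; last exact: delta0).
  rewrite -[RHS](fmor_id f); congr fmor; apply/funext => b; apply/funext => d.
  exact: delta_comp.
rewrite -[RHS](fmor_id (sumfr sums m n)); congr fmor; apply/funext => b; apply/funext => d.
exact: delta_comp.
Qed.

Lemma dsum_Fob (I : finType) (E : I -> bcat k) D :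
  is_dsum E D -> is_dsum (fun a => Fob (E a)) (Fob D).
Proof.
case=> i [p [ip1 ip0 pi1]]; exists (fun a => Fhom (i a)), (fun a => Fhom (p a)); split.
- by move=> a; rewrite -Fhom_comp ip1 Fhom_id.
- by move=> a b ab; rewrite -Fhom_comp ip0 // Fhom0.
have FhomS (F : I -> hom D D) : Fhom (\sum_a F a) = \sum_a Fhom (F a).
  by elim/big_rec2: _ => [|a u v _ <-]; rewrite ?Fhom0 ?FhomD.
by rewrite -Fhom_id -pi1 FhomS; apply: eq_bigr => a _; rewrite Fhom_comp.
Qed.

Lemma Fob_zero D : is_zero (Fob D) -> is_zero D.
Proof. by move=> z; apply: (@Fhom_inj _ char5 _ _ K sums); rewrite Fhom_id Fhom0. Qed.

(** Full faithfulness lets zero objects, idempotents and isomorphisms be tested on modules. An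
    indecomposable W comes from a nonzero module, which has one of the ten as a direct summand; the
    complement must then be zero. *)
Theorem center_classification : exists Z : 'I_10 -> center C,
  [/\ forall i, indecomposable (Z i),
      forall i j, isomorphic (Z i) (Z j) -> i = j
    & forall W : center C, indecomposable W -> exists i, isomorphic W (Z i)].
Proof.
exists (fun i => Fob (tnth (string_modules k) i)); split.
- move=> i; have [nz loc] := string_local k i.
  apply: local_end_indecomposable => [/Fob_zero //|w ww].
  have [u wE] := Fhom_surj w; have uu : u ;; u = u.
    by apply: (@Fhom_inj _ char5 _ _ K sums); rewrite Fhom_comp -wE.
  by rewrite wE; case: (loc u uu) => ->; [left; rewrite Fhom0|right; rewrite Fhom_id].
- move=> i j [w [w' [ww' w'w]]]; apply: string_inj.
  have [u uE] := Fhom_surj w; have [u' uE'] := Fhom_surj w'; exists u, u'.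
  by split; apply: (@Fhom_inj _ char5 _ _ K sums); rewrite Fhom_comp -uE -uE' Fhom_id.
move=> W [Wnz Wind]; have [D iWD] := Fob_surj W.
have iDW := isomorphic_sym iWD.
have Dnz : ~ is_zero D.
  move=> z; apply: Wnz; have [f [g [fg _]]] := iWD.
  have z' : idm (Fob D) = 0 by rewrite -Fhom_id [idm D]z Fhom0.
  by change (idm W = 0); rewrite -fg -[f]compm1 z' compm0 comp0m.
have [i [u [v [w [uvw _]]]]] := string_retract Dnz.
rewrite -compA in uvw; have [G dD] := retract_dsum uvw; exists i.
have dW := is_dsum_transport (dsum_Fob dD) iDW.
have dW' : is_dsum (fun b : bool => if b then Fob (tnth (string_modules k) i) else Fob G) W.
  by congr is_dsum: dW; apply/funext; case.
have [/Fob_zero z|z] := Wind _ _ dW'; first by case: (string_local k i).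
exact: dsum_zero_iso dW' z.
Qed.

End Main.

(** * The skeleton of Ver5plus *)

Section Verlinde.
Context (k : fieldType) (char5 : 5%N \in [pchar k]).

Local Notation G := [set: 'Z_5].
Local Notation neg := (negligible_ideal k G).
Local Notation J := (jordan3_rep char5).

Definition srep (b : bool) : representation k G := if b then J else triv_rep k G.

Lemma sum_of_1_L3_simple (b : bool) : sum_of_1_L3 char5 (srep b).
Proof.
apply: (sum_of_1_L3_iso (U := srep b)); first by case: b; [right|left].
by exists (idm _), (idm _); rewrite comp1m.
Qed.

Definition sob (b : bool) : Ver5plus char5 := exist _ (srep b : Ver5 k) (sum_of_1_L3_simple b).

Definition jordan_list := [:: [:: 1; 1; 0]; [:: 0; 1; 1]; [:: 0; 0; 1]]%N.
Definition rep_list b n := if b then npow 3 jordan_list n else nid 1.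

Lemma srepE b (x : 'Z_5) : srep b x = nat_mx k (rdegree (srep b)) (rdegree (srep b)) (rep_list
  b x).
Proof. by case: b; [exact: jordan3X|exact: nidE]. Qed.

Local Notation o0 := (Ordinal (isT : (0 < 3)%N)).
Local Notation o1 := (Ordinal (isT : (1 < 3)%N)).
Local Notation o2 := (Ordinal (isT : (2 < 3)%N)).

Lemma sum_ord3 (F : 'I_3 -> k) : \sum_i F i = F o0 + (F o1 + F o2).
Proof.
rewrite !big_ord_recl big_ord0 addr0; congr (_ + (_ + _)); congr F; exact: val_inj.
Qed.

Lemma jordan3_mulE n (A : 'M[k]_(3, n)) j : let B := jordan3 k *m A in
  [/\ B o0 j = A o0 j + A o1 j, B o1 j = A o1 j + A o2 j & B o2 j = A o2 j].
Proof.
by split; rewrite mxE sum_ord3 !mxE /= ?mul1r ?mul0r ?addr0 ?add0r.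
Qed.

Lemma mul_jordan3E n (A : 'M[k]_(n, 3)) i : let B := A *m jordan3 k in
  [/\ B i o0 = A i o0, B i o1 = A i o0 + A i o1 & B i o2 = A i o1 + A i o2].
Proof.
by split; rewrite mxE sum_ord3 !mxE /= ?mulr1 ?mulr0 ?addr0 ?add0r.
Qed.

(** Commuting with a Jordan block makes [f] triangular with constant diagonal; entries above the
    diagonal contribute nothing to traces of products. *)
Lemma rmx_JJ (f : rhom J J) :
  [/\ rmx f o1 o0 = 0, rmx f o2 o0 = 0, rmx f o2 o1 = 0, rmx f o1 o1 = rmx f o0 o0
    & rmx f o2 o2 = rmx f o0 o0].
Proof.
have := rmxC f (in_setT (1 : 'Z_5)); rewrite /= expr1 => e.
have L j := jordan3_mulE (rmx f : 'M_3) j; have R i := mul_jordan3E (rmx f : 'M_3) i.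
rewrite /= e in L.
have [a00 a01 a02] := L o0; have [a10 a11 a12] := L o1; have [a20 a21 a22] := L o2.
have [b00 b01 b02] := R o0; have [b10 b11 b12] := R o1; have [b20 b21 b22] := R o2.
have f10 : rmx f o1 o0 = 0 by move: a00; rewrite b00 -[LHS]addr0 => /addrI.
have f20 : rmx f o2 o0 = 0 by move: a01; rewrite b10 -[LHS]addr0 => /addrI.
have f21 : rmx f o2 o1 = 0 by move: a11; rewrite b11 f10 add0r -[LHS]addr0 => /addrI.
have f11 : rmx f o1 o1 = rmx f o0 o0 by move: a10; rewrite b01 addrC => /addrI.
by split=> //; rewrite -f11; move: a21; rewrite b12 addrC => /addrI.
Qed.

Lemma rmx_1J (f : rhom (triv_rep k G) J) : rmx f 0 o0 = 0 /\ rmx f 0 o1 = 0.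
Proof.
have := rmxC f (in_setT (1 : 'Z_5)); rewrite /= expr1 mul1mx => e.
have [] := mul_jordan3E (rmx f : 'M_(1, 3)) 0; rewrite -e => _ e1 e2; split.
  by move: e1; rewrite -[LHS]add0r => /addIr.
by move: e2; rewrite -[LHS]add0r => /addIr.
Qed.

Lemma rmx_J1 (f : rhom J (triv_rep k G)) : rmx f o1 0 = 0 /\ rmx f o2 0 = 0.
Proof.
have := rmxC f (in_setT (1 : 'Z_5)); rewrite /= expr1 mulmx1 => e.
have [e1 e2 _] := jordan3_mulE (rmx f : 'M_(3, 1)) 0; rewrite e in e1 e2; split.
  by move: e1; rewrite -[LHS]addr0 => /addrI.
by move: e2; rewrite -[LHS]addr0 => /addrI.
Qed.

Lemma trace_JJ (f g : rhom J J) : \tr (rmx f *m rmx g) = 3 * (rmx f o0 o0 * rmx g o0 o0).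
Proof.
have [f10 f20 f21 f11 f22] := rmx_JJ f; have [g10 g20 g21 g11 g22] := rmx_JJ g.
rewrite /mxtrace sum_ord3 ![(_ *m _) _ _]mxE !sum_ord3 f10 f20 f21 f11 f22 g10 g20 g21 g11 g22.
by ring.
Qed.

(** A map from the trivial representation lands in the invariant line of the Jordan block, which
    every map back kills. *)
Lemma trace_1J (f : rhom (triv_rep k G) J) (g : rhom J (triv_rep k G)) :
  \tr (rmx f *m rmx g) = 0.
Proof.
have [f0 f1] := rmx_1J f; have [g1 g2] := rmx_J1 g.
by rewrite /mxtrace big_ord1 mxE sum_ord3 f0 f1 g2 !mul0r mulr0 !addr0.
Qed.

Lemma qpi_eq0 (V W : representation k G) (f : rhom V W) :
  (forall g : rhom W V, \tr (rmx f *m rmx g) = 0) -> qpi neg f = 0.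
Proof.
move=> f0; rewrite -(qpi0 neg); apply/qpiP/negligibleP => g.
by rewrite subr0.
Qed.

Lemma qpi_orth x y (f : rhom (srep x) (srep y)) : x != y -> qpi neg f = 0.
Proof.
case: x f; case: y => // f _; apply: qpi_eq0 => g; last exact: trace_1J.
by rewrite mxtrace_mulC trace_1J.
Qed.

Definition top_index b : 'I_(rdegree (srep b)) :=
  if b as b0 return 'I_(rdegree (srep b0)) then o0 else 0.

(** Subtracting the diagonal scalar leaves a strictly triangular matrix, and its product with any
    endomorphism, again triangular, has trace 0. *)
Lemma qpi_scalar x (f : rhom (srep x) (srep x))
  : qpi neg f = rmx f (top_index x) (top_index x) *: qpi neg (rid _).
Proof.
rewrite -qpiZ; apply/qpiP/negligibleP => g.
have -> : rmx (f - rmx f (top_index x) (top_index x) *: rid (srep x))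
  = rmx f - rmx f (top_index x) (top_index x) *: 1%:M by [].
rewrite mulmxBl -scalemxAl mul1mx raddfB /= mxtraceZ.
case: x f g => f g /=; last by rewrite /mxtrace !big_ord1 mxE big_ord1 subrr.
have [g10 g20 g21 g11 g22] := rmx_JJ g.
by rewrite trace_JJ /mxtrace sum_ord3 g11 g22; ring.
Qed.

(* The matrices from which Defs decomposes L3 \ox L3, local to a section there. *)
Definition inc_XX1 := [:: [:: 0; 0; 3; 0; 2; 4; 3; 4; 1]]%N.
Definition prj_XX1 := [:: [:: 0]; [:: 3]; [:: 4]; [:: 1]; [:: 1]; [:: 0]; [:: 4]; [:: 0];
  [:: 0]]%N.
Definition inc_XXX := [:: [:: 0; 3; 4; 2; 3; 4; 0; 1; 2]; [:: 0; 0; 3; 0; 0; 0; 2; 0; 3];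
  [:: 0; 0; 0; 0; 0; 3; 0; 2; 0]]%N.
Definition prj_XXX := [:: [:: 0; 0; 2]; [:: 1; 1; 2]; [:: 0; 1; 0]; [:: 4; 4; 3];
  [:: 0; 0; 0]; [:: 0; 0; 1]; [:: 0; 4; 0]; [:: 0; 0; 4]; [:: 0; 0; 0]]%N.

(** The empty list denotes a zero matrix, through the default values in [ent]. Identity matrices
    serve for products with 1 because row-major indexing keeps the basis in place. *)
Definition inc_list x y r : seq (seq nat) :=
  match x, y, r with
  | true, true, true => inc_XXX | true, true, false => inc_XX1
  | true, false, true | false, true, true => nid 3
  | false, false, false => nid 1
  | _, _, _ => [::]
  end.

Definition prj_list x y r : seq (seq nat) :=
  match x, y, r with
  | true, true, true => prj_XXX | true, true, false => prj_XX1
  | true, false, true | false, true, true => nid 3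
  | false, false, false => nid 1
  | _, _, _ => [::]
  end.

Local Notation deg b := (rdegree (srep b)).

Lemma tens_srepE x y (g : 'Z_5) : tens_rep (srep x) (srep y) g =
  nat_mx k (deg x * deg y) (deg x * deg y) (ntens (deg x) (deg x) (deg y) (deg y) (rep_list x
    g) (rep_list y g)).
Proof. by rewrite /= !srepE (ntensE char5). Qed.

Lemma inc_intertwiner x y r :
  nat_mx k (deg r) (deg x * deg y) (inc_list x y r) \in intertwiner (srep r) (tens_rep (srep x)
    (srep y)).
Proof.
apply/intertwinerP => g _; rewrite srepE tens_srepE !(nmulE char5); apply: congr1.
by move: g; case: x; case: y; case: r; apply: forall_Z5; vm_compute.
Qed.

Lemma prj_intertwiner x y r :
  nat_mx k (deg x * deg y) (deg r) (prj_list x y r) \in intertwiner (tens_rep (srep x) (srep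
    y)) (srep r).
Proof.
apply/intertwinerP => g _; rewrite srepE tens_srepE !(nmulE char5); apply: congr1.
by move: g; case: x; case: y; case: r; apply: forall_Z5; vm_compute.
Qed.

Definition incR x y r : rhom (srep r) (tens_rep (srep x) (srep y)) :=
  RHom (inc_intertwiner x y r).
Definition prjR x y r : rhom (tens_rep (srep x) (srep y)) (srep r) :=
  RHom (prj_intertwiner x y r).

Lemma q_orth x y (F : qhom neg (srep x) (srep y)) : x != y -> F = 0.
Proof. by rewrite -(qpi_repr F); apply: qpi_orth. Qed.

Lemma q_scalar x (F : qhom neg (srep x) (srep x)) : exists c, F = c *: qpi neg (rid (srep x)).
Proof. by rewrite -(qpi_repr F); eexists; exact: qpi_scalar. Qed.

(** The trace of the identity is 1 or 3, nonzero modulo 5, so the identity is not negligible. *)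
Lemma q_id_neq0 x : qpi neg (rid (srep x)) <> 0.
Proof.
rewrite -(qpi0 neg) => /qpiP/negligibleP/(_ (rid (srep x))).
rewrite subr0 /= mulmx1 mxtrace1; case: x => /=; last exact/eqP/oner_neq0.
by move/eqP; rewrite -(dvdn_pcharf char5).
Qed.

Lemma q_inc_prj x y r : qcomp (qpi neg (incR x y r)) (qpi neg (prjR x y r)) =
  (fus x y r)%:R *: qpi neg (rid (srep r)).
Proof.
rewrite qcompE -qpiZ; apply: congr1; apply: val_inj => /=.
rewrite (nmulE char5); case e: (fus x y r); rewrite ?scale1r ?scale0r ?(nidE char5) ?(n0E char5);
  apply: congr1; move: e; by case: x; case: y; case: r => //= _; vm_compute.
Qed.

(** Exact already for representations, except for X \ox X: there the remaining summand is free, its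
    projector is a relative trace, and so it is negligible. *)
Lemma q_prj_inc x y :
  qcomp (qpi neg (prjR x y true)) (qpi neg (incR x y true)) +
  qcomp (qpi neg (prjR x y false)) (qpi neg (incR x y false)) =
  qpi neg (rid (tens_rep (srep x) (srep y))).
Proof.
rewrite addrC !qcompE -qpiD; case e: (x && y); last first.
  apply: congr1; apply: val_inj => /=.
  rewrite !(nmulE char5) (naddE char5) (nidE char5); apply: congr1; move: e.
  by case: x; case: y => //= _; vm_compute.
case: x e; case: y => // _; apply/qpiP/negligibleP => h /=.
have := @sq_jordan3_dec _ char5; cbv zeta => ->.
rewrite opprD addrA subrr sub0r mulNmx raddfN /=.
by rewrite rel_trace_negligible oppr0.
Qed.

Definition reindex_list m n := nmk m n (fun i j => (i == j)%N).

Lemma reindexE m n : reindex_mx m n = nat_mx k m n (reindex_list m n).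
Proof. by apply/matrixP => i j; rewrite (nmkE char5) mxE. Qed.

(** Mirrors [sixjR] factor by factor in arithmetic of natural numbers modulo 5, so that all 64
    symbols are evaluated by computation. Modulo negligible morphisms the composite is a scalar,
    read off at the entry (0, 0). *)
Definition sixj_list x y w r s t : seq (seq nat) :=
  let dx := deg x in let dy := deg y in let dw := deg w in
  let dr := deg r in let ds := deg s in let dt := deg t in
  nmul dr (dt * dw) dr
    (nmul dr (dx * dy * dw) (dt * dw)
      (nmul dr (dx * (dy * dw)) (dx * dy * dw)
        (nmul dr (dx * ds) (dx * (dy * dw)) (inc_list x s r)
          (ntens dx dx ds (dy * dw) (nid dx) (inc_list y w s)))
        (reindex_list (dx * (dy * dw)) (dx * dy * dw)))
      (ntens (dx * dy) dt dw dw (prj_list x y t) (nid dw)))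
    (prj_list t w r).

Lemma sixj_listE x y w r s t : ent (sixj_list x y w r s t) 0 0 = nsixj x y w r s t.
Proof. by case: x; case: y; case: w; case: r; case: s; case: t; vm_compute. Qed.

Definition sixjR x y w r s t : rhom (srep r) (srep r) :=
  rcomp (rcomp (rcomp (rcomp (incR x s r) (rtens (rid (srep x)) (incR y w s)))
    (riassoc (srep x) (srep y) (srep w))) (rtens (prjR x y t) (rid (srep w)))) (prjR t w r).

Lemma sixjRE x y w r s t : rmx (sixjR x y w r s t)
  = nat_mx k (deg r) (deg r) (sixj_list x y w r s t).
Proof. by rewrite /= reindexE !(nidE char5) !(ntensE char5) !(nmulE char5). Qed.

Lemma qpi_sixj x y w r s t :
  qpi neg (sixjR x y w r s t) = sixj x y w r s t *: qpi neg (rid (srep r)).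
Proof.
rewrite qpi_scalar sixjRE mxE; congr (_%:R *: _); rewrite -sixj_listE.
by case: r.
Qed.

Lemma q_sixj x y w r s t :
  qcomp (qcomp (qcomp (qcomp (qpi neg (incR x s r)) (qtensm (qpi neg (rid (srep x))) (qpi neg
    (incR y w s))))
    (qpi neg (riassoc (srep x) (srep y) (srep w))))
    (qtensm (qpi neg (prjR x y t)) (qpi neg (rid (srep w))))) (qpi neg (prjR t w r)) =
  sixj x y w r s t *: qpi neg (rid (srep r)).
Proof. by rewrite !qtensmE !qcompE -qpi_sixj. Qed.

Definition incV x y r : hom (sob r) (sob x \ox sob y) := qpi neg (incR x y r).
Definition prjV x y r : hom (sob x \ox sob y) (sob r) := qpi neg (prjR x y r).

Lemma Ver5plus_schur x y (f : hom (sob x) (sob y)) : exists c, f = c *: lid sob x y.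
Proof.
have [e|ne] := boolP (x == y).
  move/eqP: e f => <- f; rewrite lidxx; exact: q_scalar.
exists 0; rewrite scale0r; exact: q_orth.
Qed.

Lemma Ver5plus_semisimple (V : Ver5plus char5) :
  exists (I : finType) (l : I -> bool) (_ : frame sob l V), True.
Proof.
have [I [T [T1 dV]]] := svalP V.
have /boolp.choice[l lE] : forall a, exists b, T a = srep b.
  by move=> a; case: (T1 a) => ->; [exists false|exists true].
have TE : T = fun a => srep (l a) by apply/funext.
move: dV; rewrite TE => dV; exists I, l; exact: (@frame_of_dsum _ _ _ sob _ l V dV).
Qed.

Lemma sixj0 x y w r s t : ~~ fus x y t -> sixj x y w r s t = 0 :> k.
Proof. by case: x; case: y; case: w; case: r; case: s; case: t. Qed.

Lemma prjV_incV x y : \sum_r prjV x y r ;; incV x y r = idm (sob x \ox sob y).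
Proof. rewrite big_bool; exact: q_prj_inc. Qed.

Lemma Ver5plus_sixj x y w r s :
  incV x s r ;; (idm (sob x) \om incV y w s) ;; iassoc (sob x) (sob y) (sob w) =
  \sum_t sixj x y w r s t *: (incV t w r ;; (incV x y t \om idm (sob w))).
Proof.
apply: (expand_triple (prj := prjV)).
- by move=> a b g; apply: q_orth.
- exact: prjV_incV.
- move=> t; exact: q_sixj.
Qed.

Definition Ver5plus_skeleton : skeleton sob fus sixj :=
  @Skeleton k (Ver5plus char5) _ sob fus sixj Ver5plus_schur q_id_neq0 Ver5plus_semisimple incV
    prjV
    q_inc_prj prjV_incV sixj0 Ver5plus_sixj.

End Verlinde.

(** * Direct sums of copies of 1 and X *)

Section Sums.
Context (k : fieldType) (char5 : 5%N \in [pchar k]) (m n : nat).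
Local Notation G := [set: 'Z_5].
Local Notation neg := (negligible_ideal k G).
Local Notation J := (jordan3_rep char5).

(** The Kronecker product of an identity matrix with the Jordan block stands for [n] copies of it,
    so the action on the whole sum is a single closed formula. *)
Lemma sum_repr : mx_repr G (fun x => block_mx 1%:M 0 0 ((1%:M : 'M[k]_n) *t J x)
  : 'M[k]_(m + n * 3)).
Proof.
split=> [|x y Gx Gy]; first by rewrite repr_mx1 tensmx11 -scalar_mx_block.
rewrite mulmx_block !(mulmx0, mul0mx, addr0, add0r, mul1mx) tensmx_mul mul1mx.
by rewrite repr_mxM.
Qed.

Definition sum_rep : representation k G := Representation (MxRepresentation sum_repr).

Lemma sum_incl_1 (i : 'I_m) : row_mx (delta_mx 0 i) 0 \in intertwiner (triv_rep k G) sum_rep.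
Proof.
apply/intertwinerP => x _ /=.
by rewrite mul1mx mul_row_block !(mulmx0, mul0mx, addr0, mulmx1).
Qed.

Lemma sum_proj_1 (i : 'I_m) : col_mx (delta_mx i 0) 0 \in intertwiner sum_rep (triv_rep k G).
Proof.
apply/intertwinerP => x _ /=.
by rewrite mulmx1 mul_block_col !(mulmx0, mul0mx, addr0, mul1mx).
Qed.

(** Well typed because [1 * 3] computes to [3]. The same conversion lets [row3] and [col3] be
    treated as Kronecker products in the lemmas below. *)
Lemma one_tens (M : 'M[k]_3) : (1%:M : 'M[k]_1) *t M = M.
Proof.
apply/matrixP => i j; have iE : i = mxtens_index (ord0 : 'I_1, i) by apply: val_inj.
have jE : j = mxtens_index (ord0 : 'I_1, j) by apply: val_inj.
by rewrite {1}iE {1}jE tensmxE mxE mul1r.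
Qed.

Definition row3 (j : 'I_n) : 'M[k]_(3, n * 3) :=
  (delta_mx 0 j : 'M[k]_(1, n)) *t (1%:M : 'M[k]_3).
Definition col3 (j : 'I_n) : 'M[k]_(n * 3, 3) :=
  (delta_mx j 0 : 'M[k]_(n, 1)) *t (1%:M : 'M[k]_3).

Lemma mul_row3 j (M : 'M[k]_3) : M *m row3 j = row3 j *m (1%:M *t M).
Proof.
have e1 := tensmx_mul (1%:M : 'M[k]_1) M (delta_mx 0 j : 'M[k]_(1, n)) 1%:M.
have e2 := tensmx_mul (delta_mx 0 j : 'M[k]_(1, n)) 1%:M (1%:M : 'M[k]_n) M.
rewrite one_tens mul1mx mulmx1 in e1; rewrite mul1mx mulmx1 in e2.
exact: etrans e1 (esym e2).
Qed.

Lemma mul_col3 j (M : 'M[k]_3) : (1%:M *t M) *m col3 j = col3 j *m M.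
Proof.
have e1 := tensmx_mul (delta_mx j 0 : 'M[k]_(n, 1)) 1%:M (1%:M : 'M[k]_1) M.
have e2 := tensmx_mul (1%:M : 'M[k]_n) M (delta_mx j 0 : 'M[k]_(n, 1)) 1%:M.
rewrite one_tens mul1mx mulmx1 in e1; rewrite mul1mx mulmx1 in e2.
exact: etrans e2 (esym e1).
Qed.

Lemma row3_col3 i j : row3 i *m col3 j = if i == j then 1%:M else 0.
Proof.
have e := tensmx_mul (delta_mx 0 i : 'M[k]_(1, n)) 1%:M (delta_mx j 0 : 'M[k]_(n, 1)) (1%:M
  : 'M[k]_3).
apply: (etrans e); rewrite mulmx1; have [->|ne] := eqVneq i j;
  last by rewrite mul_delta_mx_0 // tens0mx.
rewrite mul_delta_mx (_ : delta_mx 0 0 = 1%:M); first exact: one_tens.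
by apply/matrixP => a b; rewrite !ord1 !mxE.
Qed.

Lemma sum_col3_row3 : \sum_j col3 j *m row3 j = 1%:M.
Proof.
transitivity (\sum_j (delta_mx j j : 'M[k]_n) *t (1%:M : 'M[k]_3)).
  apply: eq_bigr => j _.
  have := tensmx_mul (delta_mx j 0 : 'M[k]_(n, 1)) 1%:M (delta_mx 0 j : 'M[k]_(1, n)) (1%:M
    : 'M[k]_3).
  by rewrite mulmx1 mul_delta_mx.
rewrite -tensmx11 (@mx1_sum_delta _ n).
rewrite (big_morph (fun A : 'M[k]_n => A *t (1%:M : 'M[k]_3)) (id1 := 0) (op1 :=
  +%R)) // ?tens0mx // => A B.
by rewrite -[A in LHS]scale1r tensmxDl scale1r.
Qed.

Lemma sum_incl_3 (j : 'I_n) : row_mx 0 (row3 j) \in intertwiner J sum_rep.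
Proof.
apply/intertwinerP => x _ /=.
by rewrite mul_mx_row mul_row_block !(mulmx0, mul0mx, addr0, add0r) mul_row3.
Qed.

Lemma sum_proj_3 (j : 'I_n) : col_mx 0 (col3 j) \in intertwiner sum_rep J.
Proof.
apply/intertwinerP => x _ /=.
by rewrite mul_block_col mul_col_mx !(mulmx0, mul0mx, addr0, add0r) mul_col3.
Qed.

Local Notation I := ('I_m + 'I_n)%type.
Definition sum_inc (c : I) : rhom (srep char5 (isX c)) sum_rep :=
  match c with inl i => RHom (sum_incl_1 i) | inr j => RHom (sum_incl_3 j) end.
Definition sum_prj (c : I) : rhom sum_rep (srep char5 (isX c)) :=
  match c with inl i => RHom (sum_proj_1 i) | inr j => RHom (sum_proj_3 j) end.

Lemma sum_inc_prj c : rcomp (sum_inc c) (sum_prj c) = rid (srep char5 (isX c)).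
Proof.
apply: val_inj; case: c => i /=; rewrite mul_row_col.
  by rewrite mul0mx addr0 mul_delta_mx; apply/matrixP => a b; rewrite !ord1 !mxE.
by rewrite mul0mx add0r row3_col3 eqxx.
Qed.

Lemma sum_inc_prj0 c d : c != d -> rcomp (sum_inc c) (sum_prj d) = 0.
Proof.
move=> ne; apply: val_inj; case: c ne => i; case: d => j /= ne; rewrite mul_row_col.
- by rewrite mul0mx addr0 mul_delta_mx_0.
- by rewrite mulmx0 mul0mx addr0.
- by rewrite mulmx0 mul0mx addr0.
by rewrite mul0mx add0r row3_col3; have [ij|] := eqVneq i j; first rewrite ij eqxx in ne.
Qed.

Lemma sum_prj_inc : \sum_c rcomp (sum_prj c) (sum_inc c) = rid sum_rep.
Proof.
apply: val_inj; rewrite raddf_sum big_sumType /=.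
have -> : 1%:M = block_mx 1%:M 0 0 0 + block_mx 0 0 0 1%:M :> 'M[k]_(m + n * 3).
  by rewrite add_block_mx !addr0 add0r -scalar_mx_block.
congr (_ + _).
  rewrite (@mx1_sum_delta _ m) (big_morph (fun A : 'M[k]_m => block_mx A 0 0 0) (id1 :=
    0) (op1 := +%R)).
  - by apply: eq_bigr => i _; rewrite mul_col_row !(mulmx0, mul0mx) mul_delta_mx.
  - by move=> A B; rewrite add_block_mx !addr0.
  - by rewrite block_mx0.
rewrite -sum_col3_row3 (big_morph (fun A : 'M[k]_(n * 3) => block_mx 0 0 0 A) (id1 :=
  0) (op1 := +%R)).
- by apply: eq_bigr => i _; rewrite mul_col_row !(mulmx0, mul0mx).
- by move=> A B; rewrite add_block_mx !addr0.
- by rewrite block_mx0.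
Qed.

Lemma sums_exist : exists (V : Ver5plus char5) (_ : frame (sob char5) (@isX m n) V), True.
Proof.
have ip1 c : qcomp (qpi neg (sum_inc c)) (qpi neg (sum_prj c)) = qpi neg (rid _).
  by rewrite qcompE; apply: congr1; exact: sum_inc_prj.
have ip0 c d : c != d -> qcomp (qpi neg (sum_inc c)) (qpi neg (sum_prj d)) = 0.
  by move=> ne; rewrite qcompE -[RHS](qpi0 neg); apply: congr1; exact: sum_inc_prj0.
have pi1 : \sum_c qcomp (qpi neg (sum_prj c)) (qpi neg (sum_inc c)) = qpi neg (rid sum_rep).
  by under eq_bigr do rewrite qcompE; rewrite -(qpi_sum neg); apply: congr1; exact: sum_prj_inc.
have dS : is_dsum (fun c : I => srep char5 (isX c) : Ver5 k) (sum_rep : Ver5 k).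
  by exists (fun c => qpi neg (sum_inc c)), (fun c => qpi neg (sum_prj c)); split.
have P : sum_of_1_L3 char5 (sum_rep : Ver5 k).
  exists I, (fun c : I => srep char5 (isX c) : Ver5 k); split=> //.
  by case=> i; [left|right].
exists (exist _ (sum_rep : Ver5 k) P).
exact: (@frame_of_dsum _ (Ver5plus char5) _ (sob char5) _ (@isX m n) (exist _ _ P) dS).
Qed.

End Sums.

Theorem corollary4p1 (k : closedFieldType) (char5 : 5%N \in [pchar k]) :
  exists Z : 'I_10 -> center (Ver5plus char5),
    [/\ forall i, indecomposable (Z i),
        forall i j, isomorphic (Z i) (Z j) -> i = j
      & forall W : center (Ver5plus char5),
          indecomposable W -> exists i, isomorphic W (Z i)].
Proof. exact: (center_classification char5 (Ver5plus_skeleton char5) (sums_exist char5)). Qed.
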